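(* Let $\rho$ be a unitary representation of an acylindrically hyperbolic group $G$ on a uniformly convex Banach space $E\neq 0$, and assume that the maximal finite normal subgroup $K$ of $G$ has a non-zero fixed vector, i.e. there is $0\ne x\in E$ with $\rho(k)x=x$ for all $k\in K$. Then $\dim \widetilde{QC}(G;\rho)=\infty$.
   Context: Banach spaces are over $\mathbb{R}$ or $\mathbb{C}$, with norm $|\cdot|$; dimensions are over the corresponding scalar field. $E$ is uniformly convex if for every $\epsilon>0$ there is $\delta>0$ such that $x,y\in E$, $|x|\le 1$, $|y|\le 1$, $|x-y|\ge\epsilon$ implies $|\frac{x+y}{2}|\le 1-\delta$. For a group $G$ and a normed vector space $E$, a unitary representation of $G$ on $E$ is a homomorphism $\rho:G\to O(E)$, where $O(E)$ is the group of norm-preserving linear isomorphisms $E\to E$; write $gx=\rho(g)x$. A cocycle is a function $F:G\to E$ with $F(gg')=F(g)+gF(g')$ for all $g,g'\in G$. A quasi-cocycle is a function $F:G\to E$ with $\Delta(F):=\sup_{g,g'\in G}|F(gg')-F(g)-gF(g')|<\infty$. $QC(G;\rho)$ denotes the vector space of all quasi-cocycles, and $\widetilde{QC}(G;\rho)$ denotes the quotient of $QC(G;\rho)$ by the subspace generated by all bounded functions $G\to E$ and all cocycles. An isometric action of a group $G$ on a metric space $X$ is acylindrical if for all $B>0$ there exist $D,N$ such that whenever $x,y\in X$ and $d(x,y)>D$ there are at most $N$ elements $g\in G$ with $d(x,gx)<B$ and $d(y,gy)<B$. A group is acylindrically hyperbolic if it has an acylindrical, non-elementary isometric action on a (geodesic)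 $\delta$-hyperbolic space; non-elementary means that the limit set of $G$ in the Gromov boundary has more than two points. An acylindrically hyperbolic group has a (unique) maximal finite normal subgroup, i.e. a finite normal subgroup containing every finite normal subgroup (a known fact). *)

(* Defs.v *)
From HB Require Import structures.
From mathcomp Require Import all_boot all_order all_algebra.
From mathcomp Require Import generic_quotient ring_quotient complex.
From mathcomp Require Import all_classical all_reals all_analysis.

Set Implicit Arguments.
Unset Strict Implicit.
Unset Printing Implicit Defensive.

Import Order.TTheory GRing.Theory Num.Theory.
Import numFieldNormedType.Exports.

Local Open Scope classical_set_scope.
Local Open Scope card_scope.
Local Open Scope ring_scope.

Section Span.
Context {K : numFieldType} {V : lmodType K}.

Definition lspan (A : set V) : set V :=
  [set v | forall S : set V, submod_closed [in S] -> A `<=` S -> S v].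

Lemma sub_lspan (A : set V) : A `<=` lspan A.
Proof. by move=> v Av S _; apply. Qed.

Definition lspan_pred (A : set V) : {pred V} := [in lspan A].

Lemma lspan_submod_closed (A : set V) : submod_closed (lspan_pred A).
Proof.
split.
  by apply/mem_set => S [S0 _] _; apply/set_mem.
move=> c u v /set_mem Au /set_mem Av; apply/mem_set => S clS AS.
apply/set_mem/clS.2; apply/mem_set; [exact: Au|exact: Av].
Qed.

HB.instance Definition _ (A : set V) :=
  GRing.isSubmodClosed.Build K V (lspan_pred A) (lspan_submod_closed A).

End Span.

(** The vector space [V / lspan A]; [ring_quotient] only provides its additive
    group structure. *)
Section LmodQuotient.
Context {K : numFieldType} {V : lmodType K} (A : set V).

Definition lmod_quot : Type := Quotient.quot (lspan_pred A).

HB.instance Definition _ := GRing.Zmodule.on lmod_quot.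

Definition lmod_quot_pi (v : V) : lmod_quot :=
  \pi_(Quotient.quot (lspan_pred A))%qT v.

Lemma lmod_quot_pi_eq (u v : V) :
  lmod_quot_pi u = lmod_quot_pi v <-> lspan A (u - v).
Proof.
rewrite (_ : lspan A (u - v) = (u - v \in lspan_pred A)); last first.
  by apply/propext; split=> [/mem_set|/set_mem].
by rewrite Quotient.idealrBE; split=> [/eqP|/eqP].
Qed.

Lemma lmod_quot_pi_surj (q : lmod_quot) : exists v, lmod_quot_pi v = q.
Proof.
by exists (repr (q : Quotient.quot (lspan_pred A))); rewrite /lmod_quot_pi reprK.
Qed.

Let scale (c : K) (q : lmod_quot) : lmod_quot :=
  lmod_quot_pi (c *: (repr (q : Quotient.quot (lspan_pred A)) : V)).

Let scaleE c v : scale c (lmod_quot_pi v) = lmod_quot_pi (c *: v).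
Proof.
apply/lmod_quot_pi_eq; rewrite -scalerBr; apply/set_mem.
apply: (@rpredZ _ _ (lspan_pred A)); apply/mem_set.
by apply/lmod_quot_pi_eq; rewrite /lmod_quot_pi reprK.
Qed.

Let piD (u v : V) : lmod_quot_pi (u + v) = lmod_quot_pi u + lmod_quot_pi v.
Proof. exact: (raddfD (\pi_(Quotient.quot (lspan_pred A))%qT)). Qed.

Let scaleA a b q : scale a (scale b q) = scale (a * b) q.
Proof. by have [v <-] := lmod_quot_pi_surj q; rewrite !scaleE scalerA. Qed.

Let scale1 : left_id 1 scale.
Proof.
by move=> q; have [v <-] := lmod_quot_pi_surj q; rewrite scaleE scale1r.
Qed.

Let scaleDr : right_distributive scale +%R.
Proof.
move=> a p q; have [u <-] := lmod_quot_pi_surj p.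
have [v <-] := lmod_quot_pi_surj q.
by rewrite -piD !scaleE scalerDr piD.
Qed.

Let scaleDl q : {morph scale^~ q : a b / a + b}.
Proof.
move=> a b; have [v <-] := lmod_quot_pi_surj q.
by rewrite !scaleE scalerDl piD.
Qed.

HB.instance Definition _ :=
  GRing.Zmodule_isLmodule.Build K lmod_quot scaleA scale1 scaleDr scaleDl.

Lemma lmod_quot_pi_is_linear : linear lmod_quot_pi.
Proof. by move=> a u v; rewrite piD -scaleE. Qed.

End LmodQuotient.

Definition infinite_dimensional (K : numFieldType) (V : lmodType K) : Prop :=
  forall n : nat, exists v : 'I_n -> V, forall c : 'I_n -> K,
    \sum_(i < n) c i *: v i = 0 -> forall i, c i = 0.

(** When [K] is [R[i]], norms take their values in [K] and [x <= y] in [K]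
    means that [y - x] is a nonnegative real. *)
Definition uniformly_convex (K : numFieldType) (E : normedModType K) : Prop :=
  forall eps : K, 0 < eps -> exists2 delta : K, 0 < delta &
    forall x y : E, `|x| <= 1 -> `|y| <= 1 -> eps <= `|x - y| ->
      `|2^-1 *: (x + y)| <= 1 - delta.

Record unitary_rep (K : numFieldType) (G : groupType) (E : normedModType K) :=
  UnitaryRep {
    urep :> G -> {linear E -> E} ;
    urep_bij : forall g, bijective (urep g) ;
    urep_norm : forall g x, `|urep g x| = `|x| ;
    urep_mul : forall g h x, urep (g * h)%g x = urep g (urep h x)
  }.

Section QuasiCocycles.
Context {K : numFieldType} {G : groupType} {E : normedModType K}.
Variable rho : unitary_rep G E.
Implicit Type F : G -> E.

Definition cocycle F : Prop := forall g h, F (g * h)%g = F g + rho g (F h).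

Definition bounded_map F : Prop := exists M : K, forall g, `|F g| <= M.

Definition quasi_cocycle F : Prop :=
  exists M : K, forall g h, `|F (g * h)%g - F g - rho g (F h)| <= M.

Lemma cocycle_quasi_cocycle F : cocycle F -> quasi_cocycle F.
Proof.
by move=> cF; exists 0 => g h; rewrite cF -addrA -opprD subrr normr0.
Qed.

Lemma bounded_quasi_cocycle F : bounded_map F -> quasi_cocycle F.
Proof.
move=> [M FM]; exists (M + M + M) => g h.
apply: (le_trans (ler_normB _ _)); rewrite lerD ?urep_norm//.
by apply: (le_trans (ler_normB _ _)); rewrite lerD.
Qed.

Definition quasi_cocycle_pred : {pred G -> E} :=
  [pred F | `[< quasi_cocycle F >]].

Lemma quasi_cocycle_submod_closed : submod_closed quasi_cocycle_pred.
Proof.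
split=> [|c F F' /asboolP[M FM] /asboolP[M' FM']]; apply/asboolP.
  exists 0 => g h; have z (k : G) : (0 : G -> E) k = 0 by [].
  by rewrite !z (linear0 (rho g)) !subr0 normr0.
exists (`|c| * M + M') => g h.
have -> : (c *: F + F') (g * h)%g - (c *: F + F') g - rho g ((c *: F + F') h)
    = c *: (F (g * h)%g - F g - rho g (F h))
      + (F' (g * h)%g - F' g - rho g (F' h)).
  have z (k : G) : (c *: F + F') k = c *: F k + F' k by [].
  rewrite !z (linearP (rho g)) !scalerBr.
  by rewrite !opprD (addrACA (c *: F _)) [LHS]addrACA.
apply: (le_trans (ler_normD _ _)); rewrite lerD// normrZ ler_wpM2l//.
Qed.

HB.instance Definition _ :=
  GRing.isSubmodClosed.Build K (G -> E) quasi_cocycle_pred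
    quasi_cocycle_submod_closed.

Record QC : Type := MkQC {
  QC_val :> G -> E ;
  QC_valP : QC_val \in quasi_cocycle_pred
}.

HB.instance Definition _ := [isSub for QC_val].
HB.instance Definition _ := [Choice of QC by <:].
HB.instance Definition _ := [SubChoice_isSubLmodule of QC by <:].

(** All bounded maps and all cocycles lie in [QC], by [bounded_quasi_cocycle]
    and [cocycle_quasi_cocycle]. *)
Definition QCtilde : Type :=
  lmod_quot [set F : QC | bounded_map F \/ cocycle F].
HB.instance Definition _ := GRing.Lmodule.on QCtilde.

End QuasiCocycles.

Section Hyperbolic.
Context {R : realType} {X : metricType R}.
Implicit Types (p x y z : X) (u v : nat -> X).

Definition gromov_product p x y : R :=
  (mdist p x + mdist p y - mdist x y) / 2.

Definition hyperbolic_with (delta : R) : Prop := forall p x y z,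
  Num.min (gromov_product p x y) (gromov_product p y z) - delta
    <= gromov_product p x z.

Definition geodesic : Prop := forall x y, exists c : R -> X,
  [/\ c 0 = x, c (mdist x y) = y &
      forall s t, 0 <= s <= mdist x y -> 0 <= t <= mdist x y ->
        mdist (c s) (c t) = `|s - t|].

Definition asymptotic u v : Prop := forall p,
  gromov_product p (u ij.1) (v ij.2) @[ij --> (\oo, \oo)] --> +oo.

Definition converges_to_infinity u : Prop := asymptotic u u.

(** Points are the equivalence classes, under [asymptotic], of the sequences
    converging to infinity. *)
Definition gromov_boundary : set (set (nat -> X)) :=
  [set xi | exists2 u, converges_to_infinity u &
    xi = [set v | converges_to_infinity v /\ asymptotic u v]].

End Hyperbolic.
Arguments hyperbolic_with {R} X delta.
Arguments geodesic {R} X.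
Arguments gromov_boundary {R} X.

Section Actions.
Context {R : realType} {G : groupType} {X : metricType R}.
Variable act : G -> X -> X.

Definition isometric_action : Prop :=
  [/\ forall x, act 1%g x = x,
      forall g h x, act (g * h)%g x = act g (act h x) &
      forall g x y, mdist (act g x) (act g y) = mdist x y].

Definition acylindrical : Prop := forall B : R, 0 < B ->
  exists (D : R) (N : nat), forall x y : X, D < mdist x y ->
    [set g | mdist x (act g x) < B /\ mdist y (act g y) < B] #<= `I_N.

(** For an isometric action on a hyperbolic space, the boundary points obtained
    from the orbit of [x] do not depend on [x]. *)
Definition limit_set : set (set (nat -> X)) :=
  [set xi | gromov_boundary X xi /\
    exists (x : X) (g : nat -> G), xi (fun n => act (g n) x)].

Definition non_elementary : Prop := ~ (limit_set #<= `I_2).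

End Actions.

Definition acylindrically_hyperbolic (R : realType) (G : groupType) : Prop :=
  exists (X : metricType R) (act : G -> X -> X),
    [/\ geodesic X, exists delta : R, hyperbolic_with X delta,
        isometric_action act, acylindrical act & non_elementary act].

Section FiniteNormal.
Context {G : groupType}.
Implicit Types H K : set G.

Definition normal_subgroup H : Prop :=
  group_closed [in H] /\ forall h g, H h -> H (h ^ g)%g.

Definition maximal_finite_normal_subgroup K : Prop :=
  [/\ finite_set K, normal_subgroup K &
      forall H, finite_set H -> normal_subgroup H -> H `<=` K].

End FiniteNormal.

(* Main.v *)
(** Let [f] be a loxodromic element, [E] its commensurator and [Y_i] the
    translates of the quasi-axis [E o], one for each coset of [E].  By
    acylindricity they form a separated family of quasi-convex sets.  Consider
    broken paths running through the [Y_i], where crossing a set costs a large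
    constant [c] instead of the distance travelled.  An almost shortest path uses
    every set which a geodesic follows for much longer than [c], and in a triangle
    all but boundedly many sets used on one side are used on another one.  Given
    a finite sequence [tau] of sets and a vector [e] fixed by its stabilizer, sum
    [g e] over the translates [g tau] occurring in order in all almost shortest
    paths from [o] to [h o], and subtract the sum for the paths from [h o] to [o]:
    as a function of [h] this is a quasi-cocycle.

    It can be computed on products of elements [f^n b] with [n] large and [b]
    outside [E]: the optimal path goes through the successive translates, and
    [tau] is recognized from the distances between consecutive sets.  Moreover
    [tau] can be chosen with stabilizer in the maximal finite normal subgroup.

    Suppose that a combination of such quasi-cocycles is the sum of a bounded
    map and a cocycle [kappa].  For words [w] made of blocks, the vectors
    [count w - kappa w] form a bounded set which the affine isometries attached
    to the blocks map into itself.  By uniform convexity an approximate Chebyshev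
    centre is almost fixed by them, so that after subtracting a coboundary
    [kappa] almost agrees with the count on each single block.  The count
    vanishes on the blocks [z] and [z b z], so [kappa] is small on all letters
    [b], hence on the block [z p z], where [p] is the word of [tau]; but there
    the count is a translate of [e]. *)
From HB Require Import structures.
Require Import Defs.
From mathcomp Require Import all_boot all_order all_algebra complex.
From mathcomp Require Import all_classical all_reals all_analysis.
From mathcomp Require Import lra zify finmap.

Set Implicit Arguments.
Unset Strict Implicit.
Unset Printing Implicit Defensive.

Import Order.TTheory GRing.Theory Num.Theory.
Import numFieldNormedType.Exports.

Local Open Scope classical_set_scope.
Local Open Scope ring_scope.

(** * Gromov products *)

(** Infima over broken paths need not be attained, so a pattern counts only if every list that is
    optimal up to some [m' < m] contains it. The strict bound leaves slack: exchanging pieces of two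
    almost optimal lists adds their tolerances, and the sum has to stay below [m]. So arbitrary
    lists are played off against one list of very small tolerance. The constant [m] is what two
    insertions of missed sets lose to hyperbolicity; [c] exceeds [3 * m] and the separation
    constant, so that one crossing outweighs all tolerances involved.

    A pattern in the optimal path of a word is recognized only by the gaps between consecutive sets,
    so the letters must have gaps that single it out, in either direction, in all words used. This
    dictates the order of choices: the period [P] of the stabilizers, then the detecting word, the
    letters, the cost [c], and last the exponent [n], a multiple of [P] that is large compared to
    everything before. *)

Notation gp := gromov_product.

Section GromovProduct.
Context {R : realType} {X : metricType R}.
Implicit Types (p q u v w x y z : X).
Local Notation d := (@mdist R X).

Lemma gpC p x y : gp p x y = gp p y x.
Proof. by rewrite /gp (metric_sym x y) (addrC (d p x)). Qed.

Lemma gp_ge0 p x y : 0 <= gp p x y.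
Proof.
by have := metric_triangle x p y; rewrite /gp (metric_sym x p); lra.
Qed.

Lemma gp_lel p x y : gp p x y <= d p x.
Proof.
by have := metric_triangle p x y; rewrite /gp; lra.
Qed.

Lemma gp_ler p x y : gp p x y <= d p y.
Proof. by rewrite gpC gp_lel. Qed.

Lemma gp_split p x y : gp p x y + gp x p y = d p x.
Proof. by rewrite /gp (metric_sym x p); lra. Qed.

Lemma gp_dist p x y : d x y = d p x + d p y - 2 * gp p x y.
Proof. by rewrite /gp; lra. Qed.

Lemma gpxx p x : gp p x x = d p x.
Proof. by rewrite /gp mdistxx; lra. Qed.

Lemma gp0l p x : gp p p x = 0.
Proof. by rewrite /gp mdistxx; lra. Qed.

Lemma gp_lip_base p q x y : gp p x y <= gp q x y + d p q.
Proof.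
have := metric_triangle p q x; have := metric_triangle p q y.
by rewrite /gp; lra.
Qed.

Lemma gp_lip x' p x y : gp p x y <= gp p x' y + d x x'.
Proof.
have := metric_triangle p x' x; have := metric_triangle x' x y.
by rewrite /gp (metric_sym x' x); lra.
Qed.

Lemma gp_lipr y' p x y : gp p x y <= gp p x y' + d y y'.
Proof. by rewrite (gpC p x y) (gpC p x y') gp_lip. Qed.

Section Hyperbolic.
Variable delta : R.
Hypothesis hyp : hyperbolic_with X delta.

Lemma hyp_ge0 p : 0 <= delta.
Proof. by have := hyp p p p p; rewrite gp0l minxx; lra. Qed.

Lemma hyp_or p x y z :
  (gp p x y - delta <= gp p x z) \/ (gp p y z - delta <= gp p x z).
Proof.
by have := hyp p x y z; rewrite minEle; case: ifP => _ ?; [left|right].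
Qed.

(** As seen from [p], a point [z] in the same direction as [x] can replace
    [x] in an upper bound of a Gromov product. *)
Lemma gp_transfer z p x y K :
  gp p x y <= K -> K + delta < gp p x z -> gp p z y <= K + delta.
Proof. by move=> H1 H2; case: (hyp_or p x z y); lra. Qed.

(** Local-to-global for a broken geodesic with two corners: since the middle segment is long, [p]
    and [u] look alike from [v]. *)
Lemma gp_chain p q u v A : gp u p v <= A -> gp v u q <= A ->
  2 * A + delta < d u v ->
  d p u + d u v + d v q - 4 * A - 2 * delta <= d p q.
Proof.
move=> pA qA uv.
have H : gp v p q <= A + delta.
  apply: (gp_transfer qA); have := gp_split u v p.
  by rewrite (gpC v u p) (gpC u v p) in pA *; lra.
have := gp_dist v p q; have := gp_dist u p v.
by rewrite (metric_sym v p) (metric_sym u p); lra.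
Qed.

Lemma gp_mid x z u v A : gp u x v <= A -> gp v u z <= A ->
  2 * A + delta < d u v -> gp u x z <= A + delta /\ gp v x z <= A + delta.
Proof.
move=> xA zA uv.
have h1 := gp_split u v x; have h2 := gp_split v u z.
rewrite (gpC u v x) in h1; rewrite (metric_sym v u) in h2.
split.
- rewrite gpC; rewrite gpC in xA; apply: (@gp_transfer z u v x A xA).
  lra.
- by apply: (gp_transfer zA); lra.
Qed.

Hypothesis geo : geodesic X.

Lemma geodesic_point x y (t : R) : 0 <= t <= d x y ->
  exists q, d x q = t /\ d q y = d x y - t.
Proof.
have [c [c0 c1 cD]] := geo x y => t01; exists (c t).
have D0 : 0 <= d x y := mdist_ge0 x y.
have e0 := cD 0 t; have e1 := cD t (d x y).
split; first by rewrite -{1}c0 e0 ?lexx ?D0// sub0r normrN ger0_norm//; lra.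
by rewrite -{1}c1 e1 ?lexx ?D0// ler0_norm; lra.
Qed.

Lemma near_geodesic q w w' r : gp q w w' <= r ->
  exists g, d w g + d g w' = d w w' /\ d q g <= r + 2 * delta.
Proof.
move=> qr; have h := gp_split w q w'.
have [|g [wg gw]] := @geodesic_point w w' (gp w q w').
  by rewrite gp_ge0 gp_ler.
exists g; split; first by rewrite wg gw; lra.
have e : gp w w' g = gp w q w' by rewrite [LHS]/gp (metric_sym w' g) wg gw; lra.
have h1 := hyp w q w' g; rewrite e minxx in h1.
have h2 := gp_dist w q g; rewrite wg in h2.
lra.
Qed.

End Hyperbolic.
End GromovProduct.

(** * Broken paths through a family of sets *)

Section Costs.
Context {R : realType} {X : metricType R} {I : choiceType}.
Variable Y : I -> set X.
Hypothesis Y_neq0 : forall i, Y i !=set0.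
Local Notation d := (@mdist R X).

Definition node : Type := (X + I)%type.

Definition nset (P : node) : set X :=
  match P with inl x => [set x] | inr i => Y i end.

Definition gap (P Q : node) : R :=
  inf [set d pq.1 pq.2 | pq in nset P `*` nset Q].

Implicit Types (P Q : node) (L : seq I) (i j : I) (m c : R).

Lemma nset_neq0 P : nset P !=set0.
Proof. by case: P => [x|i] /=; [exists x | exact: Y_neq0]. Qed.

Let dists_neq0 P Q : [set d pq.1 pq.2 | pq in nset P `*` nset Q] !=set0.
Proof.
have [p Pp] := nset_neq0 P; have [q Qq] := nset_neq0 Q.
by exists (d p q); exists (p, q).
Qed.

Let dists_lb P Q : lbound [set d pq.1 pq.2 | pq in nset P `*` nset Q] 0.
Proof. by move=> _ [pq _ <-]; exact: mdist_ge0. Qed.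

Lemma gap_le P Q p q : nset P p -> nset Q q -> gap P Q <= d p q.
Proof. by move=> Pp Qq; apply: ge_inf; [exists 0; exact: dists_lb | exists (p, q)]. Qed.

Lemma le_gap P Q K : (forall p q, nset P p -> nset Q q -> K <= d p q) ->
  K <= gap P Q.
Proof.
move=> H; apply: (lb_le_inf (@dists_neq0 P Q)).
by move=> _ [[p q] [/= Pp Qq] <-]; exact: H.
Qed.

Lemma gap_ge0 P Q : 0 <= gap P Q.
Proof. by apply: le_gap => p q _ _; exact: mdist_ge0. Qed.

Lemma gap_ex P Q e : 0 < e ->
  exists p q, [/\ nset P p, nset Q q & d p q <= gap P Q + e].
Proof.
move=> e0; have [|_ [[p q] [/= Pp Qq] <-] H] := @inf_adherent _
    [set d pq.1 pq.2 | pq in nset P `*` nset Q] e e0.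
  by split; [exact: dists_neq0 | exists 0; exact: dists_lb].
by exists p, q; split=> //; exact: ltW.
Qed.

Lemma gapC P Q : gap P Q = gap Q P.
Proof.
apply/eqP; rewrite eq_le; apply/andP.
by split; apply: le_gap => p q Pp Qq; rewrite metric_sym; apply: gap_le.
Qed.

Lemma gapxx i : gap (inr i) (inr i) = 0.
Proof.
have [p Yp] := Y_neq0 i; apply/eqP; rewrite eq_le gap_ge0 andbT.
by rewrite -(mdistxx p); apply: gap_le.
Qed.

Variable c : R.
Hypothesis c_gt0 : 0 < c.

(** The list [L] stands for the broken paths from [P] to [Q] which run through
    the sets [Y i], [i \in L]; travelling inside [Y i] costs [c], whatever the
    distance. *)
Fixpoint cost P L Q : R :=
  if L is i :: L' then gap P (inr i) + c + cost (inr i) L' Q else gap P Q.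

Definition lastn P L : node := last P (map inr L).
Definition headn L Q : node := head Q (map inr L).

Lemma cost_cat P L1 i L2 Q :
  cost P (L1 ++ i :: L2) Q = cost P L1 (inr i) + c + cost (inr i) L2 Q.
Proof. by elim: L1 P => [|j L1 IH] P //=; rewrite IH; lra. Qed.

Lemma cost_rev P L Q : cost P L Q = cost Q (rev L) P.
Proof.
elim: L P => [|i L IH] P /=; first by rewrite gapC.
by rewrite rev_cons -cats1 cost_cat -IH /= (gapC P); lra.
Qed.

Lemma cost_ge P L Q : c *+ size L <= cost P L Q.
Proof.
elim: L P => [|i L IH] P /=; first by rewrite mulr0n gap_ge0.
by have := IH (inr i); have := gap_ge0 P (inr i); rewrite mulrS; lra.
Qed.

Lemma cost_ge0 P L Q : 0 <= cost P L Q.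
Proof. by apply: le_trans (cost_ge _ _ _); rewrite mulrn_wge0// ltW. Qed.

Lemma cost_ins P L1 i L2 Q : cost P (L1 ++ i :: L2) Q =
  cost P (L1 ++ L2) Q - gap (lastn P L1) (headn L2 Q)
  + gap (lastn P L1) (inr i) + c + gap (inr i) (headn L2 Q).
Proof.
rewrite /lastn /headn; elim: L1 P => [|j L1 IH] P /=.
  by case: L2 => [|k L2] /=; lra.
by rewrite IH; lra.
Qed.

Definition opt m P L Q : Prop := forall L', cost P L Q <= cost P L' Q + m.

Lemma opt_ge0 m P L Q : opt m P L Q -> 0 <= m.
Proof. by move=> /(_ L); lra. Qed.

Lemma opt_exists m P Q : 0 < m -> exists L, opt m P L Q.
Proof.
move=> m0; have [|_ [L _ <-] HL] := @inf_adherent _ (range (fun L => cost P L Q)) m m0.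
  split; first by exists (cost P [::] Q); exists [::].
  by exists 0 => _ [L _ <-]; exact: cost_ge0.
exists L => L'; apply: (le_trans (ltW HL)); rewrite lerD2r.
by apply: ge_inf; [exists 0 => _ [L0 _ <-]; exact: cost_ge0 | exists L'].
Qed.

Lemma opt_prefix m P L1 i L2 Q :
  opt m P (L1 ++ i :: L2) Q -> opt m P L1 (inr i).
Proof. by move=> H L'; have := H (L' ++ i :: L2); rewrite !cost_cat; lra. Qed.

Lemma opt_suffix m P L1 i L2 Q :
  opt m P (L1 ++ i :: L2) Q -> opt m (inr i) L2 Q.
Proof. by move=> H L'; have := H (L1 ++ i :: L'); rewrite !cost_cat; lra. Qed.

Lemma opt_rev m P L Q : opt m P L Q -> opt m Q (rev L) P.
Proof.
by move=> H L'; have := H (rev L'); rewrite (cost_rev P L) (cost_rev P) revK.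
Qed.

(** Cutting out the part between two visits of the same set saves at least [c]. *)
Lemma opt_uniq m P L Q : m < c -> opt m P L Q -> uniq L.
Proof.
move=> mc; elim: L P => [//|i L IH] P H /=.
apply/andP; split; last by apply: (IH (inr i)); apply: (@opt_suffix m P [::] i).
apply/negP => iL; move: H; case/splitPr: iL => L1 L2 /(_ (i :: L2)).
by rewrite /= cost_cat; have := cost_ge0 (inr i) L1 (inr i); lra.
Qed.

Lemma opt_set_point m e P L i : 0 < e -> opt m P L (inr i) ->
  exists2 p, Y i p & opt (m + e) P L (inl p).
Proof.
move=> e0 H; have [q [p [Pq Yp qp]]] := gap_ex (lastn P L) (inr i) e0.
have E (L0 : seq I) (Q1 Q2 : node) K : gap (lastn P L0) Q1 <= gap (lastn P L0) Q2 + K ->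
    cost P L0 Q1 <= cost P L0 Q2 + K.
  rewrite /lastn; elim: L0 P {H L q Pq qp} => [//|j L0 IH] P /=.
  by move=> /IH; lra.
exists p => // L'; have h := H L'.
have : cost P L (inl p) <= cost P L (inr i) + e.
  apply: E; apply: le_trans qp; exact: gap_le.
have : cost P L' (inr i) <= cost P L' (inl p) + 0.
  apply: E; rewrite addr0; apply: le_gap => p1 q1 P1 /= ->; exact: gap_le.
lra.
Qed.

(** Replacing a used set by a straight segment cannot gain much, so the visit
    must be long. *)
Lemma opt_visit m K P L1 i L2 Q p u v q :
  cost P (L1 ++ i :: L2) Q <= cost P (L1 ++ L2) Q - K ->
  nset (lastn P L1) p -> nset (headn L2 Q) q ->
  d p u <= gap (lastn P L1) (inr i) + m -> d v q <= gap (inr i) (headn L2 Q) + m ->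
  c + K - 2 * m <= d u v.
Proof.
rewrite cost_ins => H Pp Qq pu vq.
have := gap_le Pp Qq; have := metric_triangle p u q.
have := metric_triangle u v q; lra.
Qed.

End Costs.

(** * Families of separated quasi-convex sets *)

Section Separated.
Context {R : realType} {X : metricType R} {I : choiceType}.
Variable Y : I -> set X.
Local Notation d := (@mdist R X).
Local Notation gap := (gap Y).
Local Notation nset := (nset Y).
Implicit Types (P Q : node (X := X) (I := I)) (L : seq I) (i j : I).

Definition near_set (r : R) i (p : X) : Prop := exists2 w, Y i w & d p w <= r.

Definition quasi_convex (k : R) : Prop := forall i u v q, Y i u -> Y i v ->
  d u q + d q v = d u v -> near_set k i q.

Definition separated (r D : R) : Prop := forall i j p q, i <> j ->
  near_set r i p -> near_set r j p -> near_set r i q -> near_set r j q ->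
  d p q <= D.

(** Points of [P] are seen from [Y j] in the direction of the point [u] of
    [Y j] which is (almost) nearest to [P]. *)
Definition adjacency (a : R) : Prop := forall P j p u p' w, P <> inr j ->
  nset P p -> Y j u -> d p u <= gap P (inr j) + 1 ->
  nset P p' -> Y j w -> gp u p' w <= a.

Definition bounded_projections (a : R) : Prop := forall i j u v w w', i <> j ->
  Y j u -> Y j v -> Y i w -> Y i w' -> gp u w v <= gp u w' v + a.

Lemma near_setW r s i p : r <= s -> near_set r i p -> near_set s i p.
Proof. by move=> rs [w Yw pw]; exists w => //; exact: le_trans rs. Qed.

Lemma near_set_trans r s i p q : d p q <= s -> near_set r i q ->
  near_set (r + s) i p.
Proof.
by move=> pq [w Yw qw]; exists w => //; have := metric_triangle p q w; lra.
Qed.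

Variables delta k : R.
Hypothesis hyp : hyperbolic_with X delta.
Hypothesis geo : geodesic X.
Hypothesis Yqc : quasi_convex k.

Lemma near_set_between i u v q r : Y i u -> Y i v -> gp q u v <= r ->
  near_set (k + (r + 2 * delta)) i q.
Proof.
move=> Yu Yv /(near_geodesic hyp geo) [g [ug qg]].
exact: near_set_trans qg (Yqc Yu Yv ug).
Qed.

(** Where the geodesic from [v] to [w] leaves the direction of [p], quasi-convexity gives a nearby
    point of [Y i]; it would be closer to [p] than [v] if the product were larger. *)
Lemma nearest_point i p v w : Y i v -> Y i w ->
  (forall w', Y i w' -> d p v <= d p w' + 1) -> gp v w p <= k + 1 + 2 * delta.
Proof.
move=> Yv Yw near; have [|q [vq qw]] := @geodesic_point _ X geo v w (gp v w p).
  by rewrite gp_ge0 gp_lel.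
have [|w' Yw' qw'] := Yqc Yv Yw (q := q); first by rewrite vq qw; lra.
have e : gp v q w = gp v w p.
  by rewrite [LHS]/gp (metric_sym q w) (metric_sym w q) qw vq; lra.
have h1 := hyp v q w p; rewrite e minxx in h1.
have h2 := gp_dist v q p; rewrite vq in h2.
have h3 := near _ Yw'; have h4 := metric_triangle p q w'.
rewrite (metric_sym p q) in h4; rewrite (metric_sym p v) in h3.
lra.
Qed.

(** If the two projections differed by more, the geodesic from [u] to [v] would run near [Y i] for
    longer than [D] while staying near [Y j], against separation. *)
Lemma bounded_projectionsP D : separated (k + 4 * delta) D ->
  bounded_projections (`|D| + 3 * delta + 1).
Proof.
move=> sep i j u v w w' ij Yu Yv Yw Yw'; rewrite leNgt; apply/negP => lt_s.
have dl := hyp_ge0 hyp u; have s_le := gp_ler u w v; have s'0 := gp_ge0 u w' v.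
have D0 := normr_ge0 D.
have key (t : R) : gp u w' v + 3 * delta < t <= gp u w v ->
    exists q, [/\ d u q = t, near_set (k + 4 * delta) i q & near_set (k + 4 * delta)
      j q].
  move=> /andP[t1 t2].
  have [|q [uq qv]] := @geodesic_point _ X geo u v t; first by lra.
  exists q; split=> //; last first.
    by apply: near_setW (Yqc Yu Yv (q := q) _); [lra | rewrite uq qv; lra].
  have equ : gp u v q = t by rewrite /gp (metric_sym v q) uq qv; lra.
  have eqv : gp v u q = d u v - t.
    by rewrite /gp (metric_sym v q) (metric_sym v u) uq qv; lra.
  have h1 : gp q w u <= delta.
    have := hyp_or hyp u w v q; rewrite equ.
    by have := gp_split u q w; rewrite uq (gpC u q w) (gpC q u w); lra.
  have h2 : t - gp u w' v - delta <= gp q u w'.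
    have := @gp_transfer _ _ _ hyp q u v w' (gp u w' v).
    rewrite (gpC u v w') equ lexx => /(_ isT) H.
    by have := gp_split u q w'; rewrite uq; have : gp u q w' <= gp u w' v + delta;
      [apply: H|]; lra.
  have h3 : gp q w w' <= 2 * delta.
    have := hyp_or hyp q w w' u; rewrite (gpC q w' u); lra.
  by apply: near_setW (near_set_between Yw Yw' h3); lra.
have [|q1 [uq1 i1 j1]] := key (gp u w' v + 3 * delta + 1); first by lra.
have [|q2 [uq2 i2 j2]] := key (gp u w v); first by lra.
have := sep i j q1 q2 ij i1 j1 i2 j2; have := metric_triangle u q1 q2.
have := ler_norm D; lra.
Qed.

Lemma adjacency_ex D : separated (k + 4 * delta) D -> 0 <= k ->
  exists a, [/\ 0 <= a, delta <= a, adjacency a & bounded_projections a].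
Proof.
move=> /bounded_projectionsP BP k0; set b := `|D| + _ + _ in BP.
have D0 := normr_ge0 D.
have [x0|Xe] := pselect (exists x0 : X, True); last first.
  by exists `|delta|; split=> //; [exact: ler_norm|move=> ? ? p|move=> ? ? p];
    case: Xe; exists p.
have dl : 0 <= delta by case: x0 => p _; exact: (hyp_ge0 hyp p).
exists (k + 1 + 2 * delta + b); split; rewrite ?/b; try lra.
- move=> P j p u p' w Pj Pp Yu pu Pp' Yw.
  have h : gp u p w <= k + 1 + 2 * delta.
    rewrite gpC; apply: (nearest_point Yu Yw) => w' Yw'.
    by have := gap_le Pp (Yw' : nset (inr j) w'); lra.
  case: P => [x|i] /= in Pj Pp pu Pp'; first by rewrite Pp' -Pp; lra.
  have ij : i <> j by move=> e; apply: Pj; rewrite e.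
  have := BP i j u w p' p ij Yu Yw Pp' Pp; rewrite /b; lra.
- move=> i j u v w w' ij Yu Yv Yw Yw'.
  have := BP i j u v w w' ij Yu Yv Yw Yw'; rewrite /b; lra.
Qed.

End Separated.

(** * Almost optimal lists *)

Lemma pigeonhole3 (T : eqType) (P0 P1 P2 : T -> Prop) (s : seq T) : uniq s ->
  size s = 4 ->
  (forall j, j \in s -> [\/ P0 j, P1 j | P2 j]) ->
  (forall j j', j \in s -> j' \in s -> P0 j -> P0 j' -> j = j') ->
  (forall j j', j \in s -> j' \in s -> P1 j -> P1 j' -> j = j') ->
  (forall j j', j \in s -> j' \in s -> P2 j -> P2 j' -> j = j') -> False.
Proof.
case: s => [//|x1 [//|x2 [//|x3 [//|x4 [|//]]]]] /= U _ H H0 H1 H2.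
have [n12 n13 n14 [n23 n24 n34]] : [/\ x1 <> x2, x1 <> x3, x1 <> x4 &
    [/\ x2 <> x3, x2 <> x4 & x3 <> x4]].
  move: U; rewrite !inE !negb_or -!andbA => /and5P[/eqP ? /eqP ? /eqP ? /eqP ?].
  by move=> /and3P[/eqP ? /eqP ? _].
have i1 : x1 \in [:: x1; x2; x3; x4] by rewrite !inE eqxx ?orbT.
have i2 : x2 \in [:: x1; x2; x3; x4] by rewrite !inE eqxx ?orbT.
have i3 : x3 \in [:: x1; x2; x3; x4] by rewrite !inE eqxx ?orbT.
have i4 : x4 \in [:: x1; x2; x3; x4] by rewrite !inE eqxx ?orbT.
case: (H _ i1) => h1; case: (H _ i2) => h2;
  try (by apply: n12; apply: H0); try (by apply: n12; apply: H1); try (by apply: n12;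
    apply: H2);
case: (H _ i3) => h3;
  try (by apply: n13; apply: H0); try (by apply: n13; apply: H1); try (by apply: n13;
    apply: H2);
  try (by apply: n23; apply: H0); try (by apply: n23; apply: H1); try (by apply: n23;
    apply: H2);
case: (H _ i4) => h4;
  try (by apply: n14; apply: H0); try (by apply: n14; apply: H1); try (by apply: n14;
    apply: H2);
  try (by apply: n24; apply: H0); try (by apply: n24; apply: H1); try (by apply: n24;
    apply: H2);
  try (by apply: n34; apply: H0); try (by apply: n34; apply: H1); try (by apply: n34;
    apply: H2).
Qed.

Section Lists.
Context {R : realType} {X : metricType R} {I : choiceType}.
Variable Y : I -> set X.
Local Notation d := (@mdist R X).
Local Notation gap := (gap Y).
Local Notation nset := (nset Y).
Implicit Types (P Q : node (X := X) (I := I)) (L : seq I) (i j : I).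

Variables delta k a D m c : R.
Hypothesis hyp : hyperbolic_with X delta.
Hypothesis geo : geodesic X.
Hypothesis Y_neq0 : forall i, Y i !=set0.
Hypothesis Yqc : quasi_convex Y k.
Hypothesis delta_a : delta <= a.
Hypothesis delta_ge0 : 0 <= delta.
Hypothesis a_adj : adjacency Y a.
Hypothesis a_proj : bounded_projections Y a.
Hypothesis D_sep : separated Y (k + (a + 6 * delta)) D.
Hypothesis D_ge0 : 0 <= D.
Hypothesis k_ge0 : 0 <= k.
Hypothesis m_large : 120 * a + 420 * delta + 6 <= m.
Hypothesis c_large : 3 * m + D + 10 <= c.

Local Notation cost := (cost Y c).
Local Notation opt := (opt Y c).

Ltac bounds := move: (delta_a) (delta_ge0) (D_ge0) (k_ge0) (m_large) (c_large).

Let a_ge0 : 0 <= a. Proof. bounds; lra. Qed.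
Let c_gt0 : 0 < c. Proof. bounds; lra. Qed.

(** After a long crossing of [Y j] the point [x] is hidden behind [u']: from [u] it looks like [u'],
    and points of [Y j] project to [Y i] near [u]. *)
Lemma adjacency_step j i x u' v' u : j <> i -> Y j u' -> Y j v' -> Y i u ->
  d v' u <= gap (inr j) (inr i) + 1 -> gp u' x v' <= a + delta ->
  4 * a + 6 * delta < d u' v' -> forall w, Y i w -> gp u x w <= a + delta.
Proof.
bounds=> ? ? ? ? ? ?.
move=> ji Yu' Yv' Yu vu u'x ll w Yw.
have h1 : gp v' u u' <= a.
  apply: (@a_adj (inr i) j u v' u u') => //; first by case=> e; apply: ji.
  by rewrite metric_sym gapC.
have h2 : gp u u' w <= a by apply: (@a_adj (inr j) i v' u u' w) => //; case.
have h3 := gp_split u' v' u; have h4 := gp_split u' u x.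
rewrite (gpC v' u' u) in h3.
have h5 : gp u' x u <= a + 2 * delta.
  have := @gp_transfer _ _ _ hyp u u' v' x (a + delta).
  rewrite (gpC u' v' x) u'x => /(_ isT) H.
  by rewrite gpC; suff : gp u' u x <= a + delta + delta; [lra | apply: H; lra].
rewrite (gpC u' x u) in h5; rewrite (gpC u u' x) in h4.
have h6 := gp_ler u' v' u.
by apply: (@gp_transfer _ _ _ hyp x u u' w a h2); rewrite gpC; lra.
Qed.

(** By induction along the list: the set visited before [Y i] is crossed for a length of about [c],
    since skipping it would otherwise save more than [m']; so [adjacency_step] applies. *)
Lemma entry_point m' x L1 i L2 Q p u w : m' <= m ->
  opt m' (inl x) (L1 ++ i :: L2) Q ->
  nset (lastn (inl x) L1) p -> Y i u -> d p u <= gap (lastn (inl x) L1) (inr i) + 1 ->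
  Y i w -> gp u x w <= a + delta.
Proof.
bounds=> ? ? ? ? ? ?.
move=> mm'; elim/last_ind: L1 i L2 p u w => [|L1 j IH] i L2 p u w op.
  move=> /= -> Yu pu Yw.
  by have : gp u x w <= a; [apply: (@a_adj (inl x) i x u x w)|lra].
rewrite /lastn map_rcons last_rcons /= => Yjp Yu pu Yw.
have ij : j <> i.
  have : uniq (rcons L1 j ++ i :: L2).
    by apply: (@opt_uniq _ _ _ _ Y_neq0 c c_gt0 m' (inl x) _ Q) => //; lra.
  by rewrite cat_uniq => /and3P[_ /= + _] e; rewrite mem_rcons inE e eqxx.
rewrite cat_rcons in op.
have [p' [u' [p'P u'Y p'u']]] := @gap_ex _ _ _ _ Y_neq0 (lastn (inl x) L1) (inr j) 1
  ltr01.
have u'x : gp u' x p <= a + delta by apply: (IH j (i :: L2) p').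
have ll : c - m' - 2 * 1 <= d u' p.
  have := @opt_visit _ _ _ Y c 1 (- m') (inl x) L1 j (i :: L2) Q p' u' p u.
  rewrite -/(headn _ _) /=; move=> H; have := op (L1 ++ i :: L2) => h.
  apply: (H _ p'P Yu p'u' pu); lra.
by apply: (@adjacency_step j i x u' p u) => //; lra.
Qed.

Lemma lastn_rev P L : lastn P (rev L) = headn L P.
Proof.
bounds=> ? ? ? ? ? ?.
rewrite /lastn /headn; case: L => [//|i L].
by rewrite rev_cons map_rcons last_rcons.
Qed.

Lemma exit_point m' z P L1 i L2 q v w : m' <= m ->
  opt m' P (L1 ++ i :: L2) (inl z) ->
  nset (headn L2 (inl z)) q -> Y i v -> d v q <= gap (inr i) (headn L2 (inl z)) + 1 ->
  Y i w -> gp v w z <= a + delta.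
Proof.
bounds=> ? ? ? ? ? ?.
move=> mm' /(@opt_rev _ _ _ Y Y_neq0 c) op.
rewrite rev_cat rev_cons cat_rcons in op.
move=> Pq Yv vq Yw; rewrite -lastn_rev in Pq vq.
rewrite metric_sym (gapC Y_neq0) in vq.
have -> : gp v w z = gp v z w by exact: gpC.
by apply: (entry_point mm' op Pq Yv vq Yw).
Qed.

Lemma visit m' x L1 i L2 z K : m' <= m -> opt m' (inl x) (L1 ++ i :: L2) (inl z) ->
  cost (inl x) (L1 ++ i :: L2) (inl z) <= cost (inl x) (L1 ++ L2) (inl z) - K ->
  exists u v, [/\ Y i u, Y i v, c + K - 2 <= d u v,
    (forall w, Y i w -> gp u x w <= a + delta) &
    (forall w, Y i w -> gp v w z <= a + delta)].
Proof.
bounds=> ? ? ? ? ? ?.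
move=> mm' op H.
have [p [u [Pp Yu pu]]] := @gap_ex _ _ _ _ Y_neq0 (lastn (inl x) L1) (inr i) 1 ltr01.
have [v [q [Yv Qq vq]]] := @gap_ex _ _ _ _ Y_neq0 (inr i) (headn L2 (inl z)) 1 ltr01.
exists u, v; split=> //.
- have := @opt_visit _ _ _ Y c 1 K (inl x) L1 i L2 (inl z) p u v q H Pp Qq pu vq; lra.
- by move=> w Yw; apply: (entry_point mm' op Pp Yu pu Yw).
- by move=> w Yw; apply: (exit_point mm' op Qq Yv vq Yw).
Qed.

Definition leftof (B : R) (u v : X) P := forall w, nset P w -> gp u w v <= B.
Definition rightof (B : R) (u v : X) P := forall w, nset P w -> gp v u w <= B.

(** As [p] is close to a geodesic from [x] to [z] and projects deep inside the segment from [u] to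
    [v], the points [x] and [z] can be replaced by [u] and [v] in the product at [p]. *)
Lemma near_middle (p x z u v : X) A : gp p x z <= a + 2 * delta ->
  gp u x v <= A -> gp v u z <= A -> A + a + 10 * delta < gp u p v ->
  A + a + 10 * delta < gp v u p -> gp p u v <= a + 4 * delta.
Proof.
bounds=> ? ? ? ? ? ?.
move=> pxz uA vA up vp.
have h1 : gp u x p <= A + delta.
  by rewrite gpC; apply: (@gp_transfer _ _ _ hyp p u v x A);
    rewrite 1?gpC ?(gpC u v p) //; lra.
have h2 : gp v p z <= A + delta.
  by apply: (@gp_transfer _ _ _ hyp p v u z A) => //; lra.
have s1 := gp_split u p x; have s2 := gp_split v p z.
have l1 := gp_lel u p v; have l2 := gp_ler v u p.
rewrite (gpC u p x) in s1.
have h3 : gp p u z <= a + 3 * delta.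
  have := @gp_transfer _ _ _ hyp u p x z (a + 2 * delta) pxz; rewrite (gpC p x u).
  by move=> H; suff : gp p u z <= a + 2 * delta + delta; [lra|apply: H; lra].
have := @gp_transfer _ _ _ hyp v p z u (a + 3 * delta).
rewrite (gpC p z u) (gpC p v u) h3 => /(_ isT) H.
suff : gp p u v <= a + 3 * delta + delta; first lra.
by apply: H; rewrite (gpC p z v); lra.
Qed.

(** Seen from [Y j], every other set of an almost optimal list lies on one
    side: a set in the middle would have to follow [Y j] for a long time. *)
Lemma sides m' x z L i j u v A : m' <= m -> opt m' (inl x) L (inl z) -> i \in L ->
  i <> j -> Y j u -> Y j v -> gp u x v <= A -> gp v u z <= A ->
  leftof (A + 3 * a + 11 * delta) u v (inr i) \/
  rightof (A + 3 * a + 11 * delta) u v (inr i).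
Proof.
bounds=> ? ? ? ? ? ?.
move=> mm' op iL ij Yu Yv uA vA.
case/splitPr: iL op => L1 L2 op.
have [|ui [vi [Yui Yvi ll xui zvi]]] := @visit m' x L1 i L2 z (- m') mm' op.
  by have := op (L1 ++ L2); lra.
have sp := gp_split u v; have sp' (w : X) : gp u w v + gp v u w = d u v.
  by have := sp w; rewrite (gpC u v w).
have [s1|s1] := leP (gp u ui v) (A + 2 * a + 11 * delta).
  left=> w /= Yw; have := a_proj ij Yu Yv Yw Yui; lra.
have [s2|s2] := leP (gp v u ui) (A + 2 * a + 11 * delta).
  right=> w /= Yw; have := a_proj ij Yu Yv Yui Yw.
  by have := sp' w; have := sp' ui; lra.
have Yuv := a_proj ij Yu Yv Yvi Yui; have Yvu := a_proj ij Yu Yv Yui Yvi.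
have e1 := sp' ui; have e2 := sp' vi.
have xui' := xui _ Yvi; have zvi' := zvi _ Yui.
have g1 := gp_split ui vi z; have g2 := gp_split vi ui x.
have [b1 b2] : gp ui x z <= a + 2 * delta /\ gp vi x z <= a + 2 * delta.
  have := @gp_mid _ _ _ hyp x z ui vi (a + delta) xui' zvi'.
  have : 2 * (a + delta) + delta < d ui vi by lra.
  by move=> h /(_ h) [? ?]; split; lra.
have n1 : gp ui u v <= a + 4 * delta.
  by apply: (near_middle b1 uA vA); lra.
have n2 : gp vi u v <= a + 4 * delta.
  by apply: (near_middle b2 uA vA); lra.
exfalso.
have /(_ i j ui vi) := D_sep; rewrite leNgt => H; move: H => /(_ ij).
have near0 (p : X) : Y i p -> near_set Y (k + (a + 6 * delta)) i p.
  by move=> Yp; exists p => //; rewrite mdistxx; lra.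
have nearj (p : X) : gp p u v <= a + 4 * delta -> near_set Y (k + (a + 6 * delta)) j p.
  by move=> h; apply: near_setW (near_set_between hyp geo Yqc Yu Yv h); lra.
move=> /(_ (near0 _ Yui) (nearj _ n1) (near0 _ Yvi) (nearj _ n2)) /negP; apply.
lra.
Qed.

Lemma split_sides (S T : node (X := X) (I := I) -> Prop) P L Q : S P -> T Q ->
  (forall i, i \in L -> S (inr i) \/ T (inr i)) ->
  exists L1 L2, [/\ L = L1 ++ L2, S (lastn P L1) & T (headn L2 Q)].
Proof.
bounds=> ? ? ? ? ? ?.
elim: L P => [|i L IH] P SP TQ H; first by exists [::], [::].
have [Si|Ti] := H i (mem_head _ _); last by exists [::], (i :: L).
have [|L1 [L2 [-> h1 h2]]] := IH (inr i) Si TQ.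
  by move=> j jL; apply: H; rewrite inE jL orbT.
by exists (i :: L1), L2.
Qed.

(** Every set of [L] lies to the left or to the right of [Y j]. Inserting [j] at a passage from left
    to right replaces one gap, which by [gp_chain] is at least the two new gaps plus almost all of
    [d u v], at the price of one crossing. *)
Lemma insertion m' x z L j u v A : m' <= m -> opt m' (inl x) L (inl z) -> j \notin L ->
  Y j u -> Y j v -> 0 <= A -> gp u x v <= A -> gp v u z <= A ->
  2 * (A + 3 * a + 11 * delta) + delta < d u v ->
  exists L1 L2, L = L1 ++ L2 /\
    cost (inl x) (L1 ++ j :: L2) (inl z) <= cost (inl x) L (inl z)
      - (d u v - c - (4 * (A + 3 * a + 11 * delta) + 2 * delta)).
Proof.
bounds=> ? ? ? ? ? ?.
move=> mm' op jL Yu Yv A0 uA vA uv; set B := A + _ + _ in uv *.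
have [|||L1 [L2 [eL l r]]] := @split_sides (leftof B u v) (rightof B u v) (inl x) L
  (inl z).
- by move=> w /= ->; rewrite /B; lra.
- by move=> w /= ->; rewrite /B; lra.
- move=> i iL; apply: (sides mm' op iL _ Yu Yv uA vA) => e; by rewrite -e iL in jL.
exists L1, L2; split=> //; rewrite cost_ins eL.
suff : gap (lastn (inl x) L1) (inr j) + d u v + gap (inr j) (headn L2 (inl z))
  - 4 * B - 2 * delta <= gap (lastn (inl x) L1) (headn L2 (inl z)) by lra.
apply: le_gap => // p q Pp Qq.
have := gp_chain hyp (l _ Pp) (r _ Qq) uv.
have := gap_le Pp (Yu : nset (inr j) u); have := gap_le (Yv : nset (inr j) v) Qq; lra.
Qed.

(** A single missed crossing may be due to the tolerance, as its insertion gains only [m] minus a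
    constant. Two insertions gain more than [m']; this is the origin of
    [120 * a + 420 * delta + 6]. *)
Lemma insertion_twice m' x z L j j' u v u' v' : m' < m -> opt m' (inl x) L (inl z) ->
  j \notin L -> j' \notin L -> j <> j' ->
  Y j u -> Y j v -> gp u x v <= 12 * a + 40 * delta ->
  gp v u z <= 12 * a + 40 * delta -> c + m - 3 <= d u v ->
  Y j' u' -> Y j' v' -> gp u' x v' <= 12 * a + 40 * delta ->
  gp v' u' z <= 12 * a + 40 * delta -> c + m - 3 <= d u' v' -> False.
Proof.
bounds=> ? ? ? ? ? ?.
move=> mm' op jL j'L jj' Yu Yv xu zv uv Yu' Yv' xu' zv' uv'.
have A0 : 0 <= 12 * a + 40 * delta by lra.
have [|L1 [L2 [eL le]]] := insertion (ltW mm') op jL Yu Yv A0 xu zv; first by lra.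
have op2 : opt m' (inl x) (L1 ++ j :: L2) (inl z).
  by move=> L'; have := op L'; lra.
have jL2 : j' \notin L1 ++ j :: L2.
  rewrite mem_cat inE !negb_or; rewrite eL mem_cat negb_or in j'L.
  by case/andP: j'L => -> ->; rewrite andbT /=; apply/eqP => e; apply: jj'.
have [|L3 [L4 [eL2 le2]]] := insertion (ltW mm') op2 jL2 Yu' Yv' A0 xu' zv';
  first by lra.
have := op (L3 ++ j' :: L4); lra.
Qed.

(** Each of [e] and [e'] sees the other one and [z] in different directions, which is possible only
    if they are close. Then [f] and [f'] lie in the direction of [z] from almost the same place,
    although [Y j'] lies away from [f]. *)
Lemma facing (A B : R) j j' e f e' f' z : Y j e -> Y j' e' -> Y j' f' -> 0 <= B ->
  3 * B + 4 * delta <= A ->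
  (forall w, Y j' w -> gp e f w <= B) -> (forall w, Y j w -> gp e' f' w <= B) ->
  A < gp e f z -> A < gp e' f' z -> False.
Proof.
bounds=> ? ? ? ? ? ? Ye Ye' Yf' B0 AB sj sj' ez ez'.
have h1 : gp e z e' <= B + delta.
  by apply: (gp_transfer hyp (sj _ Ye')); lra.
have h2 : gp e' z e <= B + delta.
  by apply: (gp_transfer hyp (sj' _ Ye)); lra.
have h3 := gp_split e e' z; rewrite (gpC e e' z) (gpC e' e z) in h3.
have h4 := gp_lip_base e' e f' z; rewrite (metric_sym e' e) in h4.
have := sj _ Yf'; have := hyp_or hyp e f z f'; rewrite (gpC e z f'); lra.
Qed.

Definition always x y (s : seq I) : Prop :=
  forall m' L, m' < m -> opt m' (inl x) L (inl y) -> subseq s L.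

Lemma always_visit e x y L j : e <= 1 -> opt e (inl x) L (inl y) -> j \in L ->
  always x y [:: j] -> exists u v, [/\ Y j u, Y j v, c + m - 3 <= d u v,
    gp u x v <= a + delta /\ gp v u y <= a + delta &
    forall i, i \in L -> i <> j -> leftof (4 * a + 12 * delta) u v (inr i) \/
      rightof (4 * a + 12 * delta) u v (inr i)].
Proof.
bounds=> ? ? ? ? ? ?.
move=> e1 op jL Tj; have em : e <= m by lra.
case/splitPr: jL (op) => L1 L2 op'.
have U : uniq (L1 ++ j :: L2).
  by apply: (@opt_uniq _ _ _ _ Y_neq0 c c_gt0 e (inl x) _ (inl y)) => //; lra.
have jn : j \notin L1 ++ L2.
  by move: U; rewrite -cat1s uniq_catCA /= => /andP[].
(* If [j] saved less than [m - 1], the list without [j] would be optimal up to a tolerance below [m]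
   and yet miss [j]. *)
have K : cost (inl x) (L1 ++ j :: L2) (inl y) <= cost (inl x) (L1 ++ L2) (inl y) - (m
  - 1).
  rewrite leNgt; apply/negP => lt.
  have := Tj (cost (inl x) (L1 ++ L2) (inl y) - cost (inl x) (L1 ++ j :: L2) (inl y)
    + e) (L1 ++ L2).
  rewrite sub1seq (negbTE jn) => H.
  suff : false by [].
  by apply: H => [|L']; [lra | have := op' L'; lra].
have [u [v [Yu Yv uv xu yv]]] := visit em op' K.
exists u, v; split=> //; first by lra.
  by split; [exact: xu | exact: yv].
move=> i iL ij; have := sides em op' iL ij Yu Yv (xu _ Yv) (yv _ Yu).
have -> : a + delta + 3 * a + 11 * delta = 4 * a + 12 * delta by lra.
by [].
Qed.

(** In a geodesic triangle, all but boundedly many of the sets followed by one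
    side are followed by one of the two other sides. *)
Lemma triangle_sides e m1 m2 x y z L L1 L2 s : e <= 1 -> m1 < m -> m2 < m ->
  opt e (inl x) L (inl y) -> opt m1 (inl x) L1 (inl z) -> opt m2 (inl z) L2 (inl y) ->
  uniq s -> size s = 4 -> (forall j, j \in s -> j \in L /\ always x y [:: j]) ->
  exists2 j, j \in s & (j \in L1) || (j \in L2).
Proof.
bounds=> ? ? ? ? ? ? e1 mm1 mm2 op op1 op2 Us s4 sL.
apply: contrapT => no.
have {}no j : j \in s -> j \notin L1 /\ j \notin L2.
  by move=> js; split; apply/negP => jl; apply: no; exists j; rewrite // jl ?orbT.
pose A := 12 * a + 40 * delta; have eA : A = 12 * a + 40 * delta by [].
pose visiting j u v := [/\ Y j u, Y j v, c + m - 3 <= d u v,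
    gp u x v <= a + delta /\ gp v u y <= a + delta &
    forall i, i \in L -> i <> j -> leftof (4 * a + 12 * delta) u v (inr i) \/
      rightof (4 * a + 12 * delta) u v (inr i)].
(* The missed sets fall into three classes, as [z] projects near the entry point, near the exit
   point or in between. The first two have at most one member by [insertion_twice], the third by
   [facing]; hence the number 4. *)
apply: (@pigeonhole3 _ (fun j => exists u v, visiting j u v /\ gp u z v <= A)
  (fun j => exists u v, visiting j u v /\ gp v u z <= A)
  (fun j => exists u v, visiting j u v /\ A < gp u z v /\ A < gp v u z) s Us s4).
- move=> j /sL[jL Tj]; have [u [v V]] := always_visit e1 op jL Tj.
  have [h1|h1] := leP (gp u z v) A; first by constructor 1; exists u, v.
  have [h2|h2] := leP (gp v u z) A; first by constructor 2; exists u, v.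
  by constructor 3; exists u, v.
- move=> j j' /no[_ n2] /no[_ n2'] [u [v [[? ? ? [? ?] _] ?]]] [u' [v' [[? ? ? [? ?]
  _] ?]]].
  apply: contrapT => jj'.
  by apply: (@insertion_twice m2 z y L2 j j' u v u' v') => //; lra.
- move=> j j' /no[n1 _] /no[n1' _] [u [v [[? ? ? [? ?] _] ?]]] [u' [v' [[? ? ? [? ?]
  _] ?]]].
  apply: contrapT => jj'.
  by apply: (@insertion_twice m1 x z L1 j j' u v u' v') => //; lra.
- move=> j j' /sL[jL _] /sL[jL' _] [u [v [[Yu Yv _ _ S] [n1 n2]]]].
  move=> [u' [v' [[Yu' Yv' _ _ S'] [n1' n2']]]].
  apply: contrapT => jj'.
  have B0 : 0 <= 4 * a + 12 * delta by lra.
  have AB : 3 * (4 * a + 12 * delta) + 4 * delta <= A by rewrite /A; lra.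
  rewrite gpC in n1; rewrite gpC in n1'.
  have [l|r] := S _ jL' (fun e => jj' (esym e)); have [l'|r'] := S' _ jL jj'.
  + apply: (@facing A _ j j' u v u' v' z Yu Yu' Yv' B0 AB) => // w Yw; rewrite gpC.
      exact: l.
    exact: l'.
  + apply: (@facing A _ j j' u v v' u' z Yu Yv' Yu' B0 AB) => // w Yw.
    by rewrite gpC; exact: l.
  + apply: (@facing A _ j j' v u u' v' z Yv Yu' Yv' B0 AB) => // w Yw.
    by rewrite gpC; exact: l'.
  + exact: (@facing A _ j j' v u v' u' z Yv Yv' Yu' B0 AB).
Qed.

End Lists.

(** * Subsequences of lists *)

Section Subsequences.
Context {T : eqType}.
Implicit Types (s t b : seq T) (p : pred T).

Lemma subseq_catl s t1 t2 : subseq s (t1 ++ t2) ->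
  (forall x, x \in s -> x \notin t2) -> subseq s t1.
Proof.
move=> st H; have : subseq s [seq x <- t1 ++ t2 | x \notin t2].
  by rewrite subseq_filter st andbT; apply/allP => x /H.
rewrite filter_cat => h; apply: subseq_trans h _.
rewrite (_ : [seq x <- t2 | x \notin t2] = [::]) ?cats0 ?filter_subseq//.
by apply/eqP; rewrite -[_ == _]negbK -has_filter; apply/hasPn => x ->.
Qed.

Lemma subseq_catr s t1 t2 : subseq s (t1 ++ t2) ->
  (forall x, x \in s -> x \notin t1) -> subseq s t2.
Proof.
move=> st H; have : subseq s [seq x <- t1 ++ t2 | x \notin t1].
  by rewrite subseq_filter st andbT; apply/allP => x /H.
rewrite filter_cat => h; apply: subseq_trans h _.
rewrite (_ : [seq x <- t1 | x \notin t1] = [::]) ?filter_subseq//.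
by apply/eqP; rewrite -[_ == _]negbK -has_filter; apply/hasPn => x ->.
Qed.

Lemma filter_split p b t1 x t2 : [seq y <- b | p y] = t1 ++ x :: t2 ->
  exists b1 b2, [/\ b = b1 ++ x :: b2, [seq y <- b1 | p y] = t1 &
    [seq y <- b2 | p y] = t2].
Proof.
elim: b t1 => [|y b IH] t1 /=; first by case: t1.
case: ifP => py; last first.
  move=> /IH [b1 [b2 [-> <- <-]]]; exists (y :: b1), b2; split=> //=.
  by rewrite py.
case: t1 => [|y1 t1] /= [ey e]; first by exists [::], b; rewrite ey.
have [b1 [b2 [-> <- <-]]] := IH _ e; exists (y :: b1), b2; split=> //=.
by rewrite py ey.
Qed.

Lemma subseq_consP x s t : subseq (x :: s) t ->
  exists t1 t2, t = t1 ++ x :: t2 /\ subseq s t2.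
Proof.
elim: t => [//|y t IH] /=; case: eqP => [<-|_].
  by move=> st; exists [::], t.
by move=> /IH [t1 [t2 [-> st]]]; exists (y :: t1), t2.
Qed.

Lemma subseq_rconsP x s t : subseq (rcons s x) t ->
  exists t1 t2, t = t1 ++ x :: t2 /\ subseq s t1.
Proof.
rewrite -subseq_rev rev_rcons => /subseq_consP [t1 [t2 [e st]]].
exists (rev t2), (rev t1); rewrite -[t]revK e rev_cat rev_cons cat_rcons.
by split=> //; rewrite -subseq_rev revK.
Qed.

Lemma size_subseqs (L : seq (seq T)) t : uniq L ->
  (forall s, s \in L -> subseq s t) -> (size L <= 2 ^ size t)%N.
Proof.
move=> U H; rewrite -[2%N]card_bool -(card_tuple (size t) bool) cardE.
rewrite -(size_map (fun m : (size t).-tuple bool => mask m t)).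
apply: uniq_leq_size => // s /H /subseqP [m sm ->].
apply/mapP; exists (tcast sm (in_tuple m)); first by rewrite mem_enum.
by rewrite val_tcast.
Qed.

End Subsequences.

(** * Patterns on the three sides of a triangle *)

Section Exactness.
Context {R : realType} {X : metricType R} {I : choiceType}.
Variable Y : I -> set X.
Hypothesis Y_neq0 : forall i, Y i !=set0.
Implicit Types (P Q : node (X := X) (I := I)) (L : seq I) (i j : I) (x y z : X).
Variables m c : R.
Hypothesis m_gt0 : 0 < m.
Hypothesis c_large : 3 * m < c.
Hypothesis m_gt1 : 1 <= m.
Local Notation gap := (gap Y).
Local Notation cost := (cost Y c).
Local Notation opt := (opt Y c).
Local Notation always := (always Y m c).

Let c_gt0 : 0 < c. Proof. by move: m_gt0 c_large => ? ?; lra. Qed.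

Hypothesis cover : forall e m1 m2 x y z L L1 L2 s, e <= 1 -> m1 < m -> m2 < m ->
  opt e (inl x) L (inl y) -> opt m1 (inl x) L1 (inl z) -> opt m2 (inl z) L2 (inl y) ->
  uniq s -> size s = 4 -> (forall j, j \in s -> j \in L /\ always x y [:: j]) ->
  exists2 j, j \in s & (j \in L1) || (j \in L2).

Lemma always_sub x y s s' : subseq s' s -> always x y s -> always x y s'.
Proof. by move=> ss' H m' L mm' op; apply: subseq_trans ss' (H _ _ mm' op). Qed.

(** An exchange argument: three paths cannot run through [p] and [q] in the
    orders [p, q], [q] and [p] respectively. *)
Lemma order_cost e m1 m2 x y z b1 p b2 q b3 a1 a2 g1 g2 :
  opt e (inl x) (b1 ++ p :: b2 ++ q :: b3) (inl y) ->
  opt m1 (inl x) (a1 ++ q :: a2) (inl z) -> opt m2 (inl z) (g1 ++ p :: g2) (inl y) ->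
  2 * c <= m1 + m2 + 2 * e.
Proof.
move=> o o1 o2; have h1 := o (b1 ++ p :: g2); have h2 := o (a1 ++ q :: b3).
have h3 := o1 (b1 ++ p :: rev g1); have h4 := o2 (rev a2 ++ q :: b3).
move: h1 h2 h3 h4; rewrite !cost_cat.
rewrite -(cost_rev Y_neq0 c (inl z) g1) -(cost_rev Y_neq0 c (inr q) a2).
by have := cost_ge0 Y_neq0 c_gt0 (inr p) b2 (inr q); lra.
Qed.

(** Arrive at [z] from the first set by reversing the way out, and leave [z] to the second set by
    reversing the way in: together the two new paths save two crossings. *)
Lemma always_disjoint x y z s : (1 < size s)%N -> always x z s -> always z y s -> False.
Proof.
case: s => [//|j0 [//|j1 s]] _ A1 A2.
have m2 : 0 < m / 2 by move: m_gt0 => ?; lra.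
have mm2 : m / 2 < m by move: m_gt0 => ?; lra.
have sub2 : subseq [:: j0; j1] [:: j0, j1 & s] by rewrite /= !eqxx sub0seq.
have [L1 o1] := opt_exists Y_neq0 c_gt0 (inl x) (inl z) m2.
have [L2 o2] := opt_exists Y_neq0 c_gt0 (inl z) (inl y) m2.
have /subseq_consP [a1 [t1 [e1 s1]]] := subseq_trans sub2 (A1 _ _ mm2 o1).
have /subseq_consP [a2 [a3 [e2 _]]] := s1.
have /subseq_consP [g1 [t2 [e3 s2]]] := subseq_trans sub2 (A2 _ _ mm2 o2).
have /subseq_consP [g2 [g3 [e4 _]]] := s2.
rewrite {}e1 {}e2 in o1; rewrite {}e3 {}e4 in o2.
have h1 := o1 (a1 ++ j0 :: rev g1); have h2 := o2 (rev a3 ++ j1 :: g3).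
move: h1 h2; rewrite !cost_cat.
rewrite -(cost_rev Y_neq0 c (inl z) g1) -(cost_rev Y_neq0 c (inr j1) a3).
have := cost_ge0 Y_neq0 c_gt0 (inr j0) a2 (inr j1).
have := cost_ge0 Y_neq0 c_gt0 (inr j0) g2 (inr j1).
by move: c_large m_gt0 => ? ?; lra.
Qed.

(** Following [L1] up to the common set [j] and the other list afterwards is still almost optimal
    from [x] to [y], so [s] occurs; the part after [j] avoids [s] by uniqueness, hence [s] occurs in
    [L1]. *)
Lemma splice_start e m1 x y z b1 b2 L1 s j : m1 + e < m -> uniq (b1 ++ b2) ->
  opt e (inl x) (b1 ++ b2) (inl y) -> opt m1 (inl x) L1 (inl z) ->
  always x y s -> subseq s b1 -> j \in b2 -> j \in L1 -> subseq s L1.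
Proof.
move=> me U o o1 A sb jb jL.
case/splitPr: jb U o => c1 c2 U o; case/splitPr: jL o1 => a1 a2 o1.
have o3 : opt (m1 + e) (inl x) (a1 ++ j :: c2) (inl y).
  move=> L'; have h := o L'; have h1 := o1 ((b1 ++ c1) ++ j :: a2).
  by move: h h1; rewrite !catA !cost_cat; lra.
apply: subseq_trans (prefix_subseq a1 (j :: a2)).
apply: (subseq_catl (A _ _ me o3)) => i /(mem_subseq sb) ib.
move: U; rewrite cat_uniq => /and3P[_ /hasPn H _]; apply/negP => ij.
by have := H i; rewrite mem_cat ij orbT /= ib => /(_ isT).
Qed.

Lemma splice_end e m2 x y z b1 b2 L2 s j : m2 + e < m -> uniq (b1 ++ b2) ->
  opt e (inl x) (b1 ++ b2) (inl y) -> opt m2 (inl z) L2 (inl y) ->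
  always x y s -> subseq s b2 -> j \in b1 -> j \in L2 -> subseq s L2.
Proof.
move=> me U o o2 A sb jb jL.
case/splitPr: jb U o => c1 c2 U o; case/splitPr: jL o2 => g1 g2 o2.
rewrite -catA /= in o.
have o3 : opt (m2 + e) (inl x) (c1 ++ j :: g2) (inl y).
  move=> L'; have h := o L'; have h2 := o2 (g1 ++ j :: (c2 ++ b2)).
  by move: h h2; rewrite !cost_cat; lra.
rewrite -cat1s catA; apply: (subseq_trans _ (suffix_subseq (g1 ++ [:: j]) g2)).
have := A _ _ me o3; rewrite -cat1s catA => h.
apply: (subseq_catr h) => i /(mem_subseq sb) ib.
move: U; rewrite cat_uniq => /and3P[_ /hasPn H _]; apply/negP => ij.
have := H i ib; rewrite mem_cat; move: ij; rewrite mem_cat !inE /=.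
by case/orP => ->; rewrite ?orbT.
Qed.

Definition unmatched x y z (s : seq I) : Prop :=
  [/\ always x y s, ~ always x z s & ~ always z y s].

Let T x y : pred I := fun j => `[< always x y [:: j] >].

Lemma always_filter e x y L s : e < m -> opt e (inl x) L (inl y) -> always x y s ->
  subseq s [seq j <- L | T x y j].
Proof.
move=> em o A; rewrite subseq_filter (A _ _ em o) andbT.
apply/allP => j js; apply/asboolP; apply: always_sub A; by rewrite sub1seq.
Qed.

(** The margin [e] is reserved for splicing with a list of tolerance [e]. *)
Definition witness e x y z (s : seq I) : Prop :=
  (exists m1 L1, [/\ m1 + e < m, opt m1 (inl x) L1 (inl z) & ~~ subseq s L1]) /\
  (exists m2 L2, [/\ m2 + e < m, opt m2 (inl z) L2 (inl y) & ~~ subseq s L2]).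

Lemma unmatched_witness x y z (S : seq (seq I)) : (forall s,
  s \in S -> unmatched x y z s) ->
  exists e, [/\ 0 < e, e <= 1/2 & forall s, s \in S -> witness e x y z s].
Proof.
elim: S => [|s S IH] H; first by exists (1/2); split=> //; lra.
have [|e [e0 e1 W]] := IH; first by move=> s' sS; apply: H; rewrite inE sS orbT.
have not_always (x' y' : X) : ~ always x' y' s -> exists m1 L1,
    [/\ m1 < m, opt m1 (inl x') L1 (inl y') & ~~ subseq s L1].
  move=> nA; apply: contrapT => no; apply: nA => m1 L1 mm o.
  by apply: contrapT => /negP ns; apply: no; exists m1, L1.
have [A n1 n2] := H s (mem_head _ _).
have [m1 [L1 [mm1 o1 s1]]] := not_always _ _ n1.
have [m2 [L2 [mm2 o2 s2]]] := not_always _ _ n2.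
pose f := Num.min e (Num.min ((m - m1) / 2) ((m - m2) / 2)).
have [f0 fe f1 f2] : [/\ 0 < f, f <= e, f <= (m - m1) / 2 & f <= (m - m2) / 2].
  by rewrite /f !lt_min !ge_min !lexx ?orbT; split=> //; apply/and3P; split=> //; lra.
exists f; split=> //; first by lra.
move=> s'; rewrite inE => /predU1P[->|/W [[m1' [L1' [? ? ?]]] [m2' [L2' [? ? ?]]]]].
  by split; [exists m1, L1 | exists m2, L2]; split=> //; lra.
by split; [exists m1', L1' | exists m2', L2']; split=> //; lra.
Qed.

(** Unmatched patterns cannot be far apart, since in between there would be
    sets followed by the two other sides in the wrong order. *)
Lemma unmatched_close e x y z L s s' A M C : e <= 1/2 -> uniq L ->
  opt e (inl x) L (inl y) ->
  witness e x y z s -> witness e x y z s' -> always x y s -> always x y s' ->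
  [seq j <- L | T x y j] = A ++ M ++ C -> size M = 8 -> subseq s A -> subseq s' C ->
    False.
Proof.
move=> e1 U o [W1 [m2 [L2 [me2 o2 ns2]]]] [[m1 [L1 [me1 o1 ns1]]] W2'] As As'.
move: W1 => [m3 [L3 [me3 o3 ns3]]]; move: W2' => [m4 [L4 [me4 o4 ns4]]].
move=> eL sM sA sC; rewrite -(cat_take_drop 4 M) in eL.
have e0 := opt_ge0 o.
set M1 := take 4 M in eL; set M2 := drop 4 M in eL.
have sM1 : size M1 = 4 by rewrite size_take sM.
have sM2 : size M2 = 4 by rewrite size_drop sM.
have UT : uniq (A ++ (M1 ++ M2) ++ C) by rewrite -eL filter_uniq.
have inT j : j \in M1 ++ M2 -> j \in L /\ always x y [:: j].
  move=> jM; have : j \in [seq j <- L | T x y j] by rewrite eL !mem_cat -mem_cat jM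
    orbT.
  by rewrite mem_filter => /andP[/asboolP ? ?].
have [U1 U2] : uniq M1 /\ uniq M2.
  by move: UT; rewrite !cat_uniq => /and3P[_ _ /and3P[/and3P[? _ ?] _ _]].
have ge1 : e <= 1 by lra.
have [l1 l2 l3 l4] : [/\ m1 < m, m2 < m, m3 < m & m4 < m] by split; lra.
have [|p pM1 pL] := @cover e m3 m2 x y z L L3 L2 M1 ge1 l3 l2 o o3 o2 U1 sM1.
  by move=> j jM; apply: inT; rewrite mem_cat jM.
have [|q qM2 qL] := @cover e m1 m4 x y z L L1 L4 M2 ge1 l1 l4 o o1 o4 U2 sM2.
  by move=> j jM; apply: inT; rewrite mem_cat jM orbT.
case/splitPr: pM1 eL sM1 {U1 UT inT} => M11 M12 eL _.
case/splitPr: qM2 eL sM2 {U2} => M21 M22 eL _.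
have eL1 : [seq j <- L | T x y j] = (A ++ M11) ++ p :: (M12 ++ M21 ++ q :: M22 ++ C).
  by rewrite eL -!catA /= -?catA.
have [b1 [t [eb eb1 et]]] := filter_split eL1.
have [b2 [b3 [et2 eb2 eb3]]] : exists b2 b3, [/\ t = b2 ++ q :: b3,
    [seq j <- b2 | T x y j] = M12 ++ M21 & [seq j <- b3 | T x y j] = M22 ++ C].
  by apply: filter_split; rewrite et -!catA.
rewrite {}et2 in eb.
(* As [p] comes after [s], finding it on [L3] would by splicing put [s] on [L3]; likewise [q], which
   comes before [s'], is not on [L4]. So [p] is on [L2] and [q] on [L1], which [order_cost]
   excludes. *)
have pL2 : p \in L2.
  case/orP: pL => // pL3; case/negP: ns3.
  apply: (@splice_start e m3 x y z b1 (p :: b2 ++ q :: b3) L3 s p me3) => //;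
    rewrite -?eb //.
    apply: subseq_trans (filter_subseq (T x y) b1); rewrite eb1.
    exact: subseq_trans sA (prefix_subseq _ _).
  by rewrite mem_head.
have qL1 : q \in L1.
  case/orP: qL => // qL4; case/negP: ns4.
  apply: (@splice_end e m4 x y z (b1 ++ p :: b2 ++ [:: q]) b3 L4 s' q me4) => //.
  - by rewrite -catA /= -catA /= -eb.
  - by rewrite -catA /= -catA /= -eb.
  - apply: subseq_trans (filter_subseq (T x y) b3); rewrite eb3.
    exact: subseq_trans sC (suffix_subseq _ _).
  - by rewrite mem_cat inE mem_cat inE eqxx !orbT.
case/splitPr: pL2 o2 => g1 g2 o2; case/splitPr: qL1 o1 => a1 a2 o1.
rewrite eb in o; have := order_cost o o1 o2; move: c_large m_gt1 => ? ?; lra.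
Qed.

(** Each set between the two ends of the pattern costs at least [c], whereas jumping from one end to
    the other costs less than [c *+ N]. *)
Lemma always_span e x y L h s l (N : nat) : e <= 1/2 -> opt e (inl x) L (inl y) ->
  always x y (h :: rcons s l) -> gap (inr h) (inr l) + 1 <= c *+ N ->
  exists A B C, [/\ [seq j <- L | T x y j] = A ++ B ++ C, subseq (h :: rcons s l) B
    & (size B <= N + 2)%N].
Proof.
move=> e1 o A gN.
have em : e < m by move: m_gt1 => ?; lra.
have /subseq_consP [t1 [t2 [e2 /subseq_rconsP [t3 [t4 [e3 st3]]]]]] := always_filter
  em o A.
have [b1 [t [eb eb1 et]]] := filter_split e2.
have [b2 [b3 [et2 eb2 eb3]]] : exists b2 b3, [/\ t = b2 ++ l :: b3,
    [seq j <- b2 | T x y j] = t3 & [seq j <- b3 | T x y j] = t4].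
  by apply: filter_split; rewrite et e3.
exists t1, (h :: rcons t3 l), t4; split.
- by rewrite e2 e3 /= cat_rcons.
- by rewrite /= eqxx -!cats1 cat_subseq.
- rewrite /= size_rcons addn2 !ltnS -eb2 (leq_trans (size_subseq (filter_subseq _
  _)))//.
  rewrite leqNgt; apply/negP => lt.
  rewrite eb et2 in o; have o2 := opt_prefix (opt_suffix o).
  have := o2 [::]; rewrite /=; have := @cost_ge _ _ _ _ Y_neq0 c (inr h) b2 (inr l).
  have : c *+ N + c <= c *+ size b2.
    by rewrite -mulrSr ler_wpMn2l // ltW.
  by move: c_gt0 => ?; lra.
Qed.

(** Consider the leftmost window containing one of the patterns. By [unmatched_close] all other
    windows start at most [N + 2 + 8] places later, so all patterns are subsequences of one list of
    length [2 * N + 14]. *)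
Lemma unmatched_bound (N : nat) x y z (S : seq (seq I)) : uniq S ->
  (forall s, s \in S -> unmatched x y z s /\ exists h s' l,
     s = h :: rcons s' l /\ gap (inr h) (inr l) + 1 <= c *+ N) ->
  (size S <= 2 ^ (2 * N + 14))%N.
Proof.
move=> US H.
have [|e [e0 e1 W]] := @unmatched_witness x y z S; first by move=> s /H[].
have [L o] := opt_exists Y_neq0 c_gt0 (inl x) (inl y) e0.
have UL : uniq L.
  by apply: (opt_uniq Y_neq0 c_gt0 _ o); move: c_large m_gt1 => ? ?; lra.
set tb := [seq j <- L | T x y j].
have span s : s \in S -> exists A B C, [/\ tb = A ++ B ++ C,
  subseq s B & (size B <= N + 2)%N].
  move=> sS; have [[As _ _] [h [s' [l [es gN]]]]] := H s sS.
  by rewrite es; apply: (always_span e1 o _ gN); rewrite -es.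
case: S US H W span => [//|s0 S] US H W span.
pose starts (n : nat) := `[< exists s A B C, [/\ s \in s0 :: S, tb = A ++ B ++ C,
  subseq s B,
   (size B <= N + 2)%N & size A = n] >].
have ex_starts : exists n, starts n.
  have [A [B [C [? ? ?]]]] := span s0 (mem_head _ _).
  by exists (size A); apply/asboolP; exists s0, A, B, C; split=> //; rewrite mem_head.
case: (ex_minnP ex_starts) => n /asboolP [s1 [A0 [B0 [C0 [s1S eA0 sB0 B0N sA0]]]]]
  n_min.
have Wd s : s \in s0 :: S -> subseq s (take (2 * N + 14) (drop n tb)).
  move=> sS; have [A [B [C [eA sB BN]]]] := span s sS.
  have nA : (n <= size A)%N.
    by apply: n_min; apply/asboolP; exists s, A, B, C.
  have An : (size A <= n + (N + 2) + 8)%N.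
    rewrite leqNgt; apply/negP => lt.
    pose k := (size A0 + size B0)%N.
    have kA : (k + 8 <= size A)%N by rewrite /k sA0; move: B0N lt; clear; lia.
    apply: (@unmatched_close e x y z L s1 s (take k tb) (take 8 (drop k tb)) (drop 8
      (drop k tb)) e1 UL o (W _ s1S) (W _ sS)).
    - by have [[]] := H _ s1S.
    - by have [[]] := H _ sS.
    - by rewrite cat_take_drop cat_take_drop.
    - apply: size_takel; rewrite size_drop eA !size_cat; move: kA; clear; lia.
    - by rewrite eA0 /k catA take_size_cat ?size_cat //;
      exact: subseq_trans sB0 (suffix_subseq _ _).
    - rewrite drop_drop eA drop_cat; case: ltnP => h.
        rewrite catA; apply: subseq_trans (prefix_subseq _ _).
        exact: subseq_trans sB (suffix_subseq _ _).
      rewrite (_ : _ - _ = 0)%N; last by move: h kA; clear; lia.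
      by rewrite drop0; apply: subseq_trans sB (prefix_subseq _ _).
  have eB : B = take (size B) (drop (size A - n) (drop n tb)).
    by rewrite drop_drop subnK // eA drop_size_cat // take_size_cat.
  apply: subseq_trans sB _; rewrite {1}eB take_drop.
  apply: subseq_trans (drop_subseq _ _) _.
  rewrite -(@take_takel _ (size B + (size A - n)) (2 * N + 14));
    last by move: nA An BN; clear; lia.
  exact: take_subseq.
apply: leq_trans (size_subseqs US Wd) _.
by rewrite leq_pexp2l // size_take; case: ifP => // /negbT; rewrite -leqNgt.
Qed.

End Exactness.

(** * Counting quasi-cocycles *)

Lemma urep1 (K : numFieldType) (G : groupType) (V : normedModType K)
  (rho : unitary_rep G V) v : rho 1%g v = v.
Proof.
have := urep_mul rho 1%g 1%g v; rewrite mulg1 => /esym.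
by have [h hK _] := urep_bij rho 1%g => /(congr1 h); rewrite !hK.
Qed.

Section Counting.
Context {R : realType} {X : metricType R} {I : choiceType} {G : groupType}.
Variables (Y : I -> set X) (act : G -> X -> X) (actI : G -> I -> I).
Hypothesis Y_neq0 : forall i, Y i !=set0.
Hypothesis act_isom : isometric_action act.
Hypothesis actI1 : forall i, actI 1%g i = i.
Hypothesis actIM : forall g h i, actI (g * h)%g i = actI g (actI h i).
Hypothesis Y_act : forall g i p, Y i p -> Y (actI g i) (act g p).
Implicit Types (P Q : node (X := X) (I := I)) (L : seq I) (i j : I) (x y z : X).

Let act1 x : act 1%g x = x. Proof. by case: act_isom. Qed.
Let actM g h x : act (g * h)%g x = act g (act h x). Proof. by case: act_isom. Qed.
Let actD g x y : mdist (act g x) (act g y) = mdist x y. Proof. by case: act_isom. Qed.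
Let actK g x : act g^-1%g (act g x) = x. Proof. by rewrite -actM mulVg act1. Qed.
Lemma actIK g : cancel (actI g) (actI g^-1%g).
Proof. by move=> i; rewrite -actIM mulVg actI1. Qed.

Lemma actIKV g : cancel (actI g^-1%g) (actI g).
Proof. by move=> i; rewrite -actIM mulgV actI1. Qed.

Definition actn g P : node (X := X) (I := I) :=
  match P with inl x => inl (act g x) | inr i => inr (actI g i) end.

Lemma nset_act g P p : nset Y P p -> nset Y (actn g P) (act g p).
Proof. by case: P => [x ->|i] //=; exact: Y_act. Qed.

Lemma actnK g P : actn g^-1%g (actn g P) = P.
Proof. by case: P => [x|i] /=; rewrite ?actK ?actIK. Qed.

Let gap_act_le g P Q : gap Y (actn g P) (actn g Q) <= gap Y P Q.
Proof.
apply: le_gap => // p q Pp Qq; rewrite -(actD g).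
by apply: gap_le; apply: nset_act.
Qed.

Lemma gap_act g P Q : gap Y (actn g P) (actn g Q) = gap Y P Q.
Proof.
apply/eqP; rewrite eq_le gap_act_le /=.
by have := gap_act_le g^-1%g (actn g P) (actn g Q); rewrite !actnK.
Qed.

Variables m c : R.
Hypothesis m_gt1 : 1 <= m.
Hypothesis c_large : 3 * m < c.
Let c_gt0 : 0 < c. Proof. by move: m_gt1 c_large => ? ?; lra. Qed.
Let m_gt0 : 0 < m. Proof. by move: m_gt1 => ?; lra. Qed.
Local Notation opt := (opt Y c).
Local Notation always := (always Y m c).
Hypothesis cover : forall e m1 m2 x y z L L1 L2 s, e <= 1 -> m1 < m -> m2 < m ->
  opt e (inl x) L (inl y) -> opt m1 (inl x) L1 (inl z) -> opt m2 (inl z) L2 (inl y) ->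
  uniq s -> size s = 4 -> (forall j, j \in s -> j \in L /\ always x y [:: j]) ->
  exists2 j, j \in s & (j \in L1) || (j \in L2).

Lemma cost_act g P L Q :
  cost Y c (actn g P) (map (actI g) L) (actn g Q) = cost Y c P L Q.
Proof.
elim: L P => [|i L IH] P /=; first exact: gap_act.
by rewrite -(IH (inr i)) -[inr (actI g i)]/(actn g (inr i)) gap_act.
Qed.

Lemma opt_act m' g P L Q : opt m' P L Q ->
  opt m' (actn g P) (map (actI g) L) (actn g Q).
Proof.
move=> H L'; rewrite cost_act -(mapK (actIKV g) L') cost_act; exact: H.
Qed.

Lemma always_act g x y s : always x y s ->
  always (act g x) (act g y) (map (actI g) s).
Proof.
move=> A m' L mm' /(opt_act g^-1%g) /=; rewrite !actK => /(A _ _ mm') h.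
by rewrite -(mapK (actIKV g) L); apply: map_subseq.
Qed.

Lemma always_rev x y s : always x y s -> always y x (rev s).
Proof.
move=> A m' L mm' /(@opt_rev _ _ _ Y Y_neq0 c) /(A _ _ mm').
by rewrite -subseq_rev revK.
Qed.

Context {K : numFieldType} {E : normedModType K}.
Variables (rho : unitary_rep G E) (tau : seq I) (e : E).
Hypothesis tau_size : (1 < size tau)%N.
Hypothesis tau_fix : forall g, map (actI g) tau = tau -> rho g e = e.

Definition pattern (s : seq I) : Prop := exists g, s = map (actI g) tau.

(** The vector [g e] attached to the translate [g tau] of the pattern. *)
Definition pattern_vec (s : seq I) : E :=
  match pselect (pattern s) with
  | left h => rho (projT1 (cid h)) e
  | right _ => 0
  end.

Lemma pattern_vecE g : pattern_vec (map (actI g) tau) = rho g e.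
Proof.
rewrite /pattern_vec; case: pselect => [h|]; last by case; exists g.
case: cid => g' /= eg; rewrite -{1}[g'](mulVKg g) urep_mul; congr (rho g _).
apply: tau_fix; have gI : injective (actI g) := can_inj (actIK g).
apply: (inj_map gI); rewrite -map_comp [RHS]eg; apply: eq_map => i /=.
by rewrite -actIM mulVKg.
Qed.

Lemma pattern_vec_act g s : pattern_vec (map (actI g) s) = rho g (pattern_vec s).
Proof.
have [[h ->]|no] := pselect (pattern s).
  rewrite -map_comp pattern_vecE -urep_mul -pattern_vecE.
  by congr pattern_vec; apply: eq_map => i /=; rewrite actIM.
rewrite /pattern_vec; case: pselect => [[h eh]|_]; last first.
  by case: pselect => // _; rewrite linear0.
case: no; exists (g^-1 * h)%g; apply: (inj_map (can_inj (actIK g))).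
rewrite eh -map_comp; apply: eq_map => i /=.
by rewrite -actIM mulVKg.
Qed.

Lemma pattern_vec_norm s : `|pattern_vec s| <= `|e|.
Proof.
by rewrite /pattern_vec; case: pselect => [h|_]; rewrite ?urep_norm ?normr0.
Qed.

Definition occurrences x y : set (seq I) := [set s | pattern s /\ always x y s].

Lemma occurrences_finite x y : finite_set (occurrences x y).
Proof.
have m2 : 0 < m / 2 by move: m_gt0 => ?; lra.
have [L o] := opt_exists Y_neq0 c_gt0 (inl x) (inl y) m2.
apply: (@sub_finite_set _ _ [set` [seq mask (tval b) L | b : (size L).-tuple bool]]);
  last first.
  exact: finite_seq.
move=> s [_ A]; have /subseqP [b sb ->] : subseq s L.
  by apply: A o; move: m_gt0 => ?; lra.
apply/mapP; exists (tcast sb (in_tuple b)); first by rewrite mem_enum.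
by rewrite val_tcast.
Qed.

Definition count x y : E := \sum_(s <- fset_set (occurrences x y)) pattern_vec s.

Lemma countE x y (D : seq (seq I)) : uniq D -> (forall s,
  occurrences x y s -> s \in D) ->
  count x y = \sum_(s <- D | `[< occurrences x y s >]) pattern_vec s.
Proof.
move=> UD sub; rewrite /count -[RHS]big_filter; apply/perm_big/uniq_perm;
  rewrite ?fset_uniq ?filter_uniq// => s.
rewrite in_fset_set ?mem_filter; last exact: occurrences_finite.
apply/idP/andP => [/set_mem os|[/asboolP os _]]; last exact: mem_set.
by split; [apply/asboolP | exact: sub].
Qed.

Lemma occurrences_act g x y s :
  occurrences (act g x) (act g y) (map (actI g) s) <-> occurrences x y s.
Proof.
suff H h x' y' s' : occurrences x' y' s' ->
    occurrences (act h x') (act h y') (map (actI h) s').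
  split; last exact: H.
  by move=> /(H g^-1%g); rewrite !actK mapK//; exact: actIK.
move=> [[k ->] A]; split; last exact: always_act.
by exists (h * k)%g; rewrite -map_comp; apply: eq_map => i /=; rewrite actIM.
Qed.

Lemma count_act g x y : count (act g x) (act g y) = rho g (count x y).
Proof.
have gI : injective (map (actI g)) := inj_map (can_inj (actIK g)).
rewrite (@countE _ _ (map (map (actI g)) (fset_set (occurrences x y)))); last 2 first.
- by rewrite map_inj_uniq// fset_uniq.
- move=> s; rewrite -(mapK (actIKV g) s) => /occurrences_act os.
  by rewrite mem_map// in_fset_set; [exact: mem_set | exact: occurrences_finite].
rewrite big_map /count linear_sum /= big_mkcond /= big_seq [RHS]big_seq.
apply: eq_bigr => s; rewrite in_fset_set; last exact: occurrences_finite.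
by move=> /set_mem os; rewrite ifT ?pattern_vec_act//; apply/asboolP/occurrences_act.
Qed.

(** Antisymmetry lets a triangle cancel: in the sum over its oriented sides, a translate counted
    both from [x] to [y] and from [x] to [z] enters with opposite signs. *)
Definition signed_count x y : E := count x y - count y x.

Lemma signed_count_act g x y :
  signed_count (act g x) (act g y) = rho g (signed_count x y).
Proof. by rewrite /signed_count !count_act linearB. Qed.

Lemma signed_countN x y : signed_count y x = - signed_count x y.
Proof. by rewrite /signed_count opprB. Qed.

Lemma unmatched_size_ex : exists M : nat, forall x y z (D : seq (seq I)), uniq D ->
  (forall s, s \in D -> pattern s /\ unmatched Y m c x y z s) -> (size D <= M)%N.
Proof.
have [h [t [l et]]] : exists h t l, tau = h :: rcons t l.
  case: (tau) tau_size => [//|h t]; case/lastP: t => [//|t l _].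
  by exists h, t, l.
(* The gap between the two ends of the pattern, in units of [c]; it is the same for all
   translates. *)
pose N := Num.truncn ((gap Y (inr h) (inr l) + 1) / c).
exists (2 ^ (2 * N.+1 + 14))%N => x y z D UD H.
apply: (@unmatched_bound _ _ _ Y Y_neq0 m c m_gt0 c_large m_gt1 cover N.+1 x y z D
  UD) => s.
move=> /H [[g eg] us].
split=> //; exists (actI g h), (map (actI g) t), (actI g l).
rewrite eg et /= map_rcons; split=> //.
rewrite -[inr (actI g h)]/(actn g (inr h)) -[inr (actI g l)]/(actn g (inr l)) gap_act.
rewrite -[leRHS]mulr_natl -ler_pdivrMr//; apply: ltW.
by apply: truncnS_gt; rewrite num_real.
Qed.

Lemma signed_count_triangle : exists M : K, forall x y z,
  `|signed_count x y + signed_count y z + signed_count z x| <= M.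
Proof.
have [M HM] := unmatched_size_ex.
exists ((M + M + M + M + M + M)%:R * (`|e| *+ 6)) => x y z.
pose occ x y s := `[< occurrences x y s >].
pose A := (fset_set (occurrences x y) `|` fset_set (occurrences y x) `|`
  fset_set (occurrences y z) `|` fset_set (occurrences z y) `|`
  fset_set (occurrences z x) `|` fset_set (occurrences x z))%fset.
pose D : seq (seq I) := A.
have UD : uniq D by exact: fset_uniq.
have cE x' y' : (forall s, occurrences x' y' s -> s \in D) ->
    count x' y' = \sum_(s <- D) (if occ x' y' s then pattern_vec s else 0).
  by move=> sub; rewrite (countE UD sub) big_mkcond.
have inA x' y' s : occurrences x' y' s -> s \in fset_set (occurrences x' y').
  by move=> os; rewrite in_fset_set; [exact: mem_set | exact: occurrences_finite].
rewrite /signed_count !cE; try by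
  move=> s /inA; rewrite /D /A /= !inE => ->; rewrite ?orbT.
rewrite -!sumrB -!big_split /=.
pose unm x' y' z' s := `[< pattern s /\ unmatched Y m c x' y' z' s >].
pose bad s := [|| unm x y z s, unm y x z s, unm y z x s, unm z y x s,
  unm z x y s | unm x z y s].
(* A translate that is matched on every side cancels. That it cancels exactly, and is not subtracted
   twice, is due to [dis]: it never occurs on two consecutive sides. *)
have zero s : ~~ bad s ->
  (if occ x y s then pattern_vec s else 0) - (if occ y x s then pattern_vec s else 0) +
  ((if occ y z s then pattern_vec s else 0) - (if occ z y s then pattern_vec s else
    0)) +
  ((if occ z x s then pattern_vec s else 0) - (if occ x z s then pattern_vec s else
    0)) = 0.
  have [pat|npat] := pselect (pattern s); last first.
    move=> _; have no x' y' : occ x' y' s = false by apply/asboolP => -[].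
    by rewrite !no !subrr !addr0.
  have ts : (1 < size s)%N by case: pat => g ->; rewrite size_map.
  have occE x' y' : occ x' y' s = `[< always x' y' s >].
    by apply/asboolP/asboolP => [[]|].
  have unmE x' y' z' : unm x' y' z' s =
     [&& occ x' y' s, ~~ occ x' z' s & ~~ occ z' y' s].
    rewrite !occE; apply/asboolP/and3P => [[_ []]|[/asboolP ? /asboolP ? /asboolP ?]].
      by move=> a1 a2 a3; split; apply/asboolP.
    by [].
  have dis x' y' z' : ~~ (occ x' y' s && occ y' z' s).
    rewrite !occE; apply/negP => /andP[/asboolP a1 /asboolP a2].
    exact: (always_disjoint Y_neq0 m_gt0 c_large ts a1 a2).
  rewrite /bad !unmE.
  move: (dis x y z) (dis x y x) (dis y z x) (dis y z y) (dis z x y) (dis z x z).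
  move: (dis x z y) (dis y x z) (dis z y x).
  case: (occ x y s); case: (occ y x s) => //=; case: (occ y z s) => //=;
  case: (occ z y s) => //=; case: (occ z x s) => //=; case: (occ x z s) => //=;
  by rewrite ?(subr0, sub0r, addr0, add0r, subrr, addNr).
apply: (le_trans (ler_norm_sum _ _ _)).
apply: (@le_trans _ _ (\sum_(s <- D | bad s) `|e| *+ 6)).
  rewrite (bigID bad) /= [X in _ + X]big1 ?addr0; last first.
    by move=> s /zero ->; rewrite normr0.
  apply: ler_sum => s _.
  have n x' y' : `|if occ x' y' s then pattern_vec s else 0| <= `|e|.
    by case: ifP => _; [exact: pattern_vec_norm | rewrite normr0].
  rewrite -[6%N]/(1 + 1 + (1 + 1) + (1 + 1))%N !mulrnDr !mulr1n.
  have dd x' y' x2 y2 : `|(if occ x' y' s then pattern_vec s else 0)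
      - (if occ x2 y2 s then pattern_vec s else 0)| <= `|e| + `|e|.
    exact: le_trans (ler_normB _ _) (lerD (n _ _) (n _ _)).
  apply: (le_trans (ler_normD _ _)); apply: lerD => //.
  exact: le_trans (ler_normD _ _) (lerD (dd _ _ _ _) (dd _ _ _ _)).
rewrite big_const_seq iter_addr_0 -[leLHS]mulr_natl ler_wpM2r ?mulrn_wge0//.
rewrite ler_nat.
have U6 x' y' z' : (count_mem true [seq unm x' y' z' s | s <- D] <= M)%N.
  rewrite count_map -size_filter; apply: (HM x' y' z'); first exact: filter_uniq.
  by move=> s; rewrite mem_filter /= => /andP[/eqP/asboolP].
have cU (a b : pred (seq I)) m1 m2 : (seq.count a D <= m1)%N ->
  (seq.count b D <= m2)%N ->
    (seq.count (fun s => a s || b s) D <= m1 + m2)%N.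
  move=> h1 h2; apply: leq_trans (leq_add h1 h2).
  by rewrite -count_predUI -[X in (X <= _)%N]/(seq.count (predU a b) D) leq_addr.
have {}U6 x' y' z' : (seq.count (unm x' y' z') D <= M)%N.
  apply: leq_trans (U6 x' y' z'); rewrite count_map; apply: sub_count => s /=.
  by move=> ->.
rewrite -!addnA /bad.
by do 5! (apply: (cU _ _ _ _ (U6 _ _ _))); exact: U6.
Qed.

Variable o : X.

Definition counting_cocycle (g : G) : E := signed_count o (act g o).

Lemma counting_quasi_cocycle : quasi_cocycle rho counting_cocycle.
Proof.
have [M HM] := signed_count_triangle; exists M => g h.
rewrite /counting_cocycle -signed_count_act -actM.
have := HM o (act g o) (act (g * h)%g o).
rewrite (signed_countN o (act (g * h)%g o)) -normrN; congr (`|_| <= _).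
by rewrite opprB opprD addrA.
Qed.

End Counting.

(** * Powers and the axis of a loxodromic element *)

Section IntPowers.
Context {G : groupType}.
Implicit Types (f g : G) (k l : int).

Definition zpow f k : G :=
  match k with Posz n => (f ^+ n)%g | Negz n => (f ^- n.+1)%g end.

Lemma zpow0 f : zpow f 0 = 1%g. Proof. by []. Qed.

Lemma zpow1 f : zpow f 1 = f. Proof. exact: expg1. Qed.

Lemma zpowS f k : zpow f (k + 1) = (zpow f k * f)%g.
Proof.
case: k => [n|n]; first by rewrite -PoszD addn1 /= expgSr.
case: n => [|n]; first by rewrite /= expg1 mulVg.
rewrite (_ : Negz n.+1 + 1 = Negz n) /=; last by rewrite !NegzE; lia.
by rewrite (expgS f n.+1) invgM mulgVK.
Qed.

Lemma zpowB1 f k : zpow f (k - 1) = (zpow f k * f^-1)%g.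
Proof. by rewrite -[in RHS](subrK 1 k) zpowS mulgK. Qed.

Lemma zpowD f k l : zpow f (k + l) = (zpow f k * zpow f l)%g.
Proof.
elim/int_ind: l => [|n IH|n IH]; first by rewrite addr0 zpow0 mulg1.
  by rewrite -addn1 PoszD addrA !zpowS IH mulgA.
by rewrite -addn1 PoszD opprD addrA !zpowB1 IH mulgA.
Qed.

Lemma zpowN f k : zpow f (- k) = (zpow f k)^-1%g.
Proof. by apply/esym/mulg1_eq; rewrite -zpowD subrr. Qed.

Lemma zpow_nat f (n : nat) : zpow f n = (f ^+ n)%g. Proof. by []. Qed.

Lemma zpowV f k : zpow f^-1%g k = zpow f (- k).
Proof.
rewrite zpowN; case: k => n /=; first by rewrite expVgn.
by rewrite expVgn.
Qed.

Lemma zpow_commute f g k l : (g * zpow f k = zpow f k * g)%g ->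
  (g * zpow f (k * l) = zpow f (k * l) * g)%g.
Proof.
move=> H; elim/int_ind: l => [|n IH|n IH].
- by rewrite mulr0 mulg1 mul1g.
- by rewrite -addn1 PoszD mulrDr mulr1 zpowD mulgA IH -!mulgA H.
- rewrite -addn1 PoszD opprD mulrDr mulrN1 zpowD mulgA IH -!mulgA; congr (_ * _)%g.
  rewrite zpowN; apply: (@mulgI _ (zpow f k)); rewrite mulVKg mulgA -H mulgK.
  by [].
Qed.

Lemma zpow_conj f g k l n : (g * zpow f k * g^-1 = zpow f l)%g ->
  (g * zpow f (k * n) * g^-1 = zpow f (l * n))%g.
Proof.
move=> H; elim/int_ind: n => [|n IH|n IH].
- by rewrite !mulr0 mulg1 mulgV.
- rewrite -addn1 PoszD !mulrDr !mulr1 !zpowD -IH -H !mulgA.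
  by rewrite mulgVK.
- rewrite -addn1 PoszD opprD !mulrDr !mulrN1 !zpowD -IH !zpowN -H !invgM invgK !mulgA.
  by rewrite mulgVK.
Qed.

(** The commensurator of [f]; for a loxodromic element of an acylindrical
    action, this is the maximal elementary subgroup containing [f]. *)
Definition commens f : set G := [set g | exists k l,
  [/\ k != 0, l != 0 & (g * zpow f k * g^-1 = zpow f l)%g]].

Lemma commens_zpow f k : commens f (zpow f k).
Proof. by exists 1, 1; split=> //; rewrite -zpowD addrC zpowD mulgK. Qed.

Lemma commens1 f : commens f 1%g.
Proof. exact: (commens_zpow f 0). Qed.

Lemma commensM f g h : commens f g -> commens f h -> commens f (g * h)%g.
Proof.
move=> [k [l [k0 l0 eg]]] [k' [l' [k'0 l'0 eh]]].
exists (k' * k), (l * l'); split; rewrite ?mulf_neq0//.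
have := zpow_conj k eh; have := zpow_conj l' eg.
by rewrite (mulrC k) => <- <-; rewrite invgM !mulgA.
Qed.

Lemma commensV f g : commens f g -> commens f g^-1%g.
Proof.
move=> [k [l [k0 l0 eg]]]; exists l, k; split=> //.
by rewrite -eg invgK !mulgA mulVg mul1g mulgVK.
Qed.

End IntPowers.

Section Axis.
Context {R : realType} {X : metricType R} {G : groupType}.
Variables (delta : R) (act : G -> X -> X) (o : X).
Hypothesis hyp : hyperbolic_with X delta.
Hypothesis act_isom : isometric_action act.
Local Notation d := (@mdist R X).

Lemma act_1 x : act 1%g x = x. Proof. by case: act_isom. Qed.
Lemma act_M g h x : act (g * h)%g x = act g (act h x). Proof. by case: act_isom. Qed.
Lemma act_d g x y : d (act g x) (act g y) = d x y. Proof. by case: act_isom. Qed.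
Lemma act_K g : cancel (act g) (act g^-1%g).
Proof. by move=> x; rewrite -act_M mulVg act_1. Qed.
Lemma act_KV g : cancel (act g^-1%g) (act g).
Proof. by move=> x; rewrite -act_M mulgV act_1. Qed.
Lemma act_gp g p x y : gp (act g p) (act g x) (act g y) = gp p x y.
Proof. by rewrite /gp !act_d. Qed.
Lemma act_dV g x y : d (act g x) y = d x (act g^-1%g y).
Proof. by rewrite -(act_d g^-1%g) act_K. Qed.

(** Local-to-global: as the steps are long compared with [C], the point [o] and the previous orbit
    point look alike from the next one. *)
Lemma power_chain f C (n : nat) : gp o (act f o) (act f^-1%g o) <= C ->
  2 * C + 4 * delta + 1 <= d o (act f o) ->
  gp (act (f ^+ n)%g o) o (act (f ^+ n.+1)%g o) <= C + delta.
Proof.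
move=> fC fL; have d0 := hyp_ge0 hyp o; have g0 := gp_ge0 o (act f o) (act f^-1%g o).
elim: n => [|n IH]; first by rewrite expg0 act_1 gp0l; lra.
set p := act (f ^+ n)%g o in IH; set q := act (f ^+ n.+1)%g o in IH *.
have h1 : gp q p (act (f ^+ n.+2)%g o) <= C.
  rewrite (_ : p = act (f ^+ n.+1)%g (act f^-1%g o)); last first.
    by rewrite /p -act_M expgSr mulgK.
  by rewrite /q (expgSr f n.+1) act_M act_gp gpC.
have h2 : d p q = d o (act f o) by rewrite /p /q expgSr act_M act_d.
have h3 := gp_split p q o; rewrite h2 (gpC p q o) in h3.
by apply: (gp_transfer hyp h1); lra.
Qed.

Variables (f : G) (C : R).
Hypothesis fC : gp o (act f o) (act f^-1%g o) <= C.
Hypothesis fL : 2 * C + 4 * delta + 1 <= d o (act f o).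

Definition axis_pt (k : int) : X := act (zpow f k) o.
Local Notation pt := axis_pt.
Local Notation l := (d o (act f o)).
(** The bound for the product at an orbit point of two others on either side of it; it exceeds that
    of [power_chain] by one [delta], paid for joining two half lines. *)
Definition line_a : R := C + 2 * delta.
Local Notation a0 := line_a.

Lemma line_const : [/\ 0 <= delta, 0 <= C, 0 <= a0, 1 <= l & a0 = C + 2 * delta].
Proof.
have d0 := hyp_ge0 hyp o; have g0 := gp_ge0 o (act f o) (act f^-1%g o).
by move: fC fL => ? ?; split; rewrite /line_a //; lra.
Qed.

Lemma pt0 : pt 0 = o. Proof. by rewrite /pt act_1. Qed.

Lemma pt_shift k i : act (zpow f k) (pt i) = pt (k + i).
Proof. by rewrite /pt -act_M zpowD. Qed.

Lemma pt_dist i j : d (pt i) (pt j) = d o (pt (j - i)).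
Proof. by rewrite -(act_d (zpow f (- i))) !pt_shift addNr addrC pt0. Qed.

Lemma pt_gp k i j : gp (pt k) (pt i) (pt j) = gp o (pt (i - k)) (pt (j - k)).
Proof. by rewrite -(act_gp (zpow f (- k))) !pt_shift addNr pt0 !(addrC (- k)). Qed.

Lemma pt_step (n : nat) : d o (pt n) + 1 <= d o (pt n.+1) <= d o (pt n) + l.
Proof.
have h := power_chain n fC fL; rewrite -!zpow_nat -!/(pt _) in h.
have := gp_dist (pt n) o (pt n.+1); have := metric_triangle o (pt n) (pt n.+1).
have -> : d (pt n) (pt n.+1) = l.
  by rewrite pt_dist -addn1 PoszD addrC addKr /pt zpow1.
rewrite (metric_sym (pt n) o); have [d0 _ _ _ _] := line_const.
by move: fL => ? ? ?; apply/andP; split; lra.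
Qed.

Lemma pt_dist_nat (n : nat) : n%:R <= d o (pt n) <= n%:R * l.
Proof.
elim: n => [|n /andP[h1 h2]]; first by rewrite pt0 mdistxx mul0r lexx.
by have /andP[h3 h4] := pt_step n; rewrite -[n.+1]addn1 natrD mulrDl mul1r addn1;
  apply/andP; split; lra.
Qed.

Lemma pt_dist_abs i : `|i|%N%:R <= d o (pt i) <= `|i|%N%:R * l.
Proof.
case: i => n; first exact: pt_dist_nat.
rewrite NegzE abszN -(act_d (zpow f n.+1)) pt_shift subrr pt0 -/(pt n.+1) metric_sym.
exact: pt_dist_nat.
Qed.

Lemma pt_dist_bounds i j : `|i - j|%N%:R <= d (pt i) (pt j) <= `|i - j|%N%:R * l.
Proof. by rewrite metric_sym pt_dist pt_dist_abs. Qed.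

Lemma pt_inj i : pt i = o -> i = 0.
Proof.
move=> e; have /andP[+ _] := pt_dist_abs i; rewrite e mdistxx.
by rewrite (ler_nat R _ 0) leqn0 absz_eq0 => /eqP.
Qed.

Lemma between0 (p q : nat) : gp o (pt (- p%:Z)) (pt q) <= a0.
Proof.
have [d0 C0 a00 l1 ea] := line_const.
case: p => [|p]; first by rewrite oppr0 pt0 gp0l.
case: q => [|q]; first by rewrite pt0 gpC gp0l.
have h1 : gp o (pt (- p.+1%:Z)) (pt 1) <= C + delta.
  have := power_chain p.+1 fC fL; rewrite -!zpow_nat -!/(pt _).
  rewrite -{1}pt0 (pt_gp p.+1 0 p.+2) sub0r.
  by rewrite (_ : p.+2%:Z - p.+1%:Z = 1)//; lia.
have h2 : gp (pt 1) o (pt q.+1) <= C + delta.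
  have fC' : gp o (act f^-1%g o) (act f^-1^-1%g o) <= C by rewrite invgK gpC.
  have fL' : 2 * C + 4 * delta + 1 <= d o (act f^-1%g o).
    by rewrite -(act_d f) act_KV metric_sym.
  have := power_chain q fC' fL'; rewrite -!zpow_nat -!/(zpow _ _) !zpowV -!/(pt _).
  rewrite -{1}pt0 -(act_gp (zpow f q.+1)) !pt_shift addr0 subrr pt0 gpC.
  by rewrite (_ : q.+1%:Z - q%:Z = 1)//; lia.
have h3 := gp_split o (pt 1) (pt q.+1).
have e1 : d o (pt 1) = l by rewrite /pt zpow1.
have := gp_transfer hyp (z := pt q.+1) (p := o) (x := pt 1) (y := pt (- p.+1%:Z)) (K
  := C + delta).
rewrite gpC h1 => /(_ isT) H; rewrite gpC ea.
suff : gp o (pt q.+1) (pt (- p.+1%:Z)) <= C + delta + delta by lra.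
by apply: H; move: fL => ?; lra.
Qed.

Lemma between k i j : i <= k <= j -> gp (pt k) (pt i) (pt j) <= a0.
Proof.
move=> /andP[ik kj]; rewrite pt_gp.
have -> : i - k = - (`|k - i|%N%:Z) by lia.
have -> : j - k = `|j - k|%N%:Z by lia.
exact: between0.
Qed.

Lemma quasi_line_le i j q r : i <= j -> gp q (pt i) (pt j) <= r ->
  exists2 k, i <= k <= j & d q (pt k) <= l + 2 * r + 2 * a0 + 2 * delta.
Proof.
move=> ij qr; have [d0 C0 a00 l1 ea] := line_const.
have r0 := gp_ge0 q (pt i) (pt j).
pose n := `|j - i|%N; pose b := pt i; pose s := d b q;
  pose t (k : nat) := d b (pt (i + k)).
have ejn : i + n = j by rewrite /n; lia.
have tE k : t k = d o (pt k) by rewrite /t /b pt_dist addrC addKr.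
have t0 : (t 0 <= s)%R by rewrite tE pt0 mdistxx mdist_ge0.
(* Take the last orbit point that is not farther from [b] than [q]. Unless it is the end of the
   segment, its distance from [b] agrees with that of [q] up to one step. *)
have ex : exists k, (k <= n)%N && (t k <= s) by exists 0%N.
have ub k : (k <= n)%N && (t k <= s) -> (k <= n)%N by case/andP.
case: (ex_maxnP ex ub) => k /andP[kn tk] k_max.
exists (i + k); first by apply/andP; split; move: kn ejn ij; clear; lia.
have e1 := gp_split q b (pt j); have e2 := gp_dist b q (pt (i + k)).
have e3 := gp_split b q (pt j).
rewrite -/b in qr r0; rewrite -/s -/(t k) in e2; rewrite -/s in e3.
have [kn'|kn'] := eqVneq k n.
  rewrite kn' ejn; have := gp_dist q b (pt j).
  have es : s = d q b by rewrite /s metric_sym.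
  have et : t n = d b (pt j) by rewrite /t ejn.
  by rewrite kn' et es in tk; lra.
have kn2 : (k < n)%N by rewrite ltn_neqAle kn'.
have sk : s < t k.+1.
  rewrite ltNge; apply/negP => h; have := k_max k.+1; rewrite kn2 h => /(_ isT).
  by rewrite ltnn.
have /andP[_ h1] := pt_step k; rewrite -!tE in h1.
have h2 : gp (pt (i + k)) b (pt j) <= a0.
  by apply: between; apply/andP; split; move: kn ejn ij; clear; lia.
have e4 := gp_split b (pt (i + k)) (pt j); rewrite -/(t k) in e4.
have := hyp_or hyp b q (pt j) (pt (i + k)); rewrite (gpC b (pt j) (pt (i + k))).
by case; lra.
Qed.

Lemma quasi_line i j q r : gp q (pt i) (pt j) <= r ->
  exists k, d q (pt k) <= l + 2 * r + 2 * a0 + 2 * delta.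
Proof.
move=> qr; have [ij|ij] := leP i j.
  by have [k _ h] := quasi_line_le ij qr; exists k.
by rewrite gpC in qr; have [k _ h] := quasi_line_le (ltW ij) qr; exists k.
Qed.

Lemma gp_ge_sub p x y : d p x - d x y <= gp p x y.
Proof. by have := metric_triangle p y x; rewrite /gp (metric_sym y x); lra. Qed.

Definition commens_const : R := l + 2 * (a0 + 2 * delta) + 2 * a0 + 2 * delta.

(** Arbitrarily far in both directions, points of the translated axis are at the fixed distance [D0]
    from the axis. Going much farther than [D0] places [act g o] between two points of the axis,
    whence a bound that does not depend on [g]. *)
Lemma commens_near g : commens f g -> exists k, d (act g o) (pt k) <= commens_const.
Proof.
move=> [k [m [k0 m0 eg]]]; have [d0 C0 a00 l1 ea] := line_const.
pose u := act g o; pose D0 := d u o.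
have near n : d (act g (pt (k * n))) (pt (m * n)) = D0.
  have -> : act g (pt (k * n)) = act (zpow f (m * n)) u.
    by rewrite -(zpow_conj n eg) /u /pt -!act_M mulgVK.
  by rewrite /pt act_d.
pose N := Num.truncn (D0 + a0 + 3 * delta + 1).
have Nlt : D0 + a0 + 3 * delta + 1 < N.+1%:R by apply: truncnS_gt; rewrite num_real.
have far (n : int) : `|n|%N = N.+1 -> N.+1%:R <= d u (act g (pt (k * n))).
  move=> nN; rewrite /u act_d; have /andP[+ _] := pt_dist_abs (k * n).
  apply: le_trans; rewrite ler_nat abszM nN leq_pmull// lt0n absz_eq0.
  exact: k0.
apply: (@quasi_line (m * N.+1%:Z) (m * - N.+1%:Z) (act g o) (a0 + 2 * delta)).
have h1 : gp u (act g (pt (k * N.+1%:Z))) (act g (pt (k * - N.+1%:Z))) <= a0.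
  rewrite /u act_gp -pt0 mulrN.
  have [k1|k1] := leP 0 k; last first.
    by apply: between; apply/andP; split; nia.
  by rewrite gpC; apply: between; apply/andP; split; nia.
have g1 := gp_ge_sub u (act g (pt (k * N.+1%:Z))) (pt (m * N.+1%:Z)).
have g2 := gp_ge_sub u (act g (pt (k * - N.+1%:Z))) (pt (m * - N.+1%:Z)).
rewrite near in g1; rewrite near in g2.
have f1 := far N.+1%:Z erefl; have f2 : N.+1%:R <= d u (act g (pt (k * - N.+1%:Z))).
  by apply: far; rewrite abszN.
have h2 : gp u (pt (m * N.+1%:Z)) (act g (pt (k * - N.+1%:Z))) <= a0 + delta.
  by apply: (gp_transfer hyp h1); lra.
rewrite gpC in h2.
have h3 : gp u (pt (m * - N.+1%:Z)) (pt (m * N.+1%:Z)) <= a0 + delta + delta.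
  by apply: (gp_transfer hyp h2); lra.
by rewrite gpC; lra.
Qed.

End Axis.

(** * Cosets of the commensurator *)

Section Cosets.
Context {G : groupType} (f : G).
Local Notation E := (commens f).

Definition coset (a : G) : set G := [set g | E (a^-1 * g)%g].

Definition cosets : Type := {A : set G | `[< exists a, A = coset a >]}.
HB.instance Definition _ := Choice.on cosets.

Definition lab (a : G) : cosets :=
  exist _ (coset a) (asboolT (ex_intro (fun b => coset a = coset b) a erefl)).

Lemma lab_surj (i : cosets) : exists a, i = lab a.
Proof.
case: i => A hA; have /asboolP [a eA] := hA.
by exists a; apply: val_inj => /=.
Qed.

Lemma lab_eq a b : lab a = lab b <-> E (a^-1 * b)%g.
Proof.
split=> [[e]|Eab].
  have : coset b b by rewrite /coset /= mulVg; exact: commens1.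
  by rewrite -e.
apply: val_inj; apply/seteqP; split=> g /= Eg.
  rewrite /coset /=; have -> : (b^-1 * g = (a^-1 * b)^-1 * (a^-1 * g))%g by rewrite
    invgM invgK !mulgA mulgK.
  by apply: commensM => //; exact: commensV.
rewrite /coset /=; have -> : (a^-1 * g = (a^-1 * b) * (b^-1 * g))%g by rewrite !mulgA
  mulgK.
exact: commensM.
Qed.

Definition act_cosets (g : G) (i : cosets) : cosets := lab (g * projT1 (cid (lab_surj
  i)))%g.

Lemma act_lab g a : act_cosets g (lab a) = lab (g * a)%g.
Proof.
rewrite /act_cosets; case: cid => b /= /lab_eq Eab; apply/lab_eq.
rewrite invgM -mulgA mulKg; have := commensV Eab; by rewrite invgM invgK.
Qed.

Lemma act_cosets1 i : act_cosets 1%g i = i.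
Proof. by have [a ->] := lab_surj i; rewrite act_lab mul1g. Qed.

Lemma act_cosetsM g h i : act_cosets (g * h)%g i = act_cosets g (act_cosets h i).
Proof. by have [a ->] := lab_surj i; rewrite !act_lab mulgA. Qed.

End Cosets.

Section FinitePigeonhole.
Context {T : choiceType}.

Lemma finite_pigeonhole (H : set T) (n : nat) (g : nat -> T) : finite_set H ->
  (#|` fset_set H| <= n)%N -> (forall s, (s <= n)%N -> H (g s)) ->
  exists s s', [/\ (s < s')%N, (s' <= n)%N & g s = g s'].
Proof.
move=> fH Hn gH; apply: contrapT => no.
have : (n.+1 <= #|` fset_set H|)%N; last by move=> h; have := leq_trans h Hn;
  rewrite ltnn.
rewrite -(size_iota 0 n.+1) -(size_map g) cardfE.
rewrite -cardfE; apply: uniq_leq_size.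
  rewrite map_inj_in_uniq ?iota_uniq// => s s'; rewrite !mem_iota !add0n !ltnS /=.
  move=> sn s'n e; case: (ltngtP s s') => // lt; case: no.
    by exists s, s'.
  by exists s', s.
move=> _ /mapP[s + ->]; rewrite mem_iota add0n ltnS /= => sn.
by rewrite in_fset_set//; apply/mem_set/gH.
Qed.

End FinitePigeonhole.

Lemma conj_of_eq (G : groupType) (a b g x y : G) : (a^-1 * g * x = b^-1 * g * y ->
  g * (x * y^-1) * g^-1 = a * b^-1)%g.
Proof.
move=> e; have -> : (g * (x * y^-1) = a * (a^-1 * g * x) * y^-1)%g.
  by rewrite !mulgA mulgV mul1g.
by rewrite e !mulgA !mulgK.
Qed.

Lemma conj_eq1 (G : groupType) (g x : G) : (g * x * g^-1 = 1 -> x = 1)%g.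
Proof. by move/divg1_eq => e; apply: (@mulgI _ g); rewrite e mulg1. Qed.

Lemma int_sign_abs (k : int) : k = (if 0 <= k then 1 else -1) * `|k|%N%:Z.
Proof. by case: ifP; lia. Qed.

(** * Translates of the quasi-axis: quasi-convexity and separation *)

Section Elementary.
Context {R : realType} {X : metricType R} {G : groupType}.
Variables (delta : R) (act : G -> X -> X) (o : X).
Hypothesis hyp : hyperbolic_with X delta.
Hypothesis act_isom : isometric_action act.
Hypothesis acyl : acylindrical act.
Local Notation d := (@mdist R X).
Variables (f : G) (C : R).
Hypothesis fC : gp o (act f o) (act f^-1%g o) <= C.
Hypothesis fL : 2 * C + 4 * delta + 1 <= d o (act f o).
Local Notation l := (d o (act f o)).
Local Notation a0 := (line_a delta C).
Local Notation pt := (axis_pt act o f).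
Local Notation E := (commens f).
Local Notation D3 := (commens_const delta act o f C).
Let const := line_const hyp fC fL.

Definition Yset (i : cosets f) : set X := [set act g o | g in sval i].

Lemma Yset_lab a p : Yset (lab f a) p <-> exists2 h, E h & p = act (a * h)%g o.
Proof.
split=> [[g Eg <-]|[h Eh ->]].
  by exists (a^-1 * g)%g; rewrite ?mulVKg.
by exists (a * h)%g => //=; rewrite /coset /= mulKg.
Qed.

Lemma Yset_neq0 i : Yset i !=set0.
Proof.
have [a ->] := lab_surj i; exists (act (a * 1)%g o); apply/Yset_lab.
by exists 1%g => //; exact: commens1.
Qed.

Lemma Yset_act g i p : Yset i p -> Yset (act_cosets g i) (act g p).
Proof.
have [a ->] := lab_surj i => /Yset_lab [h Eh ->].
by rewrite act_lab; apply/Yset_lab; exists h; rewrite // -(act_M act_isom) mulgA.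
Qed.

Lemma Yset_near_axis p : Yset (lab f 1%g) p -> exists k, d p (pt k) <= D3.
Proof.
move=> /Yset_lab [h Eh ->]; rewrite mul1g.
exact: (commens_near hyp act_isom fC fL Eh).
Qed.

Lemma Yset_pt k : Yset (lab f 1%g) (pt k).
Proof. by apply/Yset_lab; exists (zpow f k); rewrite ?mul1g//; exact: commens_zpow. Qed.

Definition qc_const : R := l + 4 * D3 + 2 * a0 + 2 * delta.

Lemma D3_ge0 : 0 <= D3.
Proof. by case: const => ? ? ? ? _; rewrite /commens_const; lra. Qed.

Lemma qc_const_ge0 : 0 <= qc_const.
Proof. by case: const => ? ? ? ? _; have := D3_ge0; rewrite /qc_const; lra. Qed.

Lemma Yset_quasi_convex : quasi_convex Yset qc_const.
Proof.
move=> i u v q; have [a ->] := lab_surj i.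
move=> /Yset_lab [h Eh eu] /Yset_lab [h' Eh' ev] uqv.
have [k uk] := commens_near hyp act_isom fC fL Eh.
have [k' vk] := commens_near hyp act_isom fC fL Eh'.
set q' := act a^-1%g q.
have g0 : gp q' (act h o) (act h' o) = 0.
  rewrite -(act_gp act_isom a) /q' (act_KV act_isom) -!(act_M act_isom) -eu -ev.
  by rewrite /gp (metric_sym q u) uqv; lra.
have g1 : gp q' (pt k) (pt k') <= 2 * D3.
  have := gp_lip (act h o) q' (pt k) (pt k').
  have := gp_lipr (act h' o) q' (act h o) (pt k').
  by rewrite g0 (metric_sym (pt k)) (metric_sym (pt k')); lra.
have [n qn] := quasi_line hyp act_isom fC fL g1.
exists (act a (pt n)).
  by have := Yset_act a (Yset_pt n); rewrite act_lab mulg1.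
have <- : d q' (pt n) = d q (act a (pt n)) by rewrite /q' (act_dV act_isom) invgK.
by rewrite /qc_const; lra.
Qed.

Lemma acyl_axis (B : R) : 0 < B -> exists M : nat, forall i j : int,
  (M <= `|i - j|)%N ->
  finite_set [set g | d (pt i) (act g (pt i)) < B /\ d (pt j) (act g (pt j)) < B].
Proof.
move=> /acyl [D [N H]]; exists (Num.truncn D).+1 => i j ij.
apply: card_le_finite (H (pt i) (pt j) _) (finite_II N).
have /andP[+ _] := pt_dist_bounds hyp act_isom fC fL i j.
apply: lt_le_trans; apply: lt_le_trans (_ : (Num.truncn D).+1%:R <= _).
  by apply: truncnS_gt; rewrite num_real.
by rewrite ler_nat.
Qed.

(** By acylindricity two of the elements [f^(- phi s) g f^s], which almost fix
    two distant points of the axis, coincide; then [g] commensurates [f]. *)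
Lemma axis_overlap r : 0 <= r -> exists D, forall g i i' j j', ~ E g ->
  d (pt i) (act g (pt i')) <= r -> d (pt j) (act g (pt j')) <= r ->
  d (pt i) (pt j) <= D.
Proof.
move=> r0; have [d0 C0 a00 l1 ea] := const.
pose r2 := l + 2 * (a0 + 2 * r) + 2 * a0 + 2 * delta.
have r20 : 0 <= r2 by rewrite /r2; lra.
have [|M HM] := @acyl_axis (2 * r2 + 1); first by lra.
pose Q := (Num.truncn (2 * r2 + M%:R * l)).+1.
pose Hs (e : int) : set G := [set h | d o (act h o) <= r2 /\
  exists k : int, (`|k| <= Q)%N /\ d (act h (pt (e * M%:Z))) (pt k) <= r2].
have finH e : `|e|%N = 1%N -> finite_set (Hs e).
  move=> e1; apply: (@sub_finite_set _ _ (\bigcup_(k in `I_(2 * Q).+1)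
     [set h | d o (act h o) <= r2 /\ d (act h (pt (e * M%:Z))) (pt (k%:Z - Q%:Z)) <=
       r2])).
    move=> h [h1 [k [kQ h2]]]; exists `|(k + Q%:Z)%R|%N => /=; first by move: kQ;
      clear; lia.
    by rewrite (_ : `|(k + Q%:Z)%R|%N%:Z - Q%:Z = k)//; move: kQ; clear; lia.
  apply: bigcup_finite; first exact: finite_II.
  move=> k _; set A := [set h | _].
  have [[h0 [h01 h02]]|no] := pselect (exists h0, A h0); last first.
    by apply: (@sub_finite_set _ _ set0) => // h Ah; apply: no; exists h.
  apply: (@sub_finite_set _ _ ((fun g => h0 * g)%g @` [set g |
     d (pt 0) (act g (pt 0)) < 2 * r2 + 1 /\
     d (pt (e * M%:Z)) (act g (pt (e * M%:Z))) < 2 * r2 + 1])); last first.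
    by apply: finite_image; apply: HM; rewrite sub0r abszN abszM e1 mul1n.
  move=> h [h1 h2]; exists (h0^-1 * h)%g; last by rewrite mulVKg.
  rewrite /= !(act_M act_isom) -!(act_dV act_isom h0) (pt0 o act_isom).
  have t1 := metric_triangle (act h0 o) o (act h o).
  have t2 := metric_triangle (act h0 (pt (e * M%:Z))) (pt (k%:Z - Q%:Z)) (act h (pt
    (e * M%:Z))).
  rewrite (metric_sym (act h0 o) o) in t1.
  by rewrite (metric_sym (pt (k%:Z - Q%:Z)) (act h _)) in t2; split; lra.
(* [S] bounds the number of candidates for both orientations. An overlap longer than [D] has room
   for the positions 0 to [S], each followed by a second point [M] steps further on. *)
pose S := maxn #|` fset_set (Hs 1)| #|` fset_set (Hs (- 1))|.
pose D := (S + M + 1)%N%:R * l + 2 * r.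
exists D => g i i' j j' nE di dj; rewrite leNgt; apply/negP => Dlt.
pose g1 := (zpow f (- i) * g * zpow f i')%g.
have nE1 : ~ E g1.
  move=> Eg1; apply: nE.
  have -> : g = (zpow f i * g1 * zpow f (- i'))%g.
    by rewrite /g1 !zpowN !mulgA mulgV mul1g mulgK.
  by do 2 ?apply: commensM => //; exact: commens_zpow.
pose J := j - i; pose J' := j' - i'.
have g1E k : act g1 (pt k) = act (zpow f (- i)) (act g (pt (i' + k))).
  by rewrite /g1 !(act_M act_isom) (pt_shift o act_isom).
have d1 : d o (act g1 o) <= r.
  rewrite -(pt0 o act_isom f) g1E addr0 -(act_d act_isom (zpow f i)) (pt_shift o
    act_isom) addr0.
  by rewrite zpowN (act_KV act_isom).
have d2 : d (pt J) (act g1 (pt J')) <= r.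
  rewrite g1E -(act_d act_isom (zpow f i)) (pt_shift o act_isom) zpowN (act_KV
    act_isom).
  by rewrite /J /J' !addrA !(addrC _ j) !(addrC _ j') !addrK.
have d3 : d o (pt J) = d (pt i) (pt j) by rewrite [RHS](pt_dist o act_isom).
pose e : int := if 0 <= J' then 1 else -1.
have e1 : `|e|%N = 1%N by rewrite /e; case: ifP.
have eJ : J' = e * `|J'|%N%:Z := int_sign_abs J'.
have lJ' : (S + M < `|J'|)%N.
  rewrite ltnNge; apply/negP => lt.
  have /andP[_ h1] := pt_dist_abs hyp act_isom fC fL J'.
  have h2 : `|J'|%N%:R * l <= (S + M)%N%:R * l by rewrite ler_wpM2r ?ler_nat//; lra.
  have h3 := metric_triangle o (act g1 o) (pt J).
  have h4 := metric_triangle (act g1 o) (act g1 (pt J')) (pt J).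
  rewrite (act_d act_isom) (metric_sym (act g1 (pt J')) (pt J)) in h4.
  by move: Dlt; rewrite /D -d3 natrD mulrDl mul1r; lra.
have near (s : nat) : exists k, (s <= `|J'|)%N ->
  d (act g1 (pt (e * s%:Z))) (pt k) <= r2.
  have [sJ|sJ] := leqP s `|J'|%N; last by exists 0.
  have h1 : gp (pt (e * s%:Z)) o (pt J') <= a0.
    rewrite -[X in gp _ X _](pt0 o act_isom f).
    have [J0|J0] := leP 0 J'.
      by apply: (between hyp act_isom fC fL); rewrite /e J0; apply/andP; split;
        move: sJ J0; clear; lia.
    rewrite gpC; apply: (between hyp act_isom fC fL).
    have -> : e = -1 by rewrite /e leNgt J0.
    by apply/andP; split; move: sJ J0; clear; lia.
  rewrite -(act_gp act_isom g1) in h1.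
  have h2 := gp_lip (act g1 o) (act g1 (pt (e * s%:Z))) (pt 0) (pt J).
  have h3 := gp_lipr (act g1 (pt J')) (act g1 (pt (e * s%:Z))) (act g1 o) (pt J).
  rewrite {2}(pt0 o act_isom f) in h2.
  have [|k hk] := quasi_line hyp act_isom fC fL (i := 0) (j := J) (q := act g1 (pt (e
    * s%:Z))) (r := a0 + 2 * r).
    by lra.
  by exists k => _.
pose phi s := projT1 (cid (near s)).
have phiP s : (s <= `|J'|)%N -> d (act g1 (pt (e * s%:Z))) (pt (phi s)) <= r2.
  exact: (projT2 (cid (near s))).
pose h (s : nat) : G := (zpow f (- phi s) * g1 * zpow f (e * s%:Z))%g.
have hH s : (s <= S)%N -> Hs e (h s).
  move=> sS; have sJ : (s <= `|J'|)%N by move: lJ' sS; clear; lia.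
  have sMJ : (s + M <= `|J'|)%N by move: lJ' sS; clear; lia.
  split.
    rewrite /h (act_M act_isom (_ * g1)%g) (act_M act_isom _ g1) (zpowN f (phi s))
      metric_sym (act_dV act_isom) invgK.
    exact: phiP.
  exists (phi (s + M)%N - phi s); split; last first.
    rewrite /h (act_M act_isom (_ * g1)%g) (act_M act_isom _ g1) (pt_shift o
      act_isom) -mulrDr -PoszD (zpowN f (phi s)).
    rewrite (act_dV act_isom) invgK.
    by rewrite (pt_shift o act_isom) addrC subrK; exact: phiP.
  have h1 := phiP _ sJ; have h2 := phiP _ sMJ.
  have t1 := metric_triangle (pt (phi (s + M)%N)) (act g1 (pt (e * (s + M)%N%:Z)))
    (pt (phi s)).
  have t2 := metric_triangle (act g1 (pt (e * (s + M)%N%:Z))) (act g1 (pt (e *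
    s%:Z))) (pt (phi s)).
  rewrite (act_d act_isom) in t2.
  have t0 := metric_sym (pt (phi (s + M)%N)) (act g1 (pt (e * (s + M)%N%:Z))).
  have /andP[_ t3] := pt_dist_bounds hyp act_isom fC fL (e * (s + M)%N%:Z) (e * s%:Z).
  have es : `|(e * (s + M)%N%:Z - e * s%:Z)%R|%N = M.
    by rewrite -mulrBr PoszD addrC addKr abszM e1 mul1n.
  rewrite es in t3.
  have /andP[t4 _] := pt_dist_bounds hyp act_isom fC fL (phi (s + M)%N) (phi s).
  rewrite -(ler_nat R); apply: (@le_trans _ _ (2 * r2 + M%:R * l)); first by lra.
  by rewrite /Q; apply/ltW/truncnS_gt; rewrite num_real.
have [|s [s' [ss' s'S]]] := @finite_pigeonhole _ (Hs e) S h (finH e e1) _ hH.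
- by rewrite /e /S; case: ifP => _; rewrite ?leq_maxl ?leq_maxr.
rewrite /h => eh; apply: nE1; exists (e * (s%:Z - s'%:Z)), (phi s - phi s').
have key : (g1 * zpow f (e * (s%:Z - s'%:Z)) * g1^-1 = zpow f (phi s - phi s'))%g.
  rewrite mulrBr (zpowD f (e * s%:Z)) (zpowN f (e * s'%:Z)) (zpowD f (phi s)) zpowN.
  by apply: conj_of_eq; rewrite -!zpowN.
have e0 : e * (s%:Z - s'%:Z) != 0.
  rewrite mulf_neq0//; first by rewrite -absz_eq0 e1.
  by rewrite subr_eq0 eqz_nat; move: ss'; clear; lia.
split=> //; apply/eqP => p0; move: key; rewrite p0 zpow0 => /conj_eq1 z1.
by move/eqP: e0; apply; apply: (pt_inj hyp act_isom fC fL);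
  rewrite /axis_pt z1 (act_1 act_isom).
Qed.

Lemma Yset_separated r : exists D, 0 <= D /\ separated Yset r D.
Proof.
have [r0|r0] := leP 0 r; last first.
  exists 0; split=> // i j p q _ [w _ pw]; have := mdist_ge0 p w; lra.
have rD : 0 <= 2 * (r + D3) by have := D3_ge0; lra.
have [D HD] := axis_overlap rD.
exists (`|D| + 2 * (r + D3)); split; first by have := normr_ge0 D; lra.
move=> i j p q; have [a ->] := lab_surj i; have [b ->] := lab_surj j => ab.
have near c x : near_set Yset r (lab f c) x -> exists k, d x (act c (pt k)) <= r + D3.
  move=> [w /Yset_lab [h Eh ->] xw].
  have [k hk] := commens_near hyp act_isom fC fL Eh; exists k.
  have := metric_triangle x (act (c * h)%g o) (act c (pt k)).
  by rewrite (act_M act_isom) (act_d act_isom); rewrite (act_M act_isom) in xw; lra.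
move=> /near [i1 pi] /near [i2 pj] /near [j1 qi] /near [j2 qj].
have nE : ~ E (a^-1 * b)%g by move=> Eab; apply: ab; apply/lab_eq.
have dE n n' : d (pt n) (act (a^-1 * b)%g (pt n')) = d (act a (pt n)) (act b (pt n')).
  by rewrite -(act_d act_isom a) -(act_M act_isom a) mulVKg.
have := HD _ i1 i2 j1 j2 nE; rewrite !dE.
have t1 := metric_triangle (act a (pt i1)) p (act b (pt i2)).
have t2 := metric_triangle (act a (pt j1)) q (act b (pt j2)).
have t3 := metric_triangle p (act a (pt i1)) q.
have t4 := metric_triangle (act a (pt i1)) (act a (pt j1)) q.
rewrite (metric_sym (act a (pt i1)) p) in t1;
  rewrite (metric_sym (act a (pt j1)) q) in t2 t4.
move=> H; have := ler_norm D; have : d (act a (pt i1)) (act a (pt j1)) <= D.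
  by rewrite (act_d act_isom); apply: H; lra.
lra.
Qed.

End Elementary.

(** * Elements fixing several translates of the axis *)

Section Stabilizers.
Context {R : realType} {X : metricType R} {G : groupType}.
Variables (delta : R) (act : G -> X -> X) (o : X).
Hypothesis hyp : hyperbolic_with X delta.
Hypothesis act_isom : isometric_action act.
Hypothesis acyl : acylindrical act.
Local Notation d := (@mdist R X).
Variables (f : G) (C : R).
Hypothesis fC : gp o (act f o) (act f^-1%g o) <= C.
Hypothesis fL : 2 * C + 4 * delta + 1 <= d o (act f o).
Local Notation l := (d o (act f o)).
Local Notation a0 := (line_a delta C).
Local Notation pt := (axis_pt act o f).
Local Notation E := (commens f).
Local Notation D3 := (commens_const delta act o f C).
Local Notation Y := (@Yset _ _ _ act o f).
Let const := line_const hyp fC fL.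
Let Yneq0 : forall i, Y i !=set0 := @Yset_neq0 _ _ _ act o f.
Let Yact : forall g i p, Y i p -> Y (act_cosets g i) (act g p) := Yset_act act_isom
  (o := o) (f := f).

(** Both [q] and its image are near a geodesic from [u] to [v], at almost the same distance from
    [u]. *)
Lemma displacement (g : G) q u v a' b : d u (act g u) <= b -> d v (act g v) <= b ->
  gp q u v <= a' -> d q (act g q) <= 2 * a' + 7 * b + 2 * delta.
Proof.
move=> ub vb quv.
have h1 : gp (act g q) (act g u) (act g v) <= a' by rewrite (act_gp act_isom).
have h2 := gp_lip (act g u) (act g q) u v.
have h3 := gp_lipr (act g v) (act g q) (act g u) v.
have t1 := metric_triangle u (act g u) (act g q).
have t2 := metric_triangle (act g u) u (act g q).
rewrite (act_d act_isom) in t1 t2; rewrite (metric_sym (act g u) u) in t2.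
have s1 := gp_split u q v; have s2 := gp_split u (act g q) v.
have e := gp_dist u q (act g q).
have := hyp_or hyp u q v (act g q); rewrite (gpC u v (act g q)).
by case; lra.
Qed.

(** Once [P] divides [n], these elements commute with [f ^+ n], so that conjugating them by
    [f ^+ n * b] amounts to conjugating by [b]. *)
Definition small_shifts (r : R) (P : nat) : set G :=
  [set g | (g * zpow f P = zpow f P * g)%g /\ forall k, d (pt k) (act g (pt k)) <= r].

Lemma small_shifts_finite r P : finite_set (small_shifts r P).
Proof.
have [r0|r0] := ltP r 0.
  apply: (@sub_finite_set _ _ set0) => // g [_ /(_ 0)].
  by have := mdist_ge0 (pt 0) (act g (pt 0)); lra.
have [|M HM] := @acyl_axis _ _ _ _ _ _ hyp act_isom acyl _ _ fC fL (r + 1); first lra.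
apply: sub_finite_set (HM 0 M%:Z _); last by rewrite sub0r abszN.
by move=> g [_ H]; split; have := H 0; have := H M%:Z; lra.
Qed.

Lemma small_shiftsP r : exists P M : nat, (0 < P)%N /\ forall g (i : int),
  (forall k, i <= k <= i + M%:Z -> d (pt k) (act g (pt k)) <= r) -> small_shifts r P g.
Proof.
have [r0|r0] := ltP r 0.
  exists 1%N, 0%N; split=> // g i /(_ i); rewrite addr0 lexx => /(_ isT).
  by have := mdist_ge0 (pt i) (act g (pt i)); lra.
have [|M1 HM] := @acyl_axis _ _ _ _ _ _ hyp act_isom acyl _ _ fC fL (r + 1); first lra.
have {}HM := HM 0 M1%:Z; rewrite sub0r abszN leqnn in HM; have {}HM := HM isT.
set S := [set g | _] in HM; pose p := #|` fset_set S|.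
exists p`!, (p`! + p + M1)%N; split; first exact: fact_gt0.
move=> g i H.
have disp n k : d (pt k) (act (zpow f (- n) * g * zpow f n)%g (pt k))
   = d (pt (n + k)) (act g (pt (n + k))).
  rewrite !(act_M act_isom) (pt_shift o act_isom) -(act_d act_isom (zpow f n)).
  by rewrite (pt_shift o act_isom) zpowN (act_KV act_isom).
pose h (s : nat) := (zpow f (- (i + s%:Z)) * g * zpow f (i + s%:Z))%g.
have hS s : (s <= p)%N -> S (h s).
  move=> sp; split; rewrite /h disp ?addr0.
    have : d (pt (i + s%:Z)) (act g (pt (i + s%:Z))) <= r; last lra.
    by apply: H; move: sp; clear; lia.
  have : d (pt (i + s%:Z + M1%:Z)) (act g (pt (i + s%:Z + M1%:Z))) <= r; last lra.
  by apply: H; move: sp; clear; lia.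
have [s [s' [ss' s'p e]]] := finite_pigeonhole HM (leqnn p) hS.
have comm0 : (g * zpow f (s' - s)%N = zpow f (s' - s)%N * g)%g.
  have E0 : (s' - s)%N = (i + s'%:Z) - (i + s%:Z) :> int by move: ss'; clear; lia.
  move: e; rewrite /h !zpowN => e; have e' := conj_of_eq (esym e).
  rewrite E0 (zpowD f (i + s'%:Z)) (zpowN f (i + s%:Z)).
  by rewrite -{2}e' mulgVK.
have commP : (g * zpow f p`! = zpow f p`! * g)%g.
  have /dvdnP [q eq] : (s' - s %| p`!)%N.
    by apply: dvdn_fact; move: ss' s'p; clear; lia.
  by rewrite eq mulnC PoszM; apply: zpow_commute.
split=> // k.
have P0 : (0 < p`!)%N := fact_gt0 p.
pose k' := i + ((k - i) %% p`!%:Z)%Z.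
have ek : k = p`!%:Z * ((k - i) %/ p`!%:Z)%Z + k'.
  by rewrite /k' addrCA (mulrC p`!%:Z) -(divz_eq (k - i) p`!) addrC subrK.
rewrite ek -disp.
rewrite (_ : zpow f (- _) * g * _ = g)%g; last first.
  by rewrite -mulgA (zpow_commute _ commP) zpowN mulKg.
apply: H; rewrite /k'.
have := modz_ge0 (k - i) (d := p`!%:Z); have := ltz_mod (k - i) (d := p`!%:Z).
move: P0; set F := (p`!)%N; set M := (_ %% _)%Z; clearbody F M; clear; lia.
Qed.

Variable a : R.
Hypothesis a_adj : adjacency Y a.
Local Notation gap P Q := (gap Y P Q).
Local Notation inL b := (@inr X (cosets f) (lab f b)).

Lemma gap_lab (g b b' : G) : gap (inL (g * b)%g) (inL (g * b')%g) = gap (inL b) (inL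
  b').
Proof. by rewrite -!act_lab -[LHS](gap_act Yneq0 act_isom (@act_cosets1 _ f)
  (@act_cosetsM _ f) Yact g^-1%g) /= !act_lab !mulKg. Qed.

Lemma Yact_lab g b p : Y (lab f b) p -> Y (lab f (g * b)%g) (act g p).
Proof. by rewrite -act_lab; exact: Yact. Qed.

Lemma Yact_lab1 g p : Y (lab f 1%g) p -> Y (lab f g) (act g p).
Proof. by move=> /(Yact_lab g); rewrite mulg1. Qed.

Lemma lab_fn (n : nat) : lab f (f ^+ n)%g = lab f 1%g.
Proof. by apply/lab_eq; rewrite mulg1; apply/commensV/(commens_zpow f n). Qed.

Lemma gap_lab_fn (n : nat) b : gap (inL 1%g) (inL (f ^+ n * b)%g) = gap (inL 1%g)
  (inL b).
Proof. by rewrite -[LHS](gap_lab (f ^+ n)^-1%g) mulKg mulg1 (_ : lab f (f ^+ n)^-1%g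
  = lab f 1%g)//; apply/lab_eq; rewrite mulg1 invgK; exact: (commens_zpow f n). Qed.

(** From [u] as from its image, [Y j] and the points of [Y i] are seen in different directions,
    which bounds the distance between the two. *)
Lemma neighbour_fix g i j p u : i <> j -> act_cosets g i = i -> act_cosets g j = j ->
  Y j p -> Y i u -> d p u <= gap (inr j) (inr i) + 1 -> d u (act g u) <= 2 * a.
Proof.
move=> ij gi gj Yp Yu pu.
have Ygp : Y j (act g p) by rewrite -gj; exact: Yact.
have Ygu : Y i (act g u) by rewrite -gi; exact: Yact.
have ne : @inr X _ j <> inr i by case=> e; apply: ij.
have h1 := a_adj ne Yp Yu pu Ygp Ygu.
have h2 : gp (act g u) (act g p) u <= a.
  by apply: (a_adj ne Ygp Ygu _ Ygp Yu); rewrite (act_d act_isom).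
have := gp_split u (act g u) (act g p).
by rewrite (gpC u) (gpC (act g u)); lra.
Qed.

(** [B] bounds the distances of the ends of the bridge from [o] and [act b o]. As [n] is chosen
    after [B], a crossing by [f ^+ n] dominates these offsets. *)
Definition bridge (B : R) (b : G) (v u : X) : Prop :=
  [/\ Y (lab f 1%g) v, Y (lab f b) u, d v u <= gap (inL 1%g) (inL b) + 1,
      d o v <= B & d o (act b^-1%g u) <= B].

Lemma bridge_ex (bs : seq G) : exists2 B, 0 <= B &
  forall b, b \in bs -> exists v u, bridge B b v u.
Proof.
elim: bs => [|b bs [B B0 IH]]; first by exists 0.
have [v [u [/= Yv Yu vu]]] := @gap_ex _ _ _ _ Yneq0 (inL 1%g) (inL b) 1 ltr01.
exists (B + d o v + d o (act b^-1%g u)).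
  by rewrite !addr_ge0// mdist_ge0.
have h1 := mdist_ge0 o v; have h2 := mdist_ge0 o (act b^-1%g u).
move=> b'; rewrite inE => /predU1P [->|/IH [v' [u' [h3 h4 h5 h6 h7]]]].
  by exists v, u; split=> //; lra.
by exists v', u'; split=> //; lra.
Qed.

Lemma lab_neq b : ~ E b -> lab f 1%g <> lab f b.
Proof. by move=> Eb /lab_eq; rewrite invg1 mul1g. Qed.

Definition shift_const : R := 2 * (a0 + 2 * D3) + 7 * (2 * a) + 2 * delta.

(** An element fixing three consecutive sets almost fixes the ends of the two bridges on the middle
    one, hence a long piece of the axis between them. [P] has to come before [B], as the letters,
    and with them [B], will depend on [P]. *)
Lemma stabilizer_small : exists2 P : nat, (0 < P)%N & forall B, exists n0 : nat,
  forall n g b b' v u v' u', (n0 <= n)%N -> ~ E b -> ~ E b' ->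
  bridge B b v u -> bridge B b' v' u' ->
  act_cosets g (lab f b^-1%g) = lab f b^-1%g -> act_cosets g (lab f 1%g) = lab f 1%g ->
  act_cosets g (lab f (f ^+ n * b')%g) = lab f (f ^+ n * b')%g ->
  small_shifts shift_const P g.
Proof.
have [P [M [P0 HP]]] := small_shiftsP shift_const; exists P => // B.
pose n1 := (Num.truncn (B + D3)).+1.
have n1P : B + D3 < n1%:R by apply: truncnS_gt; rewrite num_real.
exists (2 * n1 + M)%N => n g b b' v u v' u' nn Eb Eb'.
move=> [Yv Yu vu ov ou] [Yv' Yu' vu' ov' ou'] g1 g2 g3.
have near x k : d (pt k) x <= B -> Y (lab f 1%g) x ->
    exists2 k', (`|(k' - k)%R| <= n1)%N & d x (pt k') <= D3.
  move=> kx /(Yset_near_axis hyp act_isom fC fL) [k' xk']; exists k' => //.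
  have /andP[h _] := pt_dist_bounds hyp act_isom fC fL k' k.
  have t := metric_triangle (pt k') x (pt k).
  rewrite (metric_sym (pt k') x) (metric_sym x (pt k)) in t.
  by rewrite -(ler_nat R); lra.
set w := act b^-1%g u; have Yw : Y (lab f 1%g) w by rewrite -(mulVg b) -act_lab;
  exact: Yact.
have fixw : d w (act g w) <= 2 * a.
  apply: (@neighbour_fix g (lab f 1%g) (lab f b^-1%g) (act b^-1%g v)) => //.
  - by apply: lab_neq => /commensV; rewrite invgK.
  - exact: Yact_lab1.
  rewrite /w (act_d act_isom); apply: (le_trans vu).
  by rewrite -(gap_lab b b^-1%g) mulgV mulg1.
set x := act (f ^+ n)%g v'.
have Yx : Y (lab f 1%g) x by rewrite -(lab_fn n); exact: Yact_lab1.
have fixx : d x (act g x) <= 2 * a.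
  apply: (@neighbour_fix g (lab f 1%g) (lab f (f ^+ n * b')%g) (act (f ^+ n)%g u'))
    => //.
  - move=> e; apply: (lab_neq Eb'); move: e;
    rewrite -{1}(lab_fn n) -{1}[(f ^+ n)%g]mulg1.
    by rewrite -!act_lab => /(congr1 (act_cosets (f ^+ n)^-1%g));
      rewrite !act_lab !mulKg.
  - exact: Yact_lab.
  rewrite /x (act_d act_isom) metric_sym; apply: (le_trans vu').
  by rewrite (gapC Yneq0 (inL (f ^+ n * b')%g)) gap_lab_fn.
have [k1 k1n wk1] := near w 0 ltac:(by rewrite pt0) Yw.
have [k2 k2n xk2] := near x n%:Z ltac:(by rewrite /x /axis_pt (act_d act_isom)) Yx.
apply: (HP _ n1%:Z) => k /andP[k1k kk2].
have h1 : gp (pt k) (pt k1) (pt k2) <= a0.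
  apply: (between hyp act_isom fC fL); move: k1n k2n nn k1k kk2; clear.
  by rewrite subr0; lia.
have h2 := gp_lip (pt k1) (pt k) w x.
have h3 := gp_lipr (pt k2) (pt k) (pt k1) x.
by apply: (displacement fixw fixx); lra.
Qed.

Lemma node_neq i j : i <> j -> @inr X (cosets f) i <> inr j.
Proof. by move=> ij [e]; apply: ij. Qed.

(** On the way from the set of [1] to that of [t * f ^+ n * t], the set of [t] has to be crossed
    over a length that grows with [n]. *)
Lemma gap_unbounded t K : ~ E t -> 0 <= a -> exists2 b,
  ~ E b & K < gap (inL 1%g) (inL b).
Proof.
move=> Et a_ge0; have [d0 C0 a00 l1 ea] := const.
have [B B0 /(_ t (mem_head _ _)) [v [u [Yv Yu vu ov ou]]]] := bridge_ex [:: t].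
pose n := (Num.truncn (2 * B + 2 * a + delta + 4 * a + 2 * delta + `|K|)).+1.
have nP : 2 * B + 2 * a + delta + 4 * a + 2 * delta + `|K| < n%:R.
  by apply: truncnS_gt; rewrite num_real.
have aK := ler_norm K; have K0 := normr_ge0 K.
pose b := (t * f ^+ n * t)%g.
have lt : lab f (t * f ^+ n)%g = lab f t by rewrite -act_lab lab_fn act_lab mulg1.
have far : `|K| < gap (inL 1%g) (inL b).
  apply: lt_le_trans (_ : d o (pt n) - 2 * B - 4 * a - 2 * delta <= _).
    by have /andP[+ _] := pt_dist_nat hyp act_isom fC fL n; lra.
  apply: (le_gap Yneq0) => p q /= Yp Yq.
  set v' := act (t * f ^+ n)%g v; set u' := act (t * f ^+ n)%g u.
  have Yv' : Y (lab f t) v' by rewrite -lt; exact: Yact_lab1.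
  have Yu' : Y (lab f b) u' by exact: Yact_lab.
  have h1 : gp u p v' <= a.
    by apply: (@a_adj (inL 1%g) (lab f t) v u p v') => //; apply: node_neq;
      exact: lab_neq.
  have h2 : gp v' u q <= a.
    rewrite gpC; apply: (@a_adj (inL b) (lab f t) u' v' q u) => //.
    - apply: node_neq; rewrite -lt => /(congr1 (act_cosets (t * f ^+ n)^-1%g)).
      by rewrite !act_lab mulKg mulVg => e; case: (lab_neq Et).
    - rewrite /u' /v' (act_d act_isom) metric_sym (gapC Yneq0); apply: (le_trans vu).
      by rewrite -(gap_lab (t * f ^+ n)%g) mulg1 lt.
  have h3 : d o (pt n) - 2 * B <= d u v'.
    rewrite -(act_d act_isom t^-1%g u) /v' !(act_M act_isom) (act_K act_isom).
    have t1 := metric_triangle o (act t^-1%g u) (pt n).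
    have t2 := metric_triangle (act t^-1%g u) (act (f ^+ n)%g v) (pt n).
    have t3 : d (act (f ^+ n)%g v) (pt n) = d o v by rewrite (act_d act_isom)
      metric_sym.
    lra.
  have := gp_chain hyp h1 h2.
  have := mdist_ge0 p u; have := mdist_ge0 v' q.
  by have /andP[? _] := pt_dist_nat hyp act_isom fC fL n; lra.
exists b; last lra.
move=> Eb; move: far; have -> : lab f b = lab f 1%g.
  by apply/lab_eq; rewrite mulg1; exact: commensV.
by rewrite (gapxx Yneq0); lra.
Qed.

(** Each prescribed product is reached from the word so far by a quotient [q]. If [q] lies in the
    commensurator, it is split into [t] and [t^-1 * q], which both lie outside. *)
Lemma prefix_words t (bs : seq G) : ~ E t -> exists2 s : seq G,
  (forall b, b \in s -> ~ E b) & [/\ s != [::] &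
  forall b, b \in bs -> exists k, (k <= size s)%N /\ (\prod_(i <- take k s) i)%g = b].
Proof.
move=> Et; elim: bs => [|b bs [s sE [s0 IH]]].
  by exists [:: t]; [move=> b; rewrite inE => /eqP->|split].
pose q := ((\prod_(i <- s) i)^-1 * b)%g.
have old s' b' : b' \in bs ->
    exists k, (k <= size (s ++ s'))%N /\ (\prod_(i <- take k (s ++ s')) i)%g = b'.
  move=> /IH [k [ks e]]; exists k; split; first by rewrite size_cat (leq_trans ks)
    ?leq_addr.
  by rewrite takel_cat.
have full s' : (\prod_(i <- s') i)%g = q ->
    exists k, (k <= size (s ++ s'))%N /\ (\prod_(i <- take k (s ++ s')) i)%g = b.
  by move=> e; exists (size (s ++ s')); rewrite take_size big_cat /= e /q mulVKg.
have [Eq|nEq] := pselect (E q); last first.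
  exists (s ++ [:: q]).
    by move=> b'; rewrite mem_cat inE => /orP[/sE//|/eqP->].
  split; first by case: (s).
  move=> b'; rewrite inE => /predU1P[->|/old//]; apply: full.
  by rewrite big_seq1.
exists (s ++ [:: t; (t^-1 * q)%g]).
  move=> b'; rewrite mem_cat !inE => /orP[/sE//|/orP[]/eqP->//].
  move=> Etq; apply: Et; rewrite -[t]invgK; apply: commensV.
  by rewrite -[(t^-1)%g](mulgK q); apply: commensM => //; exact: commensV.
split; first by case: (s).
move=> b'; rewrite inE => /predU1P[->|/old//]; apply: full.
by rewrite big_cons big_seq1 mulVKg.
Qed.

Lemma finite_killers (T : set G) (Q : G -> G -> Prop) : finite_set T ->
  (forall g, T g -> exists b, Q g b) ->
  exists bs : seq G, forall g, T g -> exists2 b, b \in bs & Q g b.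
Proof.
move=> fT H; have /choice [w wP] : forall g, exists b, T g -> Q g b.
  by move=> g; have [/H [b]|] := pselect (T g); [exists b | exists g].
exists (map w (fset_set T)) => g Tg; exists (w g); last exact: wP.
by apply: map_f; rewrite in_fset_set//; exact: mem_set.
Qed.

Variable N : set G.
Hypothesis N_max : maximal_finite_normal_subgroup N.

(** The elements with all conjugates in [commens f] are those fixing every coset. They form a normal
    subgroup, which [stabilizer_small], applied to the letter [t], puts inside a finite set. *)
Lemma maximal_sub_core t g : ~ E t -> (forall b, E (b^-1 * g * b)%g) -> N g.
Proof.
move=> Et; pose S : set G := [set g | forall b, E (b^-1 * g * b)%g].
case: N_max => _ _ Nmax; apply: (Nmax S).
  have [P P0 /(_ _)] := stabilizer_small => H.
  have [B B0 /(_ t (mem_head _ _)) [v [u br]]] := bridge_ex [:: t].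
  have [n0 {}H] := H B.
  apply: sub_finite_set (small_shifts_finite shift_const P) => h Sh.
  have fix_lab b : act_cosets h (lab f b) = lab f b.
    by rewrite act_lab; apply/lab_eq; have := commensV (Sh b);
      rewrite !invgM invgK !mulgA.
  by apply: (H n0 h t t v u v u).
split.
  split; first by apply/mem_set => b; rewrite mulg1 mulVg; exact: commens1.
  move=> u v /set_mem Su /set_mem Sv; apply/mem_set => b.
  have := commensM (Su b) (commensV (Sv b)).
  by rewrite !invgM invgK !mulgA mulgK.
by move=> h k Sh b; have := Sh (k * b)%g; rewrite invgM /conjg !mulgA.
Qed.

(** Only finitely many elements have small shifts, and each one outside [N] has a conjugate outside
    [commens f]; the word is chosen with these conjugators among its prefix products. *)
Lemma detecting_word t P : ~ E t -> exists2 s : seq G, (forall b, b \in s -> ~ E b) &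
  s != [::] /\ forall g, small_shifts shift_const P g ->
  (forall k, (k <= size s)%N -> E ((\prod_(i <- take k s) i)^-1 * g * \prod_(i <-
    take k s) i)%g) -> N g.
Proof.
move=> Et.
have [bs H] : exists bs : seq G, forall g, small_shifts shift_const P g /\ ~ N g ->
    exists2 b, b \in bs & ~ E (b^-1 * g * b)%g.
  apply: finite_killers.
    by apply: sub_finite_set (small_shifts_finite shift_const P) => g [].
  by move=> g [_ nN]; apply: contrapT => no; apply: nN;
    apply: (maximal_sub_core Et) => b; apply: contrapT => nE; apply: no; exists b.
have [s sE [s0 pre]] := prefix_words bs Et; exists s => //; split=> // g Tg Hg.
apply: contrapT => nN; have [b /pre [k [ks <-]] nE] := H g (conj Tg nN).
exact: nE (Hg k ks).
Qed.

End Stabilizers.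

(** * Words and their itineraries *)

Section ShortGaps.
Context {R : realType} {X : metricType R} {I : choiceType}.
Variable Y : I -> set X.
Hypothesis Y_neq0 : forall i, Y i !=set0.
Variable c : R.
Hypothesis c_gt0 : 0 < c.
Local Notation gap := (gap Y).
Local Notation cost := (cost Y c).
Local Notation opt := (opt Y c).
Implicit Types (P Q : node (X := X) (I := I)) (L s t : seq I).

Lemma gap_le_cost P L Q : gap P Q <= c -> gap P Q <= cost P L Q.
Proof.
case: L => [|i L] //= H; have := @cost_ge0 _ _ _ _ Y_neq0 c c_gt0 (inr i) L Q.
by have := gap_ge0 Y_neq0 P (inr i); lra.
Qed.

(** No further set can shorten the way: its crossing costs [c], as much as the whole gap that it
    could save. *)
Lemma cost_subseq P s L Q : path (fun P Q => gap P Q <= c) P (rcons (map inr s) Q) ->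
  subseq s L -> cost P s Q <= cost P L Q.
Proof.
elim: s P L => [|i s IH] P L /=.
  by rewrite andbT => H _; exact: gap_le_cost.
move=> /andP[Pi H] /subseq_consP [L1 [L2 [-> sL2]]]; rewrite cost_cat /=.
by have := IH _ _ H sL2; have := gap_le_cost L1 Pi; lra.
Qed.

(** An additional set in between would cost at least [c], more than the direct gap; so in an exact
    optimum the occurrence is contiguous. *)
Lemma opt0_infix P t Q x s : opt 0 P t Q -> subseq (x :: s) t ->
  path (fun i j => gap (inr i) (inr j) < c) x s -> exists t1 t2,
    t = t1 ++ (x :: s) ++ t2.
Proof.
elim: s P x t => [|y s IH] P x t o.
  by move=> /subseq_consP [t1 [t2 [-> _]]] _; exists t1, t2.
move=> /subseq_consP [t1 [t' [et st]]] /= /andP[xy ys].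
rewrite et in o; have o' := opt_suffix o.
have [[|j t1'] [t2 et']] := IH (inr x) y t' o' st ys; first by exists t1, t2;
  rewrite et et'.
rewrite et' /= in o'; have := (@opt_prefix _ _ _ _ _ _ _ (j :: t1') _ _ _ o') [::] =>
  /=.
have := @cost_ge0 _ _ _ _ Y_neq0 c c_gt0 (inr j) t1' (inr y).
by have := gap_ge0 Y_neq0 (inr x) (inr j); lra.
Qed.

Lemma opt_set_start m e i L Q : 0 < e -> opt m (inr i) L Q ->
  exists2 p, Y i p & opt (m + e) (inl p) L Q.
Proof.
move=> e0 /(@opt_rev _ _ _ _ Y_neq0 c) o; have [p Yp o'] := opt_set_point Y_neq0 e0 o.
by exists p => //; rewrite -[L]revK; apply: (@opt_rev _ _ _ _ Y_neq0).
Qed.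

End ShortGaps.

Section Words.
Context {R : realType} {X : metricType R} {G : groupType}.
Variables (delta : R) (act : G -> X -> X) (o : X).
Hypothesis hyp : hyperbolic_with X delta.
Hypothesis geo : geodesic X.
Hypothesis act_isom : isometric_action act.
Local Notation d := (@mdist R X).
Variables (f : G) (C : R).
Hypothesis fC : gp o (act f o) (act f^-1%g o) <= C.
Hypothesis fL : 2 * C + 4 * delta + 1 <= d o (act f o).
Local Notation pt := (axis_pt act o f).
Local Notation E := (commens f).
Local Notation Y := (@Yset _ _ _ act o f).
Local Notation actI := (@act_cosets _ f).
Variables k a D m c B : R.
Hypothesis Yqc : quasi_convex Y k.
Hypothesis delta_a : delta <= a.
Hypothesis a_adj : adjacency Y a.
Hypothesis a_proj : bounded_projections Y a.
Hypothesis D_sep : separated Y (k + (a + 6 * delta)) D.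
Hypothesis D_ge0 : 0 <= D.
Hypothesis k_ge0 : 0 <= k.
Hypothesis m_large : 120 * a + 420 * delta + 6 <= m.
Hypothesis c_large : 3 * m + D + 10 <= c.
Hypothesis B_ge0 : 0 <= B.
Variable n : nat.
Hypothesis n_large : 2 * B + c + 2 * m <= n%:R.

Let Yneq0 : forall i, Y i !=set0 := @Yset_neq0 _ _ _ act o f.
Let Yact : forall g i p, Y i p -> Y (actI g i) (act g p) := Yset_act act_isom (o :=
  o) (f := f).
Let const := line_const hyp fC fL.
Let delta_ge0 : 0 <= delta. Proof. by case: const. Qed.
Let c_gt0 : 0 < c.
Proof. by move: (delta_ge0) (delta_a) (m_large) (c_large) (D_ge0) => ? ? ? ? ?;
  lra. Qed.

Local Notation inL b := (@inr X (cosets f) (lab f b)).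
Local Notation gap P Q := (gap Y P Q).
Local Notation cost := (cost Y c).
Local Notation opt := (opt Y c).
Definition gam (b : G) : R := gap (inL 1%g) (inL b).
Definition letter (b : G) : Prop :=
  [/\ ~ E b, gam b < c & exists v u, bridge act o f B b v u].
Local Notation x_ b := (f ^+ n * b)%g.
Implicit Types (w : seq G) (b : G).

Ltac bounds := move: (delta_a) (delta_ge0) (D_ge0) (k_ge0) (m_large) (c_large)
  (B_ge0) (n_large).

Definition word_prod w : G := (\prod_(b <- w) x_ b)%g.

Fixpoint stops w : seq (cosets f) :=
  if w is b :: w' then lab f (x_ b) :: map (actI (x_ b)) (stops w') else [::].

Definition itinerary w := lab f 1%g :: stops w.

Arguments itinerary : simpl never.

(** The final [f ^+ n] makes the crossing of the last set as long as the others. *)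
Definition word_end w : X := act (word_prod w) (act (f ^+ n)%g o).

Lemma word_prod_cons b w : word_prod (b :: w) = (x_ b * word_prod w)%g.
Proof. exact: big_cons. Qed.

Lemma word_end_cons b w : word_end (b :: w) = act (x_ b) (word_end w).
Proof. by rewrite /word_end word_prod_cons (act_M act_isom (x_ b)). Qed.

Lemma stops_cons b w : stops (b :: w) = map (actI (x_ b)) (itinerary w).
Proof. by rewrite /= act_lab mulg1. Qed.

Lemma fn_o : Y (lab f 1%g) (act (f ^+ n)%g o).
Proof. exact: (Yset_pt act o f n). Qed.

Lemma o_in : Y (lab f 1%g) o.
Proof. by have := Yset_pt act o f 0; rewrite (pt0 o act_isom). Qed.

Lemma Yfn p : Y (lab f 1%g) p -> Y (lab f 1%g) (act (f ^+ n)%g p).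
Proof. by rewrite -{2}(lab_fn f n); exact: Yact_lab1. Qed.

Lemma word_end_in w : Y (lab f (word_prod w)) (word_end w).
Proof. by apply: Yact_lab1 => //; exact: fn_o. Qed.

Lemma lab_step b b' : ~ E b -> lab f b' <> lab f (b' * x_ b)%g.
Proof.
move=> Eb /lab_eq; rewrite mulKg => e; apply: Eb.
rewrite -[b](mulKg (f ^+ n)%g); apply: commensM => //.
by apply: commensV; exact: (commens_zpow f n).
Qed.

Lemma long (w v : X) : d o w <= B -> d o v <= B -> c + 2 * m <= d w (act (f ^+ n)%g v).
Proof.
move=> ow ov; have /andP[h _] := pt_dist_nat hyp act_isom fC fL n.
have e : d (act (f ^+ n)%g v) (pt n) = d o v by rewrite (act_d act_isom) metric_sym.
have t1 := metric_triangle o w (pt n); have t2 := metric_triangle w (act (f ^+ n)%g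
  v) (pt n).
by bounds; lra.
Qed.

Lemma bridge_act b v u h : bridge act o f B b v u ->
  d (act (h * f ^+ n)%g v) (act (h * f ^+ n)%g u) <= gap (inL h) (inL (h * x_ b)%g) + 1.
Proof.
move=> [_ _ vu _ _]; rewrite (act_d act_isom); apply: (le_trans vu).
by rewrite lerD2r -[X in _ <= gap (inL X) _]mulg1 (gap_lab o act_isom) (gap_lab_fn o
  act_isom).
Qed.

(** Induction on the rest of the word by [adjacency_step]: every later set lies behind the bridge
    that leaves the first one. *)
Lemma beyond b w v u z p : (forall b', b' \in b :: w -> letter b') ->
  bridge act o f B b v u -> Y (lab f (word_prod (b :: w))) z -> Y (lab f 1%g) p ->
  gp (act (f ^+ n)%g v) p z <= a + delta.
Proof.
elim: w b v u z p => [|b' w IH] b v u z p lett br Yz Yp.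
  have [Eb _ _] := lett b (mem_head _ _); have [Yv Yu vu ov ou] := br.
  rewrite /word_prod big_seq1 in Yz; rewrite gpC.
  have : gp (act (f ^+ n)%g v) z p <= a; last by bounds; lra.
  apply: (@a_adj (inL (x_ b)) (lab f 1%g) (act (f ^+ n)%g u) (act (f ^+ n)%g v) z p)
    => //.
  - by apply/node_neq/nesym; have := @lab_step b 1%g Eb; rewrite mul1g.
  - exact: Yact_lab.
  - exact: Yfn.
  - rewrite metric_sym (gapC Yneq0); have := bridge_act 1%g br; rewrite !mul1g.
    exact.
have [Eb _ _] := lett b (mem_head _ _); have [Yv Yu vu ov ou] := br.
have [Eb' _ [v' [u' br']]] := lett b' ltac:(by rewrite !inE eqxx orbT).
have [Yv' Yu' vu' ov' ou'] := br'.
rewrite gpC; set x := x_ b.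
apply: (@adjacency_step _ _ _ Y delta k a D m c hyp Yneq0 delta_a delta_ge0 a_adj
  D_ge0 k_ge0
  m_large c_large (lab f x) (lab f 1%g) z (act (x * f ^+ n)%g v') (act (f ^+ n)%g u))
    => //.
- by move=> e; have := @lab_step b 1%g Eb; rewrite mul1g; apply; rewrite e.
- by rewrite (act_M act_isom x); apply: Yact_lab1 => //; exact: Yfn.
- exact: Yact_lab.
- exact: Yfn.
- by rewrite metric_sym (gapC Yneq0); have := bridge_act 1%g br; rewrite !mul1g.
- rewrite gpC -[act (f ^+ n)%g u](act_KV act_isom x) (act_M act_isom x).
  rewrite -[z](act_KV act_isom x) (act_gp act_isom).
  apply: (@IH b' v' u') => //.
  + by move=> b2 hb2; apply: lett; rewrite inE hb2 orbT.
  + rewrite (_ : word_prod _ = (x^-1 * word_prod [:: b, b' & w]))%g; last first.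
      by rewrite (word_prod_cons b) mulKg.
    exact: Yact_lab.
  + rewrite -(mulVg x); apply: Yact_lab => //; exact: Yact_lab.
- rewrite metric_sym -(act_d act_isom x^-1%g) (act_M act_isom x) (act_K act_isom).
  rewrite /x invgM (act_M act_isom b^-1%g) (act_K act_isom).
  by have := long ou ov'; bounds; lra.
Qed.

Definition leaves w (v : X) : Prop := [/\ d o v <= B, Y (lab f 1%g) v &
  forall p, Y (lab f 1%g) p -> gp (act (f ^+ n)%g v) p (word_end w) <= a + delta].

Lemma leaves_ex w : (forall b, b \in w -> letter b) -> exists v, leaves w v.
Proof.
case: w => [|b w] lett.
  exists o; split; [by rewrite mdistxx | exact: o_in |].
  move=> p _; rewrite /word_end /word_prod big_nil (act_1 act_isom) gpC gp0l.
  by bounds; lra.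
have [_ _ [v [u br]]] := lett b (mem_head _ _); exists v.
have [? ? _ ? _] := br; split=> // p Yp.
by apply: (beyond lett br) => //; exact: word_end_in.
Qed.

(** Otherwise [insertion] would gain [2 * m] up to a small loss, more than the tolerance. *)
Lemma long_inserted m' x z L j u v : m' < m -> opt m' (inl x) L (inl z) -> Y j u ->
  Y j v ->
  gp u x v <= a + delta -> gp v u z <= a + delta -> c + 2 * m <= d u v -> j \in L.
Proof.
move=> mm' op Yu Yv xu vz uv; apply: contrapT => /negP jL.
have ad0 : 0 <= a + delta by bounds; lra.
have [|L1 [L2 [_]]] := @insertion _ _ _ Y delta k a D m c hyp geo Yneq0 Yqc delta_a
  delta_ge0
  a_adj a_proj D_sep D_ge0 k_ge0 m_large c_large m' x z L j u v (a + delta) (ltW mm')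
    op jL Yu Yv ad0 xu vz.
  by bounds; lra.
by have := op (L1 ++ j :: L2); bounds; lra.
Qed.

Lemma stops_subseq w x m' L : (forall b, b \in w -> letter b) -> Y (lab f 1%g) x ->
  m' < m -> opt m' (inl x) L (inl (word_end w)) -> subseq (stops w) L.
Proof.
elim: w x m' L => [|b w IH] x m' L lett Yx mm' op; first exact: sub0seq.
have [Eb _ [v [u br]]] := lett b (mem_head _ _); have [Yv Yu vu ov ou] := br.
have lett' b' : b' \in w -> letter b' by move=> h; apply: lett; rewrite inE h orbT.
have [v' [ov' Yv' v'P]] := leaves_ex lett'.
set y := x_ b.
have yL : lab f y \in L.
  apply: (@long_inserted m' x (word_end (b :: w)) L (lab f y)
     (act (f ^+ n)%g u) (act (y * f ^+ n)%g v') mm' op).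
  - exact: Yact_lab.
  - by rewrite (act_M act_isom y); apply: Yact_lab1 => //; exact: Yfn.
  - have : gp (act (f ^+ n)%g u) x (act (y * f ^+ n)%g v') <= a; last by bounds; lra.
    apply: (@a_adj (inL 1%g) (lab f y) (act (f ^+ n)%g v)) => //.
    + by apply: node_neq; have := @lab_step b 1%g Eb; rewrite mul1g.
    + exact: Yfn.
    + exact: Yact_lab.
    + by have := bridge_act 1%g br; rewrite !mul1g.
    + by rewrite (act_M act_isom y); apply: Yact_lab1 => //; exact: Yfn.
  - rewrite word_end_cons -/y (act_M act_isom y) -[act (f ^+ n)%g u](act_KV act_isom y).
    rewrite (act_gp act_isom); apply: v'P.
    by rewrite -(mulVg y); apply: Yact_lab => //; exact: Yact_lab.
  - rewrite -(act_d act_isom y^-1%g) (act_M act_isom y) (act_K act_isom).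
    by rewrite /y invgM (act_M act_isom b^-1%g) (act_K act_isom); exact: long.
case/splitPr: yL op => L1 L2 op; have := opt_suffix op.
have e0 : 0 < (m - m') / 2 by lra.
move=> /(opt_set_start Yneq0 e0) [x' Yx' op'].
have {}op' := opt_act Yneq0 act_isom (@act_cosets1 _ f) (@act_cosetsM _ f) Yact
  y^-1%g op'.
rewrite /= word_end_cons -/y (act_K act_isom) in op'.
have sub : subseq (stops w) (map (actI y^-1%g) L2).
  apply: IH op' => //; last by lra.
  by rewrite -(mulVg y); exact: Yact_lab.
rewrite /= -/y; apply: (@subseq_trans _ (lab f y :: L2)); last first.
  exact: suffix_subseq.
rewrite /= eqxx; have := map_subseq (actI y) sub.
by rewrite (mapK (actIKV (@act_cosets1 _ f) (@act_cosetsM _ f) y)).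
Qed.

Lemma itinerary_always w m' L : (forall b, b \in w -> letter b) -> m' < m ->
  opt m' (inl o) L (inl (word_end w)) -> subseq (itinerary w) L.
Proof.
move=> lett mm' op; have [v [ov Yv vP]] := leaves_ex lett.
have L1 : lab f 1%g \in L.
  apply: (@long_inserted m' o (word_end w) L (lab f 1%g) o (act (f ^+ n)%g v) mm' op).
  - exact: o_in.
  - exact: Yfn.
  - by rewrite gp0l; bounds; lra.
  - by apply: vP; exact: o_in.
  - by apply: long => //; rewrite mdistxx.
case/splitPr: L1 op => L1 L2 op; have := opt_suffix op.
have e0 : 0 < (m - m') / 2 by lra.
move=> /(opt_set_start Yneq0 e0) [x' Yx' op'].
apply: (@subseq_trans _ (lab f 1%g :: L2)); last exact: suffix_subseq.
by rewrite /= eqxx; apply: (stops_subseq lett Yx' _ op'); lra.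
Qed.

Local Notation gapI := (fun i j => gap (inr i) (inr j)).

Lemma gaps_act g i s : pairmap gapI (actI g i) (map (actI g) s) = pairmap gapI i s.
Proof.
elim: s i => [//|j s IH] i /=; rewrite IH; congr (_ :: _).
exact: (gap_act Yneq0 act_isom (@act_cosets1 _ f) (@act_cosetsM _ f) Yact g (inr i)
  (inr j)).
Qed.

Lemma gaps_stops w : pairmap gapI (lab f 1%g) (stops w) = map gam w.
Proof.
elim: w => [//|b w IH] /=; rewrite (gap_lab_fn o act_isom); congr (_ :: _).
by rewrite -IH -(gaps_act (x_ b)) act_lab mulg1.
Qed.

Lemma gaps_rev i s : exists j t, [/\ rev (i :: s) = j :: t, last j t = i &
  pairmap gapI j t = rev (pairmap gapI i s)].
Proof.
elim: s i => [|i' s IH] i; first by exists i, [::].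
have [j [t [e l p]]] := IH i'; exists j, (rcons t i).
rewrite rev_cons e rcons_cons last_rcons; split=> //.
by rewrite -cats1 pairmap_cat /= p l rev_cons cats1 (gapC Yneq0).
Qed.

Lemma path_pairmap (K : R) i s : path (fun i j => gapI i j < K) i s = all (fun r =>
  r < K) (pairmap gapI i s).
Proof. by elim: s i => [//|j s IH] i /=; rewrite IH. Qed.

Lemma stops_path w : (forall b, b \in w -> letter b) ->
  path (fun i j => gapI i j < c) (lab f 1%g) (stops w).
Proof.
move=> lett; rewrite path_pairmap gaps_stops; apply/allP => _ /mapP[b bw ->].
by have [_ ->] := lett b bw.
Qed.

Lemma last_stops w : last (lab f 1%g) (stops w) = lab f (word_prod w).
Proof.
elim: w => [|b w IH] /=; first by rewrite /word_prod big_nil.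
rewrite word_prod_cons -(act_lab f (x_ b)) -IH -(last_map (actI (x_ b))) act_lab mulg1.
by [].
Qed.

(** Any list of small tolerance contains the itinerary and is at least as expensive by
    [cost_subseq]; now let the tolerance tend to 0. *)
Lemma itinerary_opt0 w : (forall b, b \in w -> letter b) ->
  opt 0 (inl o) (itinerary w) (inl (word_end w)).
Proof.
move=> lett L'; rewrite addr0.
have le e : 0 < e -> e < m -> cost (inl o) (itinerary w) (inl (word_end w)) <= cost
  (inl o) L' (inl (word_end w)) + e.
  move=> e0 em; have [L op] := opt_exists Yneq0 c_gt0 (inl o) (inl (word_end w)) e0.
  apply: le_trans (op L'); apply: (cost_subseq Yneq0 c_gt0);
    last exact: itinerary_always em op.
  rewrite -cats1 cat_path /= andbT.
  have gap0 (p : X) i : Y i p -> gap (inl p) (inr i) = 0.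
    move=> Yp; apply/eqP; rewrite eq_le gap_ge0// andbT -(mdistxx p).
    exact: gap_le.
  rewrite (gap0 _ _ o_in) ltW//=; apply/andP; split.
    have := stops_path lett; elim: (stops w) (lab f 1%g) =>
      [//|j s IH] i /= /andP[/ltW -> /=].
    exact: IH.
  rewrite last_map last_stops (gapC Yneq0) gap0 ?ltW//; exact: word_end_in.
rewrite leNgt; apply/negP => lt.
have m0 : 0 < m by bounds; lra.
set A := cost _ (itinerary w) _ in lt le; set A' := cost _ L' _ in lt le.
case: (ltP ((A - A') / 2) m) => h; first by have := le ((A - A') / 2) ltac:(lra) h; lra.
by have := le (m / 2) ltac:(lra) ltac:(lra); lra.
Qed.

Lemma itinerary_cons b w : itinerary (b :: w) = lab f 1%g :: map (actI (x_ b))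
  (itinerary w).
Proof. by rewrite /itinerary stops_cons. Qed.

Lemma size_stops w : size (stops w) = size w.
Proof. by elim: w => [//|b w IH] /=; rewrite size_map IH. Qed.

Lemma size_itinerary w : size (itinerary w) = (size w).+1.
Proof. by rewrite /= size_stops. Qed.

Lemma drop_itinerary j w : (j <= size w)%N ->
  drop j (itinerary w) = map (actI (word_prod (take j w))) (itinerary (drop j w)).
Proof.
elim: j w => [|j IH] w.
  by rewrite take0 !drop0 /word_prod big_nil -[LHS]map_id; move=> _;
    apply: eq_map => i; rewrite act_cosets1.
case: w => [//|b w] jw; change (drop j (stops (b :: w)) =
  map (actI (word_prod (b :: take j w))) (itinerary (drop j w))).
rewrite stops_cons -map_drop IH// -map_comp.
by apply: eq_map => i /=; rewrite -act_cosetsM word_prod_cons.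
Qed.

Lemma take_itinerary j w : take j.+1 (itinerary w) = itinerary (take j w).
Proof.
rewrite /itinerary /=; congr (_ :: _).
elim: j w => [|j IH] [|b w] //=.
by rewrite -map_take IH.
Qed.

Lemma itinerary_uniq w : (forall b, b \in w -> letter b) -> uniq (itinerary w).
Proof.
by move=> lett; apply: (opt_uniq Yneq0 c_gt0 c_gt0 (itinerary_opt0 lett)).
Qed.

Lemma always_itinerary w s : (forall b, b \in w -> letter b) ->
  always Y m c o (word_end w) s <-> subseq s (itinerary w).
Proof.
move=> lett; split=> [A|sub m' L mm' op]; last exact: subseq_trans sub
  (itinerary_always lett mm' op).
by apply: (A 0); [bounds; lra | exact: itinerary_opt0].
Qed.

(** Exact optimality makes the subsequence contiguous, and gaps are invariant under translation. *)
Lemma subseq_itinerary w i s : (forall b, b \in w -> letter b) ->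
  subseq (i :: s) (itinerary w) ->
  path (fun i j => gapI i j < c) i s -> exists j, let v := take (size s) (drop j w) in
  [/\ (j <= size w)%N, i :: s = map (actI (word_prod (take j w))) (itinerary v) &
      pairmap gapI i s = map gam v].
Proof.
move=> lett sub pat; have [t1 [t2 et]] := opt0_infix Yneq0 c_gt0 (itinerary_opt0
  lett) sub pat.
have jw : (size t1 <= size w)%N.
  by have := size_itinerary w; rewrite et !size_cat; clear; move=> /=; lia.
have e : i :: s = map (actI (word_prod (take (size t1) w))) (itinerary (take (size s)
  (drop (size t1) w))).
  by rewrite -take_itinerary map_take -drop_itinerary// et drop_size_cat//
    take_size_cat.
exists (size t1); split=> //=; rewrite -gaps_stops.
by move: (take (size s) _) e => v [-> ->]; rewrite gaps_act.
Qed.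

Section Occurrences.
Context {K : numFieldType} {V : normedModType K}.
Variables (rho : unitary_rep G V) (p : seq G) (e : V).
Hypothesis p_neq0 : p != [::].
Hypothesis p_letter : forall b, b \in p -> letter b.
Hypothesis p_fix : forall g, map (actI g) (itinerary p) = itinerary p -> rho g e = e.

Local Notation occurrences := (occurrences Y actI m c (itinerary p)).
Local Notation count := (count Y actI m c rho (itinerary p) e).

Lemma occurrence_position w s : (forall b, b \in w -> letter b) ->
  (forall j, map gam (take (size p) (drop j w)) = map gam p ->
    take (size p) (drop j w) = p) ->
  occurrences o (word_end w) s <-> exists j, take (size p) (drop j w) = p /\
    s = map (actI (word_prod (take j w))) (itinerary p).
Proof.
move=> lett H; split.
  move=> [[g es] /(always_itinerary _ lett) sub].
  rewrite es /= in sub.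
  have [|j [jw e1 e2]] := subseq_itinerary lett sub.
    by rewrite path_pairmap gaps_act -path_pairmap; exact: stops_path.
  have := size_itinerary p; rewrite /itinerary /= => -[sp].
  rewrite size_map sp in e1 e2; rewrite gaps_act gaps_stops in e2.
  have ep := H j (esym e2); exists j; split=> //.
  by rewrite es; move: e1; rewrite ep.
move=> [j [ep es]]; split; first by exists (word_prod (take j w)).
have jw : (j <= size w)%N.
  by rewrite leqNgt; apply/negP => /ltnW/drop_oversize e0; move: ep p_neq0;
    rewrite e0 => <-.
apply/(always_itinerary _ lett); rewrite es.
apply: (@subseq_trans _ (drop j (itinerary w))); last exact: drop_subseq.
rewrite drop_itinerary//.
by apply: map_subseq; rewrite -{1}ep -take_itinerary; exact: take_subseq.
Qed.

Lemma reverse_occurrence w s : (forall b, b \in w -> letter b) ->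
  occurrences (word_end w) o s ->
  exists j, map gam (take (size p) (drop j w)) = rev (map gam p).
Proof.
move=> lett [[g es] /(always_rev Yneq0) /(always_itinerary _ lett) sub].
have [i0 [s0 es0]] : exists i0 s0, rev s = i0 :: s0.
  rewrite es /itinerary /=; have [i1 [s1 [->
    _ _]]] := gaps_rev (actI g (lab f 1%g)) (map (actI g) (stops p)).
  by exists i1, s1.
have gs : pairmap gapI i0 s0 = rev (map gam p).
  move: es0; rewrite es /itinerary /=.
  have [i1 [s1 [-> _ e1]]] := gaps_rev (actI g (lab f 1%g)) (map (actI g) (stops p)).
  by move=> [<- <-]; rewrite e1 gaps_act gaps_stops.
have sz : size s0 = size p.
  by have := congr1 size gs; rewrite size_pairmap size_rev size_map.
rewrite es0 in sub; have [|j [jw _ e2]] := subseq_itinerary lett sub.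
  rewrite path_pairmap gs all_rev -gaps_stops -path_pairmap; exact: stops_path.
by exists j; rewrite -sz -e2.
Qed.

Fixpoint word_count w : V :=
  if w is b :: w' then (if prefix p w then e else 0) + rho (x_ b) (word_count w')
    else 0.

Lemma word_countE w : word_count w =
  \sum_(j <- iota 0 (size w) | prefix p (drop j w)) rho (word_prod (take j w)) e.
Proof.
elim: w => [|b w IH]; first by rewrite big_nil.
rewrite -[iota 0 _]/(0 :: iota (1 + 0) (size w))%N big_cons iotaDl big_map.
rewrite take0 drop0 /word_prod big_nil urep1 -/word_prod.
have -> : \sum_(j <- iota 0 (size w) | prefix p (drop (1 + j) (b :: w)))
    rho (word_prod (take (1 + j) (b :: w))) e = rho (x_ b) (word_count w).
  rewrite IH linear_sum; apply: eq_bigr => j _ /=.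
  by rewrite word_prod_cons urep_mul.
by rewrite -[word_count (b :: w)]/((if prefix p (b :: w) then e else 0) + _);
  case: ifP; rewrite ?add0r.
Qed.

Lemma signed_count_word w : (forall b, b \in w -> letter b) ->
  (forall j, map gam (take (size p) (drop j w)) = map gam p ->
    take (size p) (drop j w) = p) ->
  (forall j, map gam (take (size p) (drop j w)) <> rev (map gam p)) ->
  signed_count Y actI m c rho (itinerary p) e o (word_end w) = word_count w.
Proof.
move=> lett Hpos Hneg; rewrite /signed_count.
have m1 : 1 <= m by bounds; lra.
have c3 : 3 * m < c by bounds; lra.
rewrite (@countE _ _ _ _ _ _ Yneq0 _ _ m1 c3 _ _ rho _ e (word_end w) o [::]) //;
  last first.
  by move=> s /(reverse_occurrence lett) [j]; move/Hneg.
rewrite big_nil subr0 word_countE.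
pose occ j := map (actI (word_prod (take j w))) (itinerary p).
have headE j : (j <= size w)%N -> nth (lab f 1%g) (itinerary w) j = head (lab f 1%g)
  (occ j).
  by move=> jw; rewrite -[j in LHS]addn0 -nth_drop drop_itinerary.
rewrite (@countE _ _ _ _ _ _ Yneq0 _ _ m1 c3 _ _ rho _ e o (word_end w)
  [seq occ j | j <- iota 0 (size w) & prefix p (drop j w)]) //.
- rewrite big_map big_filter_cond; apply: eq_big => [j|j /andP[pj _]].
    rewrite andb_idr// => pj; apply/asboolP;
      apply/(occurrence_position (occ j) lett Hpos); exists j.
    by split=> //; move: pj; rewrite prefixE => /eqP.
  by rewrite (pattern_vecE (@act_cosets1 _ f) (@act_cosetsM _ f) p_fix).
(* Translates at different positions start with different entries of the itinerary, so they are
   distinct. *)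
- rewrite map_inj_in_uniq ?filter_uniq ?iota_uniq// => j j'.
  rewrite !mem_filter !mem_iota !add0n => /andP[_ jw] /andP[_ jw'] ejj.
  have := itinerary_uniq lett => /(uniqP (lab f 1%g)); apply.
  + by rewrite inE size_itinerary ltnW.
  + by rewrite inE size_itinerary ltnW.
  + by rewrite !headE ?ejj// ltnW.
- move=> s /(occurrence_position s lett Hpos) [j [ep ->]]; apply: map_f.
  rewrite mem_filter mem_iota add0n /= prefixE ep eqxx /=.
  rewrite ltnNge; apply/negP => jw; move: ep p_neq0; rewrite (drop_oversize jw) => <-.
  by [].
Qed.

End Occurrences.

End Words.

(** * Detecting words *)

Section BlockWords.
Context {T S : eqType}.
Variables (wt : T -> S) (z y : T) (s : seq T).
Hypothesis zy : wt z != wt y.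
Hypothesis zs : wt z \notin map wt s.
Hypothesis ys : wt y \notin map wt s.
Hypothesis s_neq0 : s != [::].
Implicit Types (u v w : seq T) (b : T).

(** The weight [wt] stands for the gap of a letter, which is all that an itinerary shows of it. The
    separators [z] isolate the single letters, so that the pattern [y :: s] occurs only in the last
    kind of block. *)
Inductive block_word : seq T -> Prop :=
| block_nil : block_word [::]
| block_sep w : block_word w -> block_word (z :: w)
| block_letter b w : b \in y :: s -> block_word w -> block_word [:: z, b, z & w]
| block_pattern w : block_word w -> block_word ((z :: y :: s) ++ z :: w).

Lemma block_word_mem w b : block_word w -> b \in w -> b \in [:: z, y & s].
Proof.
elim=> [|w' _ IH|b' w' b's _ IH|w' _ IH] //.
- by rewrite inE => /predU1P[->|/IH//]; exact: mem_head.
- rewrite !inE => /or4P[/eqP->|/eqP->|/eqP->|/IH]; rewrite ?eqxx ?inE //.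
  by rewrite inE in b's; rewrite b's orbT.
- rewrite mem_cat => /orP[//|]; rewrite inE => /predU1P[->|/IH//].
  exact: mem_head.
Qed.

(** This is what allows to recognize the pattern by weights alone: where it may start, either it is
    really there or the next letter is [z], whose weight does not occur in [s]. *)
Fixpoint anchored w : bool :=
  if w is b :: v then
    ((wt b == wt y) ==> (b == y) && (prefix s v || (ohead v == Some z))) && anchored v
  else true.

Lemma wt_s b : b \in s -> wt b != wt y.
Proof. by move=> bs; apply: contraNneq ys => <-; exact: map_f. Qed.

Lemma anchored_cat u w : (forall b, b \in u -> wt b != wt y) ->
  anchored (u ++ w) = anchored w.
Proof.
elim: u => [//|b u IH] H /=; rewrite (negbTE (H b (mem_head _ _))) /=.
by apply: IH => b' h; apply: H; rewrite inE h orbT.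
Qed.

Lemma anchored_drop j w : anchored w -> anchored (drop j w).
Proof. by elim: j w => [|j IH] [|b w] //= /andP[_ /IH]. Qed.

Lemma block_anchored w : block_word w -> anchored w.
Proof.
elim=> [//|w' _ IH|b w' bs _ IH|w' _ IH] //=; rewrite (negbTE zy) ?IH//=.
  rewrite eqxx orbT andbT andbT; apply/implyP; move: bs; rewrite inE.
  by case/predU1P => [->//|/wt_s/negbTE->].
by rewrite prefix_prefix !eqxx /= (anchored_cat _ wt_s) /= (negbTE zy) IH.
Qed.

Lemma anchored_pattern w j : anchored w ->
  map wt (take (size s).+1 (drop j w)) = map wt (y :: s) ->
    take (size s).+1 (drop j w) = y :: s.
Proof.
move=> /(anchored_drop j); case: (drop j w) => [//|b v] /= /andP[H _] [eb ev].
move: H; rewrite eb eqxx /= => /andP[/eqP-> /orP[|]].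
  by rewrite prefixE => /eqP->.
case: v ev => [//|b' v]; case: s s_neq0 zs => [//|s0 s'] _ zs' /= [e _] /eqP[e'].
by move: zs'; rewrite /= -e e' mem_head.
Qed.

Let r (x x' : S) : bool := (x' == wt y) ==> (x == wt z).

Lemma path_not_y x t : (forall x', x' \in t -> x' != wt y) -> path r x t.
Proof.
elim: t x => [//|x' t IH] x H /=; rewrite /r (negbTE (H _ (mem_head _ _))) /=.
by apply: IH => x2 h; apply: H; rewrite inE h orbT.
Qed.

Lemma block_path w x : block_word w -> path r x (map wt w).
Proof.
move=> bw; elim: bw x => [|w' _ IH|b w' bs _ IH|w' _ IH] x //=;
  rewrite ?map_cat ?cat_path /= {1}/r (negbTE zy) ?IH //=.
  by rewrite /r eqxx implybT (negbTE zy).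
have zy' x' : r x' (wt z) by rewrite /r (negbTE zy).
have zr x' : r (wt z) x' by rewrite /r eqxx implybT.
rewrite zy' zr /= andbT path_not_y//.
by move=> _ /mapP[b bs ->]; exact: wt_s.
Qed.

(** In a block word a letter of weight [wt y] comes after one of weight [wt z], as [r] expresses; in
    the reversed pattern it comes after the first letter of [s]. *)
Lemma block_not_reversed w j : block_word w ->
  map wt (take (size s).+1 (drop j w)) <> rev (map wt (y :: s)).
Proof.
move=> bw e; have := block_path (wt z) bw =>
  /path_sorted/(drop_sorted j)/(take_sorted (size s).+1).
rewrite -map_drop -map_take e.
case: s s_neq0 zs => [//|s0 s'] _ zs' /=; rewrite !rev_cons -!cats1 -catA =>
  /cat_sorted2[_].
rewrite /= /r eqxx andbT => /eqP ee; move: zs'; rewrite /= -ee mem_head.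
by [].
Qed.

Lemma block_no_other w j y' (t : seq T) : block_word w -> wt y' \notin map wt [:: z,
  y & s] ->
  map wt (take (size t).+1 (drop j w)) <> map wt (y' :: t) /\
  map wt (take (size t).+1 (drop j w)) <> rev (map wt (y' :: t)).
Proof.
move=> bw ny; have H : wt y' \notin map wt (take (size t).+1 (drop j w)).
  apply: contra ny => /mapP[b bt ->]; apply: map_f; apply: (block_word_mem bw).
  exact: mem_drop (mem_take bt).
by split=> e; rewrite e ?mem_rev mem_head in H.
Qed.

End BlockWords.

Section WordCountBlocks.
Context {G : groupType} {K : numFieldType} {V : normedModType K}.
Variables (f : G) (n : nat) (rho : unitary_rep G V) (e : V) (z y : G) (s : seq G).
Hypothesis zy : z != y.
Hypothesis zs : z \notin s.
Hypothesis ys : y \notin s.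
Hypothesis s_neq0 : s != [::].
Local Notation count := (word_count f n rho (y :: s) e).
Local Notation wp := (word_prod f n).

Lemma word_count_skip u w : y \notin u -> count (u ++ w) = rho (wp u) (count w).
Proof.
elim: u => [|b u IH]; first by rewrite /word_prod big_nil urep1.
rewrite inE negb_or => /andP[yb yu]; rewrite /= (negbTE yb) add0r IH//.
by rewrite word_prod_cons [in RHS]urep_mul.
Qed.

Lemma word_count_letter b w : b \in y :: s ->
  count [:: z, b, z & w] = rho (wp [:: z; b; z]) (count w).
Proof.
move=> bs; have [->|by_] := eqVneq b y; last first.
  rewrite -[[:: z, b, z & w]]/([:: z; b; z] ++ w) word_count_skip//.
  by rewrite !inE !negb_or !(eq_sym y) zy by_.
rewrite -[[:: z, y, z & w]]/([:: z] ++ y :: z :: w) word_count_skip ?inE 1?eq_sym//.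
have -> : count (y :: z :: w) = rho (f ^+ n * y)%g (count (z :: w)).
  rewrite -[LHS]/((if prefix (y :: s) (y :: z :: w) then e else 0) + _).
  case: ifP => [|_]; rewrite ?add0r//= eqxx /=.
  case: s s_neq0 zs => [//|s0 s'] _; rewrite inE negb_or => /andP[zs0 _] /=.
  by rewrite eq_sym (negbTE zs0).
rewrite -[z :: w]/([:: z] ++ w) word_count_skip ?inE 1?eq_sym//.
rewrite -!urep_mul; congr (rho _ _).
by rewrite /word_prod !big_cons big_nil !mulg1 !mulgA.
Qed.

Lemma word_count_pattern w : count ((z :: y :: s) ++ z :: w) =
  rho (f ^+ n * z)%g e + rho (wp ((z :: y :: s) ++ [:: z])) (count w).
Proof.
rewrite -[_ ++ z :: w]/([:: z] ++ y :: (s ++ z :: w)) word_count_skip ?inE 1?eq_sym//.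
have -> : count (y :: s ++ z :: w) = e + rho (f ^+ n * y)%g (count (s ++ z :: w)).
  rewrite -[LHS]/((if prefix (y :: s) (y :: s ++ z :: w) then e else 0) + _).
  by rewrite prefix_cons eqxx prefix_prefix.
rewrite word_count_skip// -[z :: w]/([:: z] ++ w) word_count_skip ?inE 1?eq_sym//.
rewrite linearD -!urep_mul; congr (rho _ _ + rho _ _);
  first by rewrite /word_prod big_seq1.
by rewrite /word_prod !big_cat /= !big_cons !big_nil !mulg1 !mulgA.
Qed.

End WordCountBlocks.

(** * A family of counting quasi-cocycles separated by words *)

Section Detection.
Context {R : realType} {X : metricType R} {G : groupType}.
Variables (delta : R) (act : G -> X -> X) (o : X).
Hypothesis hyp : hyperbolic_with X delta.
Hypothesis geo : geodesic X.
Hypothesis act_isom : isometric_action act.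
Hypothesis acyl : acylindrical act.
Local Notation d := (@mdist R X).
Variables (f : G) (C : R).
Hypothesis fC : gp o (act f o) (act f^-1%g o) <= C.
Hypothesis fL : 2 * C + 4 * delta + 1 <= d o (act f o).
Local Notation E := (commens f).
Local Notation Y := (@Yset _ _ _ act o f).
Local Notation actI := (@act_cosets _ f).

Lemma distinct_letters a t (K : R) M : adjacency Y a -> 0 <= a -> ~ E t ->
  exists2 ys : seq G, size ys = M & [/\ uniq (map (gam act o f) ys),
    forall b, b \in ys -> ~ E b & forall b, b \in ys -> K < gam act o f b].
Proof.
move=> adj a0 Et; elim: M => [|M [ys sz [U nE big]]]; first by exists [::].
have [b Eb Kb] := gap_unbounded hyp act_isom fC fL adj (\sum_(b <- ys) `|gam act o f
  b| + `|K|) Et a0.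
exists (b :: ys); first by rewrite /= sz.
split=> [/=|b'|b']; last 2 first.
- by rewrite inE => /predU1P[->|/nE].
- rewrite inE => /predU1P[->|/big//]; apply: le_lt_trans Kb.
  by rewrite (le_trans (ler_norm K))// lerDr sumr_ge0.
rewrite U andbT; apply/mapP => -[b' b'ys e]; move: Kb; rewrite -/(gam _ _ _ _) e.
rewrite (big_rem b' b'ys) /= -addrA ltNge => /negP; apply.
by rewrite (le_trans (ler_norm _))// lerDl addr_ge0// sumr_ge0.
Qed.

Lemma map_id_mem (I : eqType) (h : I -> I) (t : seq I) : map h t = t -> forall i,
  i \in t -> h i = i.
Proof.
elim: t => [//|j t IH] /= [hj /IH H] i; rewrite inE => /predU1P[->//|]; exact: H.
Qed.

Section PatternStabilizer.
Variables (r : R) (P n : nat).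
Hypothesis Pn : (P %| n)%N.
Variable lett : G -> Prop.
Hypothesis stab : forall g b b', lett b -> lett b' ->
  actI g (lab f b^-1%g) = lab f b^-1%g -> actI g (lab f 1%g) = lab f 1%g ->
  actI g (lab f (f ^+ n * b')%g) = lab f (f ^+ n * b')%g ->
  small_shifts act o f r P g.
Local Notation x_ b := (f ^+ n * b)%g.

Lemma small_shifts_comm g : small_shifts act o f r P g -> (g * f ^+ n = f ^+ n * g)%g.
Proof.
move=> [e _]; have /dvdnP [q ->] := Pn; rewrite mulnC.
by have := zpow_commute q e; rewrite -PoszM.
Qed.

(** At each letter [h] fixes three consecutive sets, hence commutes with [f ^+ n]. So passing to the
    next set conjugates [h] by the bare letter, and the fixed sets become conditions on the prefix
    products of [s]. *)
Lemma itinerary_stab s b h : (forall b', b' \in b :: s -> lett b') ->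
  actI h (lab f b^-1%g) = lab f b^-1%g ->
  (forall i, i \in itinerary f n s -> actI h i = i) ->
  (s != [::] -> small_shifts act o f r P h) /\
  forall k, (k <= size s)%N -> E ((\prod_(b <- take k s) b)^-1 * h * \prod_(b <- take
    k s) b)%g.
Proof.
have fix1 g : actI g (lab f 1%g) = lab f 1%g -> E g.
  by rewrite act_lab mulg1 => /lab_eq; rewrite mulg1 => /commensV; rewrite invgK.
elim: s b h => [|b' s IH] b h lett_s hb hs.
  split=> // k _; rewrite /= big_nil mulg1 invg1 mul1g; apply: fix1; apply: hs.
  exact: mem_head.
have h1 : actI h (lab f 1%g) = lab f 1%g by apply: hs; exact: mem_head.
have sm : small_shifts act o f r P h.
  apply: (@stab h b b') => //; try by apply: lett_s; rewrite !inE eqxx ?orbT.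
  by apply: hs; rewrite /itinerary !inE eqxx orbT.
split=> // -[_|k]; first by rewrite /= big_nil mulg1 invg1 mul1g; exact: fix1.
rewrite ltnS => ks.
have cE : (b'^-1 * h * b' = (x_ b')^-1 * h * x_ b')%g.
  by rewrite invgM -!mulgA (mulgA h (f ^+ n)%g) (small_shifts_comm sm) -mulgA mulKg.
have [|||_ /(_ k ks)] := IH b' (b'^-1 * h * b')%g; last first.
- by rewrite /= big_cons invgM !mulgA.
- move=> i si; rewrite cE act_cosetsM act_cosetsM hs.
    by rewrite -act_cosetsM mulVg act_cosets1.
  by rewrite itinerary_cons inE map_f// orbT.
- rewrite act_lab -mulgA mulgV mulg1 -[X in lab f X](mulg1 (b'^-1 * h)%g) -(act_lab f
  (b'^-1 * h)%g).
  by rewrite act_cosetsM h1 act_lab mulg1.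
- by move=> b2 hb2; apply: lett_s; rewrite inE hb2 orbT.
Qed.

Variable N : set G.
Hypothesis N_max : maximal_finite_normal_subgroup N.

(** After conjugation to the second set, the letter [y] supplies the set before it, so that three
    consecutive fixed sets are available from the start. *)
Lemma pattern_stab y s g : (forall b', b' \in y :: s -> lett b') -> s != [::] ->
  (forall h, small_shifts act o f r P h -> (forall k, (k <= size s)%N ->
     E ((\prod_(b <- take k s) b)^-1 * h * \prod_(b <- take k s) b)%g) -> N h) ->
  map (actI g) (itinerary f n (y :: s)) = itinerary f n (y :: s) -> N g.
Proof.
move=> lett_ys s0 kill /map_id_mem fix_g.
pose h := ((x_ y)^-1 * g * x_ y)%g.
have [/(_ s0) sm Ek] : (s != [::] -> small_shifts act o f r P h) /\
  forall k, (k <= size s)%N -> E ((\prod_(b <- take k s) b)^-1 * h * \prod_(b <- take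
    k s) b)%g.
  apply: (@itinerary_stab s y h lett_ys).
    rewrite (_ : lab f y^-1%g = actI (x_ y)^-1%g (lab f 1%g)).
      rewrite -act_cosetsM /h -mulgA mulgV mulg1 act_cosetsM fix_g//.
      exact: mem_head.
    rewrite act_lab mulg1 invgM; apply/lab_eq.
    by rewrite invgK mulgA mulgV mul1g; apply: commensV; exact: (commens_zpow f n).
  move=> i si; rewrite /h act_cosetsM act_cosetsM fix_g.
    by rewrite -act_cosetsM mulVg act_cosets1.
  by rewrite itinerary_cons inE map_f// orbT.
have [_ [_ Nnorm] _] := N_max; have := Nnorm _ (x_ y)^-1%g (kill h sm Ek).
rewrite (_ : (h ^ (x_ y)^-1)%g = g)// conjgE /h; set x := x_ y.
by rewrite invgK mulgK mulVKg.
Qed.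

End PatternStabilizer.

(** The interface to the rigidity argument, free of geometry: [W] consists of the products of block
    words paired with their counts, [u] is the separator, [ps] the word of the pattern, and [h] the
    final power of [f]. *)
Theorem counting_family (K : numFieldType) (V : normedModType K)
  (rho : unitary_rep G V) (e : V) (N : set G) (t : G) (M : nat) :
  maximal_finite_normal_subgroup N -> (forall g, N g -> rho g e = e) -> ~ E t ->
  exists F : 'I_M -> G -> V, (forall i, quasi_cocycle rho (F i)) /\
  forall q, exists (u : G) (ps : seq G) (h : G) (W : set (G * V)),
  [/\ W (1%g, 0), forall g v, W (g, v) ->
       [/\ W (u * g, rho u v)%g, forall b, b \in ps -> W (u * b * u * g,
         rho (u * b * u) v)%g &
           W (u * (\prod_(b <- ps) b) * u * g,
              rho u e + rho (u * (\prod_(b <- ps) b) * u) v)%g] &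
       forall g v, W (g, v) -> F q (g * h)%g = v /\ forall i,
         i != q -> F i (g * h)%g = 0].
Proof.
move=> N_max Ne Et; have [d0 C0 a00 l1 ea] := line_const hyp fC fL.
set k := qc_const delta act o f C.
have k0 : 0 <= k := qc_const_ge0 hyp fC fL.
have Yqc : quasi_convex Y k := Yset_quasi_convex hyp act_isom fC fL.
have [D1 [_ sep1]] := Yset_separated hyp act_isom acyl fC fL (k + 4 * delta).
have [a [a_ge0 da adj proj]] := adjacency_ex hyp geo Yqc sep1 k0.
have [D [D0 sep]] := Yset_separated hyp act_isom acyl fC fL (k + (a + 6 * delta)).
pose m := 120 * a + 420 * delta + 6.
have [P P0 stab] := stabilizer_small hyp act_isom acyl fC fL adj.
have [s sE [s0 kill]] := detecting_word hyp act_isom acyl fC fL adj N_max P Et.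
pose wt := gam act o f.
(* One separator and [M] first letters of patterns. Gaps larger than the sum of those of [s] keep
   their weights apart from the weights in [s]. *)
have [zys szys [Uzys zysE zysbig]] := distinct_letters (\sum_(b <- s) `|wt b|) M.+1
  adj a_ge0 Et.
have [z [ys [ezys sys]]] : exists z ys, zys = z :: ys /\ size ys = M.
  by case: (zys) szys => [//|z ys] [<-]; exists z, ys.
have [B B0 br] := @bridge_ex _ _ _ act o f (zys ++ s).
(* The sum makes [c] larger than the gap of every letter. *)
pose c := 3 * m + D + 10 + \sum_(b <- zys ++ s) `|wt b| + 1.
have sum0 (T : seq G) : 0 <= \sum_(b <- T) `|wt b| by rewrite sumr_ge0.
have sum_lt (T : seq G) b : b \in T -> wt b <= \sum_(b <- T) `|wt b|.
  move=> bT; rewrite (big_rem b bT) /= (le_trans (ler_norm _))// lerDl sumr_ge0//.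
have cl : 3 * m + D + 10 <= c by have := sum0 (zys ++ s); rewrite /c; lra.
have [n0 {}stab] := stab B.
(* Divisible by [P] for [small_shifts_comm], at least [n0] for the stabilizers, and large enough for
   long crossings. *)
pose n := (P * (n0 + (Num.truncn (2 * B + c + 2 * m)).+1))%N.
have Pn : (P %| n)%N by exact: dvdn_mulr.
have nn0 : (n0 <= n)%N by apply: leq_trans (leq_pmull _ P0); exact: leq_addr.
have nl : 2 * B + c + 2 * m <= n%:R.
  apply: (@le_trans _ _ (Num.truncn (2 * B + c + 2 * m)).+1%:R).
    by apply/ltW/truncnS_gt; rewrite num_real.
  by rewrite ler_nat; apply: leq_trans (leq_pmull _ P0); exact: leq_addl.
have letters b : b \in zys ++ s -> letter act o f c B b.
  move=> bT; split; last exact: br.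
    by move: bT; rewrite mem_cat => /orP[/zysE|/sE].
  have := sum_lt _ _ bT; rewrite -/wt /c /m; move: D0 a_ge0 d0; clear; lra.
have m1 : 1 <= m by rewrite /m; lra.
have c3 : 3 * m < c by have := sum0 (zys ++ s); rewrite /c; lra.
pose pat i := nth z ys i :: s.
have nth_ys (i : 'I_M) : nth z ys i \in zys by rewrite ezys inE mem_nth ?sys ?orbT.
have pat_lett (i : 'I_M) b : b \in pat i -> letter act o f c B b.
  rewrite inE => /predU1P[->|bs]; apply: letters; rewrite mem_cat ?nth_ys// bs orbT.
  by [].
have lm : 120 * a + 420 * delta + 6 <= m by [].
have fix_e (i : 'I_M) g : map (actI g) (itinerary f n (pat i)) = itinerary f n (pat
  i) -> rho g e = e.
  move=> fixg; apply: Ne; apply: (pattern_stab Pn (lett := letter act o f c B) _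
    N_max _ s0 kill fixg).
    move=> h b b' [Eb _ [v [u bb]]] [Eb' _ [v' [u' bb']]].
    exact: (stab n h b b' v u v' u' nn0 Eb Eb' bb bb').
  exact: pat_lett.
have cover := triangle_sides hyp geo (@Yset_neq0 _ _ _ act o f) Yqc da d0 adj proj
  sep D0 k0 lm cl.
pose F (i : 'I_M) := counting_cocycle Y act actI m c rho (itinerary f n (pat i)) e o.
exists F; split.
  move=> i; apply: (counting_quasi_cocycle (@Yset_neq0 _ _ _ act o f) act_isom
   (@act_cosets1 _ f) (@act_cosetsM _ f) (Yset_act act_isom (o := o) (f := f)) m1 c3
     cover _ (fix_e i)).
  by rewrite size_itinerary.
move=> q; set y := nth z ys q; pose x_ b := (f ^+ n * b)%g.
have wts b : b \in zys -> wt b \notin map wt s.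
  move=> bz; apply/mapP => -[b' b's eb]; have := zysbig b bz; rewrite -/wt eb.
  by rewrite ltNge sum_lt.
have zz : z \in zys by rewrite ezys mem_head.
have zs := wts z zz; have yss := wts y (nth_ys q).
move: Uzys; rewrite -/wt ezys /= => /andP[zys' Uys].
have zy : wt z != wt y.
  by apply: contraNneq zys' => ->; apply: map_f; rewrite mem_nth// sys.
have other (i : 'I_M) : i != q -> wt (nth z ys i) \notin map wt [:: z, y & s].
  move=> iq; rewrite /= !inE !negb_or wts ?nth_ys// andbT; apply/andP; split.
    by apply: contraNneq zys' => <-; apply: map_f; rewrite mem_nth// sys.
  rewrite -!(nth_map z (wt z)) ?sys// (nth_uniq _ _ _ Uys) ?size_map ?sys//.
exists (x_ z), (map x_ (y :: s)), (f ^+ n)%g,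
  [set gv | exists2 w, block_word z y s w & gv = (word_prod f n w,
    word_count f n rho (y :: s) e w)].
have wprod T : word_prod f n T = (\prod_(b <- map x_ T) b)%g by rewrite big_map.
have notin b T : wt b \notin map wt T -> b \notin T by apply: contra; exact: map_f.
have zy' : z != y by apply: contraNneq zy => ->.
split.
- by exists [::]; [exact: block_nil | rewrite /word_prod big_nil].
- move=> g v [w bw [-> ->]]; split.
  + exists (z :: w); first exact: block_sep.
    rewrite word_prod_cons -[z :: w]/([:: z] ++ w) word_count_skip ?inE 1?eq_sym//.
    by rewrite /word_prod big_seq1.
  + move=> _ /mapP[b bs ->]; exists [:: z, b, z & w]; first exact: block_letter.
    rewrite (word_count_letter _ _ _ _ zy' (notin _ _ zs) s0) ?(notin _ _ yss)//.
    by rewrite /word_prod !big_cons big_nil !mulg1 !mulgA.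
  + exists ((z :: y :: s) ++ z :: w); first exact: block_pattern.
    rewrite (word_count_pattern _ _ _ _ zy') ?(notin _ _ yss)//.
    rewrite -wprod; congr (_, _ + rho _ _).
      by rewrite /word_prod big_cat /= !big_cons !mulgA.
    by rewrite /word_prod big_cat /= !big_cons big_nil !mulgA mulg1.
move=> g v [w bw [-> ->]].
have wl b : b \in w -> letter act o f c B b.
  move=> /(block_word_mem bw); rewrite !inE => /or3P[/eqP->|/eqP->|bs]; apply: letters;
  by rewrite mem_cat ?zz ?nth_ys// bs orbT.
have swc := signed_count_word hyp geo act_isom fC fL Yqc da adj proj sep D0 k0 lm cl
  B0 nl.
have FE i : F i (word_prod f n w * f ^+ n)%g =
    signed_count Y actI m c rho (itinerary f n (pat i)) e o (word_end act o f n w).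
  by rewrite /F /counting_cocycle (act_M act_isom (word_prod f n w)).
split.
  rewrite FE; apply: swc => //; first exact: pat_lett.
  - exact: fix_e.
  - by move=> j; apply: (anchored_pattern (wt := wt) (z := z) zs s0);
    apply: (block_anchored (wt := wt) (z := z)).
  - by move=> j; exact: (block_not_reversed zy zs yss s0).
move=> i iq; rewrite FE (swc _ _ rho (pat i)) //; last 4 first.
- exact: pat_lett.
- exact: fix_e.
- by move=> j /(proj1 (block_no_other _ _ bw (other i iq))).
- by move=> j; exact: (proj2 (block_no_other _ _ bw (other i iq))).
rewrite -[w]cats0 word_count_skip ?linear0//.
apply: contra (other i iq) => yw; apply: map_f; exact: block_word_mem bw yw.
Qed.

End Detection.

(** * Loxodromic elements from the limit set *)

Lemma not_card_le2 (T : Type) (A : set T) : ~ (A #<= `I_2)%card ->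
  exists a b c, [/\ A a, A b & A c] /\ [/\ a <> b, a <> c & b <> c].
Proof.
move=> nA; apply: contrapT => no; apply: nA.
have sub a b : A `<=` [set a; b] -> (A #<= `I_2)%card.
  move=> Aab; apply: card_le_trans (card_image_le (fun n : nat =>
    if n is 0%N then a else b) `I_2).
  apply: subset_card_le => x /Aab[->|->]; [by exists 0%N | by exists 1%N].
have [[a Aa]|A0] := pselect (exists a, A a); last first.
  have -> : A = set0 by apply/seteqP; split=> // x Ax; case: A0; exists x.
  exact: card_ge0.
have [[b [Ab ab]]|A1] := pselect (exists b, A b /\ a <> b); last first.
  by apply: (sub a a) => x Ax; left; apply: contrapT => xa; apply: A1; exists x;
    split=> // e; exact/xa/esym.
apply: (sub a b) => x Ax; apply: contrapT => /not_orP[xa xb]; apply: no.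
by exists a, b, x; split; split=> //; [move=> e; exact/xa/esym | move=> e;
  exact/xb/esym].
Qed.

Section Boundary.
Context {R : realType} {X : metricType R}.
Variable delta : R.
Hypothesis hyp : hyperbolic_with X delta.
Implicit Types (u v w : nat -> X) (o : X).
Local Notation d := (@mdist R X).

Lemma asymptoticP o u v : asymptotic u v <-> forall A, exists N, forall i j,
  (N <= i)%N -> (N <= j)%N -> A <= gp o (u i) (v j).
Proof.
split=> [H A|H p].
  have /cvgryPge/(_ A) := H o; move=> [[P Q] [/= [N1 _ PN] [N2 _ QN] PQ]].
  exists (maxn N1 N2) => i j; rewrite !geq_max => /andP[i1 _] /andP[_ j2].
  by apply: (PQ (i, j)); split; [exact: PN | exact: QN].
apply/cvgryPge => A; have [N HN] := H (A + d o p).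
exists ([set i | (N <= i)%N], [set i | (N <= i)%N]); first by split; exists N.
move=> [i j] [/= Ni Nj]; have := HN i j Ni Nj; have := gp_lip_base o p (u i) (v j).
by lra.
Qed.

Lemma asymptotic_sym u v : asymptotic u v -> asymptotic v u.
Proof.
move=> H; apply/(asymptoticP (u 0%N)) => A.
have [N HN] := (asymptoticP (u 0%N) u v).1 H A; exists N => i j Ni Nj; rewrite gpC.
exact: HN.
Qed.

(** By hyperbolicity, one large product far out spreads along the tails of both sequences, as each
    of them converges. *)
Lemma asymptotic_frequently o u v : converges_to_infinity u ->
  converges_to_infinity v ->
  (forall A N, exists i j, [/\ (N <= i)%N, (N <= j)%N & A <= gp o (u i) (v j)]) ->
  asymptotic u v.
Proof.
move=> /(asymptoticP o) cu /(asymptoticP o) cv H; apply/(asymptoticP o) => A.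
have dl := hyp_ge0 hyp o.
have [N1 h1] := cu (A + 2 * delta); have [N2 h2] := cv (A + 2 * delta).
exists (maxn N1 N2) => i j; rewrite !geq_max => /andP[i1 _] /andP[_ j2].
have [i' [j' []]] := H (A + 2 * delta) (maxn N1 N2).
rewrite !geq_max => /andP[i'1 _] /andP[_ j'2] h3.
have h4 := h1 _ _ i1 i'1; have h5 := h2 _ _ j'2 j2.
case: (hyp_or hyp o (u i') (v j') (v j)) => h6;
  case: (hyp_or hyp o (u i) (u i') (v j)); lra.
Qed.

Lemma asymptotic_trans v u w : converges_to_infinity u -> converges_to_infinity w ->
  asymptotic u v -> asymptotic v w -> asymptotic u w.
Proof.
move=> cu cw uv vw; have o := u 0%N; have dl := hyp_ge0 hyp o.
apply/(asymptoticP o) => A.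
have [N1 h1] := (asymptoticP o u v).1 uv (A + delta).
have [N2 h2] := (asymptoticP o v w).1 vw (A + delta).
exists (maxn N1 N2) => i j; rewrite !geq_max => /andP[i1 _] /andP[_ j2].
have := h1 i _ i1 (leq_maxl N1 N2); have := h2 _ j (leq_maxr N1 N2) j2.
by case: (hyp_or hyp o (u i) (v (maxn N1 N2)) (w j)); lra.
Qed.

Lemma boundary_eq xi xi' v v' : gromov_boundary X xi -> gromov_boundary X xi' ->
  xi v -> xi' v' -> asymptotic v v' -> xi = xi'.
Proof.
move=> [u cu ->] [u' cu' ->] [cv uv] [cv' uv'] vv'.
have uu' : asymptotic u u'.
  apply: (asymptotic_trans (v := v)) => //; apply: (asymptotic_trans (v := v')) => //.
  exact: asymptotic_sym.
apply/seteqP; split=> w [cw h]; split=> //; last exact: asymptotic_trans cu cw uu' h.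
exact: asymptotic_trans cu' cw (asymptotic_sym uu') h.
Qed.

End Boundary.

Section Loxodromic.
Context {R : realType} {X : metricType R} {G : groupType}.
Variables (delta : R) (act : G -> X -> X) (o : X).
Hypothesis hyp : hyperbolic_with X delta.
Hypothesis act_isom : isometric_action act.
Local Notation d := (@mdist R X).
Local Notation "<< g , h >>" := (gp o (act g o) (act h o)).

Lemma norm_inv g : d o (act g^-1%g o) = d o (act g o).
Proof. by rewrite -(act_d act_isom g) (act_KV act_isom) metric_sym. Qed.

Lemma angle g h : gp (act g o) o (act (g * h)%g o) = <<g^-1%g, h>>.
Proof. by rewrite -(act_gp act_isom g^-1%g) (act_K act_isom) (act_M act_isom) (act_K
  act_isom). Qed.

(** If neither [g] nor [h] qualifies, then [g^-1] points in the direction of [g], and [h^-1] in that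
    of [h]. These two directions differ, so the steps of [g * h] hardly backtrack. *)
Lemma loxodromic_of_pair A g h L : 0 <= A -> 2 * A + 4 * delta < d o (act g o) ->
  2 * A + 4 * delta < d o (act h o) -> <<g, h>> <= A ->
  L + 2 * A + 2 * delta <= d o (act g o) -> L + 2 * A + 2 * delta <= d o (act h o) ->
  exists f, <<f, f^-1%g>> <= A + 3 * delta /\ L <= d o (act f o).
Proof.
move=> A0 gl hl gh Lg Lh; have dl := hyp_ge0 hyp o.
have [gg|gg] := leP <<g, g^-1%g>> (A + delta); first by exists g; split; lra.
have [hh|hh] := leP <<h, h^-1%g>> (A + delta); first by exists h; split; lra.
have g'h : <<g^-1%g, h>> <= A + delta by apply: (gp_transfer hyp gh).
have gh' : <<h^-1%g, g>> <= A + delta by apply: (gp_transfer hyp _ hh); rewrite gpC.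
exists (g * h)%g.
have a1 := angle g h; have s1 := gp_split o (act g o) (act (g * h)%g o).
have a2 := angle h^-1%g g^-1%g; rewrite invgK in a2.
have s2 := gp_split o (act h^-1%g o) (act (h^-1 * g^-1)%g o).
rewrite -invgM in a2 s2; rewrite norm_inv in s2.
rewrite (gpC o (act h o)) in a2.
have h1 : <<(g * h)%g, h^-1%g>> <= A + 2 * delta.
  have : <<(g * h)%g, h^-1%g>> <= A + delta + delta; last lra.
  apply: (gp_transfer hyp (x := act g o)); first by rewrite gpC.
  by lra.
split.
  rewrite gpC; have : <<(g * h)^-1%g, (g * h)%g>> <= A + 2 * delta + delta; last lra.
  by apply: (gp_transfer hyp (x := act h^-1%g o)); [rewrite gpC | lra].
have := gp_dist (act g o) o (act (g * h)%g o).
rewrite a1 (act_M act_isom g) (act_d act_isom) (metric_sym (act g o) o); lra.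
Qed.

Hypothesis nonel : non_elementary act.

Definition orbit (g : nat -> G) (i : nat) : X := act (g i) o.

Lemma three_orbits : exists g1 g2 g3 : nat -> G,
  [/\ converges_to_infinity (orbit g1), converges_to_infinity (orbit g2) &
      converges_to_infinity (orbit g3)] /\
  [/\ ~ asymptotic (orbit g1) (orbit g2), ~ asymptotic (orbit g1) (orbit g3) &
      ~ asymptotic (orbit g2) (orbit g3)].
Proof.
have [xi1 [xi2 [xi3 [[l1 l2 l3] [n12 n13 n23]]]]] := not_card_le2 nonel.
have H xi : limit_set act xi -> exists g : nat -> G, converges_to_infinity (orbit g) /\
    exists2 v, xi v & asymptotic (orbit g) v.
  move=> [[u cu ->] [x [g [cg ug]]]]; exists g.
  have key v : asymptotic (fun n => act (g n) x) v -> asymptotic (orbit g) v.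
    move=> /(asymptoticP o) h; apply/(asymptoticP o) => A.
    have [N HN] := h (A + d o x); exists N => i j Ni Nj; have := HN i j Ni Nj.
    have := gp_lip (act (g i) o) o (act (g i) x) (v j).
    by rewrite (act_d act_isom) (metric_sym x) /orbit; lra.
  have gx := key _ cg; split.
    apply: key; exact: asymptotic_sym gx.
  by exists (fun n => act (g n) x).
have [g1 [c1 [v1 xv1 a1]]] := H _ l1; have [g2 [c2 [v2 xv2 a2]]] := H _ l2.
have [g3 [c3 [v3 xv3 a3]]] := H _ l3.
have D xi xi' v v' g g' : limit_set act xi -> limit_set act xi' -> xi <> xi' ->
    converges_to_infinity (orbit g) -> converges_to_infinity (orbit g') ->
    xi v -> xi' v' -> asymptotic (orbit g) v -> asymptotic (orbit g') v' ->
    ~ asymptotic (orbit g) (orbit g').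
  move=> [B _] [B' _] ne cg cg' xv xv' gv gv' gg'; apply: ne.
  have cv : converges_to_infinity v by case: B xv => u cu -> [].
  have cv' : converges_to_infinity v' by case: B' xv' => u cu -> [].
  apply: (boundary_eq hyp B B' xv xv').
  exact: (asymptotic_trans hyp cv cv' (asymptotic_sym gv) (asymptotic_trans hyp cg
    cv' gg' gv')).
exists g1, g2, g3; split; split=> //.
- exact: (D _ _ _ _ _ _ l1 l2 n12 c1 c2 xv1 xv2 a1 a2).
- exact: (D _ _ _ _ _ _ l1 l3 n13 c1 c3 xv1 xv3 a1 a3).
- exact: (D _ _ _ _ _ _ l2 l3 n23 c2 c3 xv2 xv3 a2 a3).
Qed.

Lemma norm_infty g K : converges_to_infinity (orbit g) ->
  exists N, forall i, (N <= i)%N -> K <= d o (act (g i) o).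
Proof.
move=> /(asymptoticP o) /(_ K) [N HN]; exists N => i Ni.
by have := HN i i Ni Ni; rewrite /orbit gpxx.
Qed.

Lemma loxodromic_ex : exists f C, gp o (act f o) (act f^-1%g o) <= C /\
  2 * C + 4 * delta + 1 <= d o (act f o).
Proof.
have [g [h [_ [[cg ch _] [na _ _]]]]] := three_orbits.
have dl := hyp_ge0 hyp o.
have [A [A0 HA]] : exists A, 0 <= A /\ forall N, exists i j,
    [/\ (N <= i)%N, (N <= j)%N & <<g i, h j>> <= A].
  apply: contrapT => no; apply: na; apply/(asymptoticP o) => A.
  apply: contrapT => no2; apply: no; exists `|A|; split=> [//|N].
  apply: contrapT => no3; apply: no2; exists N => i j Ni Nj; rewrite leNgt;
    apply/negP => lt.
  by apply: no3; exists i, j; split=> //; apply/ltW/(lt_le_trans lt)/ler_norm.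
pose L := 2 * (A + 3 * delta) + 4 * delta + 1.
have [N1 h1] := norm_infty (L + 2 * A + 4 * delta) cg.
have [N2 h2] := norm_infty (L + 2 * A + 4 * delta) ch.
have [i [j []]] := HA (maxn N1 N2); rewrite !geq_max =>
  /andP[/h1 gi _] /andP[_ /h2 hj] gh.
have := @loxodromic_of_pair A (g i) (h j) L A0 _ _ gh; rewrite /L in gi hj *.
case; try lra; move=> f [fC fL]; exists f, (A + 3 * delta); split=> //.
Qed.

Variables (f : G) (C : R).
Hypothesis fC : gp o (act f o) (act f^-1%g o) <= C.
Hypothesis fL : 2 * C + 4 * delta + 1 <= d o (act f o).
Local Notation pt := (axis_pt act o f).

Lemma same_side (i j : int) : (0 <= i) && (0 <= j) || (i <= 0) && (j <= 0) ->
  Num.min (d o (pt i)) (d o (pt j)) - line_a delta C <= gp o (pt i) (pt j).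
Proof.
have mid (k n : int) : (0 <= k <= n) || (n <= k <= 0) ->
    d o (pt k) - line_a delta C <= gp o (pt k) (pt n).
  move=> kn; have : gp (pt k) o (pt n) <= line_a delta C.
    rewrite -[X in gp _ X _](pt0 o act_isom f).
    by case/orP: kn => kn; [|rewrite gpC]; apply: (between hyp act_isom fC fL).
  by have := gp_split o (pt k) (pt n); lra.
move=> ij; have [le|le] : ((0 <= i <= j) || (j <= i <= 0)) \/ ((0 <= j <= i) || (i <=
  j <= 0)).
  by move: ij; clear; lia.
  by have := mid _ _ le; rewrite minEle; case: ifP => ?; lra.
by have := mid _ _ le; rewrite (gpC o (pt j)) minEle; case: (leP (d o (pt i))) => ?;
  lra.
Qed.

(** Otherwise the whole orbit would stay near the axis, whose two ends cannot receive three pairwise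
    non-asymptotic sequences. *)
Lemma outside_commens_ex : exists t, ~ commens f t.
Proof.
apply: contrapT => no.
have all_near g : exists k, d (act g o) (pt k) <= commens_const delta act o f C.
  apply: (commens_near hyp act_isom fC fL); apply: contrapT => ng; apply: no;
    by exists g.
set D3 := commens_const _ _ _ _ _ in all_near.
have [m mP] := choice all_near.
have [g1 [g2 [g3 [[c1 c2 c3] [n12 n13 n23]]]]] := three_orbits.
pose freq (b : bool) (g : nat -> G) := forall N, exists2 i,
  (N <= i)%N & (0 <= m (g i)) = b \/ m (g i) = 0.
have freqP g : freq true g \/ freq false g.
  apply: contrapT => /not_orP[h1 h2]; apply: h1 => N1; apply: contrapT => h1.
  apply: h2 => N2; apply: contrapT => h2; pose N := maxn N1 N2.
  have [s|s] := boolP (0 <= m (g N)).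
    by apply: h1; exists N; rewrite ?leq_maxl//; left.
  by apply: h2; exists N; rewrite ?leq_maxr//; left; apply/negbTE.
have clash b g g' : converges_to_infinity (orbit g) ->
  converges_to_infinity (orbit g') ->
    freq b g -> freq b g' -> asymptotic (orbit g) (orbit g').
  move=> cg cg' fg fg'; apply: (asymptotic_frequently hyp (o := o) cg cg') => A N.
  pose K := A + 3 * D3 + line_a delta C.
  have [N1 h1] := norm_infty K cg; have [N2 h2] := norm_infty K cg'.
  have [i + si] := fg (maxn N (maxn N1 N2)); rewrite !geq_max => /and3P[Ni /h1 ki _].
  have [j + sj] := fg' (maxn N (maxn N1 N2)); rewrite !geq_max => /and3P[Nj _ /h2 kj].
  exists i, j; split=> //; rewrite /orbit.
  have ss : (0 <= m (g i)) && (0 <= m (g' j)) || (m (g i) <= 0) && (m (g' j) <= 0).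
    by move: si sj; clear; case: b => -[?|?] [?|?]; lia.
  have := same_side ss.
  have e1 := mP (g i); have e2 := mP (g' j).
  have t1 := metric_triangle o (pt (m (g i))) (act (g i) o).
  have t2 := metric_triangle o (pt (m (g' j))) (act (g' j) o).
  rewrite (metric_sym (pt _)) in t1; rewrite (metric_sym (pt _)) in t2.
  have l1 := gp_lip (act (g i) o) o (pt (m (g i))) (pt (m (g' j))).
  have l2 := gp_lipr (act (g' j) o) o (act (g i) o) (pt (m (g' j))).
  rewrite (metric_sym (pt _)) in l1; rewrite (metric_sym (pt _)) in l2.
  by rewrite minEle; case: ifP => _; rewrite /K in ki kj; lra.
case: (freqP g1) (freqP g2) (freqP g3) => h1 [] h2 [] h3;
  first [exact: n12 (clash _ _ _ c1 c2 h1 h2) | exact: n13 (clash _ _ _ c1 c3 h1 h3)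
        | exact: n23 (clash _ _ _ c2 c3 h2 h3)].
Qed.

End Loxodromic.

(** * Rigidity of cocycles *)

Lemma norm_le_nat (R : realType) (K : numFieldType) :
  K = R :> numFieldType \/ K = R[i] :> numFieldType -> forall x : K, exists n : nat,
    `|x| <= n%:R.
Proof.
have real_case (x : R) : exists n : nat, `|x| <= n%:R.
  by exists (Num.truncn `|x|).+1; apply/ltW/truncnS_gt; rewrite num_real.
case=> -> //= x; have [n xn] := real_case (complex.Re `|x|); exists n.
have xr : `|x| = (complex.Re `|x|)%:C%C by apply/esym/RRe_real; rewrite normr_real.
rewrite xr (_ : n%:R = (n%:R : R)%:C%C); last by rewrite rmorph_nat.
by rewrite lecR (le_trans (ler_norm _)).
Qed.

Section NearCenter.
Context {K : numFieldType} {V : normedModType K}.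
Hypothesis arch : forall x : K, exists n : nat, `|x| <= n%:R.
Hypothesis conv : uniformly_convex V.

(** The order of [K] may be partial, so no infimum is taken: descending from [M] in steps of [eps]
    leaves [P] after finitely many steps. *)
Lemma near_infimum (P : K -> Prop) (M eps : K) : P M -> 0 < eps ->
  (forall r, P r -> 0 <= r) -> exists r, [/\ P r, r <= M & ~ P (r - eps)].
Proof.
move=> PM e0 P0; have M0 := P0 _ PM.
have [n Mn] := arch (M / eps).
have ex : exists n, `[< ~ P (M - n.+1%:R * eps) >].
  exists n; apply/asboolP => /P0; rewrite subr_ge0 -ler_pdivlMr// => h.
  have := le_trans h (le_trans (real_ler_norm (ger0_real (divr_ge0 M0 (ltW e0)))) Mn).
  by rewrite ler_nat ltnn.
case: (ex_minnP ex) => k /asboolP nP kmin.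
exists (M - k%:R * eps); split.
- case: k nP kmin => [|k] nP kmin; first by rewrite mul0r subr0.
  apply: contrapT => nPk; have := kmin k (asboolT nPk).
  by rewrite ltnn.
- by rewrite gerBl mulr_ge0// ltW.
- by move: nP; rewrite -[k.+1]addn1 natrD mulrDl mul1r opprD addrA.
Qed.

(** [xi] is almost a Chebyshev centre of [S]: if an isometry moved it far, the
    midpoint of [xi] and its image would be a better centre of the image of [S]. *)
Lemma almost_fixed_point (S : set V) (M eta : K) : S !=set0 ->
  (forall v, S v -> `|v| <= M) -> 0 < eta ->
  exists xi, forall A : V -> V, (forall x y, `|A x - A y| = `|x - y|) ->
    (forall y, exists x, A x = y) -> (forall v, S v -> S (A v)) -> `|A xi - xi| <= eta.
Proof.
move=> [s0 Ss0] SM eta0.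
have M0 : 0 <= M := le_trans (normr_ge0 _) (SM _ Ss0).
have M1 : 0 < M + 1 by rewrite ltr_wpDl.
have [dl dl0 conv'] := conv (divr_gt0 eta0 M1).
pose P (r : K) := exists xi, forall v, S v -> `|v - xi| <= r.
have P0 r : P r -> 0 <= r by move=> [xi /(_ _ Ss0)]; exact: le_trans (normr_ge0 _).
have PM : P M by exists 0 => v Sv; rewrite subr0; exact: SM.
have half0 : 0 < eta / 2 by rewrite divr_gt0.
(* The step is chosen for the contradiction: if [xi] moves by more than [eta], then [r] is at least
   [eta / 2], and uniform convexity improves the radius by [dl * r]. *)
have [r [[xi rP] rM nP]] := near_infimum PM (mulr_gt0 half0 dl0) P0.
exists xi => A isoA surA SA; rewrite real_leNgt ?ger0_real ?normr_ge0 ?ltW//.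
apply/negP => lt; apply: nP.
have r2 : eta < r + r.
  apply: lt_le_trans lt _; have -> : A xi - xi = (A xi - A s0) + (A s0 - xi) by
    rewrite subrKA.
  by apply: le_trans (ler_normD _ _) (lerD _ (rP _ (SA _ Ss0))); rewrite isoA distrC rP.
have r_half : eta / 2 <= r by rewrite ler_pdivrMr// mulr_natr mulr2n ltW.
have r0 : 0 < r := lt_le_trans half0 r_half.
(* [A] maps [S] only into itself, so the midpoint is pulled back by [A] to become a centre of
   [S]. *)
have [nu nuE] := surA (2^-1 *: (xi + A xi)); exists nu => v Sv.
rewrite -isoA nuE; set w := A v.
have Sw : S w := SA _ Sv.
have n1 : `|r^-1 *: (w - xi)| <= 1.
  by rewrite normrZ gtr0_norm ?invr_gt0// mulrC ler_pdivrMr// mul1r; exact: rP.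
have n2 : `|r^-1 *: (w - A xi)| <= 1.
  by rewrite normrZ gtr0_norm ?invr_gt0// mulrC ler_pdivrMr// mul1r isoA; exact: rP.
have n3 : eta / (M + 1) <= `|r^-1 *: (w - xi) - r^-1 *: (w - A xi)|.
  rewrite -scalerBr opprB (addrC (w - xi)) subrKA normrZ gtr0_norm ?invr_gt0//
    [leRHS]mulrC.
  apply: (@le_trans _ _ (eta / r)); last by rewrite ler_pM2r ?invr_gt0// ltW.
  by rewrite ler_pM2l// lef_pV2 ?posrE// (le_trans rM)// lerDl.
have := conv' _ _ n1 n2 n3; rewrite -scalerDr scalerA mulrC -scalerA normrZ gtr0_norm
  ?invr_gt0//.
rewrite mulrC ler_pdivrMr// => h.
apply: (@le_trans _ _ ((1 - dl) * r)).
  apply: le_trans h; rewrite le_eqVlt; apply/orP; left; apply/eqP; congr `|_|.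
  rewrite addrACA -opprD scalerBr; congr (_ - _).
  by rewrite -[w + w]mulr2n -[w *+ 2]scaler_nat scalerA mulVf ?scale1r// pnatr_eq0.
by rewrite mulrBl mul1r lerD2l lerN2 mulrC ler_pM2l.
Qed.

End NearCenter.

Section Rigidity.
Context {K : numFieldType} {G : groupType} {V : normedModType K}.
Hypothesis arch : forall x : K, exists n : nat, `|x| <= n%:R.
Hypothesis conv : uniformly_convex V.
Variable rho : unitary_rep G V.

Lemma cocycle1 kappa : cocycle rho kappa -> kappa 1%g = 0.
Proof.
move=> c; have := c 1%g 1%g; rewrite mulg1 urep1 => /eqP.
by rewrite -[X in X == _]addr0 (inj_eq (addrI _)) eq_sym => /eqP.
Qed.

Lemma cocycle_prod kappa ps (eta : K) : cocycle rho kappa ->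
  (forall b, b \in ps -> `|kappa b| <= eta) ->
  `|kappa (\prod_(b <- ps) b)%g| <= eta *+ size ps.
Proof.
move=> c; elim: ps => [|b ps IH] H; first by rewrite big_nil (cocycle1 c) normr0.
rewrite big_cons c mulrS; apply: le_trans (ler_normD _ _) _; apply: lerD.
  by apply: H; exact: mem_head.
by rewrite urep_norm; apply: IH => b' h; apply: H; rewrite inE h orbT.
Qed.

Lemma cocycle_rigidity (W : set (G * V)) (u h : G) (ps : seq G) (e : V) (c : K) (beta
  kappa : G -> V) :
  W (1%g, 0) -> (forall g v, W (g, v) ->
    [/\ W (u * g, rho u v)%g, forall b, b \in ps -> W (u * b * u * g,
      rho (u * b * u) v)%g &
        W (u * (\prod_(b <- ps) b) * u * g,
           rho u e + rho (u * (\prod_(b <- ps) b) * u) v)%g]) ->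
  bounded_map beta -> cocycle rho kappa ->
  (forall g v, W (g, v) -> beta (g * h)%g + kappa (g * h)%g = c *: v) ->
  e <> 0 -> c = 0.
Proof.
move=> W1 Wcl [Mb bM] ck val e0; set P := (\prod_(b <- ps) b)%g in Wcl.
have small (eta : K) : 0 < eta -> `|c| * `|e| <= eta *+ (3 + 3 * size ps).
  move=> eta0.
  (* These deviations are bounded: by [val] each of them is a value of [beta] plus a translate of
     [kappa h]. *)
  pose S : set V := [set x | exists g v, W (g, v) /\ x = c *: v - kappa g].
  have S0 : S !=set0 by exists (c *: 0 - kappa 1%g), 1%g, 0.
  have SM x : S x -> `|x| <= Mb + `|kappa h|.
    move=> [g [v [Wgv ->]]]; rewrite -(val _ _ Wgv) ck addrCA addrAC subrr add0r.
    by apply: le_trans (ler_normD _ _) _; rewrite lerD ?bM// urep_norm.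
  have [xi fix_xi] := almost_fixed_point arch conv S0 SM eta0.
  (* Subtracting this coboundary moves [xi] to the origin: for a block [b] with count [k], the
     vector [c *: k - kap b] is the displacement of [xi] under the affine isometry of the block. *)
  pose kap g := kappa g + xi - rho g xi.
  have ckap : cocycle rho kap.
    move=> g g'; rewrite /kap ck urep_mul linearB linearD /=.
    set A := rho g (kappa g'); set B := rho g xi; set D := rho g (rho g' xi).
    by rewrite !addrA (addrAC _ A xi) (addrAC _ (- B) A) subrK.
  have near b k : (forall g v, W (g, v) -> W (b * g,
    k + rho b v)%g) -> `|c *: k - kap b| <= eta.
    move=> Wb; pose A x := c *: k - kappa b + rho b x.
    have -> : c *: k - kap b = A xi - xi.
      by rewrite /A /kap !opprD opprK !addrA addrAC.
    apply: fix_xi.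
    - by move=> x y; rewrite /A opprD addrACA subrr add0r -linearB urep_norm.
    - move=> y; have [rb rbK rKb] := urep_bij rho b.
      by exists (rb (y - (c *: k - kappa b))); rewrite /A rKb addrC subrK.
    - move=> _ [g [v [Wgv ->]]]; exists (b * g)%g, (k + rho b v); split;
      first exact: Wb.
      by rewrite /A ck linearB linearZ scalerDr opprD /= addrACA.
  have near0 b : (forall g v, W (g, v) -> W (b * g, rho b v)%g) -> `|kap b| <= eta.
    by move=> Wb; have := near b 0; rewrite scaler0 sub0r normrN; apply=> g v /Wb;
      rewrite add0r.
  have ku : `|kap u| <= eta by apply: near0 => g v /Wcl[].
  have mid b : `|kap (u * b * u)%g| <= `|kap b| + eta *+ 2 /\
               `|kap b| <= `|kap (u * b * u)%g| + eta *+ 2.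
    rewrite ckap ckap; set x := rho u (kap b);
      have <- : `|x| = `|kap b| by rewrite urep_norm.
    have r2 : `|rho (u * b)%g (kap u)| <= eta by rewrite urep_norm.
    split.
      apply: le_trans (ler_normD _ _) _; rewrite mulr2n addrA lerD//.
      by apply: le_trans (ler_normD _ _) _; rewrite [leLHS]addrC lerD2l.
    have ex : x = (kap u + x + rho (u * b)%g (kap u)) - (kap u + rho (u * b)%g (kap u)).
      by rewrite opprD addrACA subrr addr0 addrC addKr.
    rewrite {1}ex; apply: le_trans (ler_normB _ _) _; rewrite lerD2l mulr2n.
    by apply: le_trans (ler_normD _ _) _; rewrite lerD.
  have kb b : b \in ps -> `|kap b| <= eta *+ 3.
    move=> bps; apply: le_trans (mid b).2 _; rewrite -[3%N]/(1 + 2)%N mulrnDr lerD2r.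
    by apply: near0 => g v /Wcl[_ /(_ b bps)].
  have kP : `|kap P| <= eta *+ (3 * size ps).
    by rewrite mulrnA; apply: cocycle_prod.
  (* One [eta] comes from this block, two from its separators, and three from each letter of [P]. *)
  have := near (u * P * u)%g (rho u e) (fun g v Wgv =>
    let: And3 _ _ w := Wcl g v Wgv in w).
  rewrite -normrZ -(urep_norm rho u (c *: e)) linearZ /= => h1.
  rewrite -[c *: _](subrK (kap (u * P * u)%g)) -[3%N]/(1 + 2)%N -addnA addnC mulrnDr
    addrC.
  apply: le_trans (ler_normD _ _) _; rewrite lerD//.
  by apply: le_trans (mid P).1 _; rewrite mulrnDr addrC lerD2l.
apply: contrapT => /eqP c0.
have ce : 0 < `|c| * `|e| by rewrite mulr_gt0// normr_gt0//; exact/eqP.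
pose m := (3 + 3 * size ps)%N.
have m0 : 0 < (m.+1%:R : K) by rewrite ltr0n.
have := small (`|c| * `|e| / m.+1%:R) (divr_gt0 ce m0).
rewrite -/m; set X := `|c| * `|e| in ce *.
by rewrite -[_ *+ m]mulr_natr -mulrA ler_pMr// ler_pdivlMl// mulr1 ler_nat ltnn.
Qed.

End Rigidity.

(** * Linear independence in the quotient *)

Section QuasiCocycleQuotient.
Context {K : numFieldType} {G : groupType} {V : normedModType K}.
Variable rho : unitary_rep G V.

Lemma lspan_bounded_cocycle (F : QC rho) : lspan [set F : QC rho | bounded_map F \/
  cocycle rho F] F ->
  exists beta kappa : G -> V, [/\ bounded_map beta, cocycle rho kappa &
    forall g, F g = beta g + kappa g].
Proof.
have zb : bounded_map (fun _ : G => 0 : V) by exists 0 => g; rewrite normr0.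
have zc : cocycle rho (fun _ => 0) by move=> g h; rewrite linear0 addr0.
pose S : set (QC rho) := [set F | exists beta kappa : G -> V, [/\ bounded_map beta,
  cocycle rho kappa &
    forall g, F g = beta g + kappa g]].
move=> /(_ S); apply.
  split; first by apply/mem_set; exists (fun _ => 0), (fun _ => 0); split=> // g;
    rewrite addr0.
  move=> c F1 F2 /set_mem [b1 [k1 [[M1 hM1] c1 e1]]] /set_mem [b2 [k2 [[M2 hM2] c2
    e2]]].
  apply/mem_set; exists (fun g => c *: b1 g + b2 g), (fun g => c *: k1 g + k2 g); split.
  - exists (`|c| * M1 + M2) => g; apply: le_trans (ler_normD _ _) _; rewrite lerD//.
    by rewrite normrZ ler_wpM2l.
  - by move=> g h; rewrite c1 c2 linearP scalerDr addrACA.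
  - move=> g; have -> : (c *: F1 + F2) g = c *: F1 g + F2 g by [].
    by rewrite e1 e2 scalerDr addrACA.
move=> F1 [bF|cF]; [exists F1, (fun _ => 0) | exists (fun _ => 0), F1];
  by split=> // g; rewrite ?addr0 ?add0r.
Qed.

Lemma infinite_dimensional_QCtilde : (forall n, exists F : 'I_n -> G -> V,
  (forall i, quasi_cocycle rho (F i)) /\ forall c : 'I_n -> K,
  forall beta kappa : G -> V, bounded_map beta -> cocycle rho kappa ->
  (forall g, \sum_(i < n) c i *: F i g = beta g + kappa g) -> forall i, c i = 0) ->
  infinite_dimensional (QCtilde rho).
Proof.
move=> H n; have [F [qF indep]] := H n.
pose Q i : QC rho := MkQC (asboolT (qF i)).
exists (fun i => lmod_quot_pi [set F : QC rho | bounded_map F \/ cocycle rho F] (Q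
  i)) => c e.
have E g : (\sum_(i < n) c i *: Q i : QC rho) g = \sum_(i < n) c i *: F i g.
  by elim/big_rec2: _ => [//|i y1 y2 _ <-].
have : lspan [set F : QC rho | bounded_map F \/ cocycle rho F] (\sum_(i < n) c i *: Q
  i - 0).
  apply/lmod_quot_pi_eq.
  have L := @lmod_quot_pi_is_linear K (QC rho) [set F : QC rho | bounded_map F \/
    cocycle rho F].
  have L0 : lmod_quot_pi [set F : QC rho | bounded_map F \/ cocycle rho F] 0 = 0.
    by have := L (-1) 0 0; rewrite scaler0 addr0 scaleN1r addNr.
  by rewrite L0 -e; elim/big_rec2: _ => [//|i y1 y2 _ <-]; rewrite L.
rewrite subr0 => /lspan_bounded_cocycle [beta [kappa [bb ck ebk]]].
by apply: (indep c beta kappa bb ck) => g; rewrite -E ebk.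
Qed.

End QuasiCocycleQuotient.

Theorem corollary1p2 (R : realType) (K : numFieldType)
  (hK : K = R :> numFieldType \/ K = R[i] :> numFieldType)
  (G : groupType) (hG : acylindrically_hyperbolic R G)
  (E : completeNormedModType K) (hE : uniformly_convex E)
  (hE0 : exists x : E, x <> 0)
  (rho : unitary_rep G E)
  (N : set G) (hN : maximal_finite_normal_subgroup N)
  (hfix : exists2 x : E, x <> 0 & forall k, N k -> rho k x = x) :
  infinite_dimensional (QCtilde rho).
Proof.
have [X [act [geo [delta hyp] act_isom acyl nonel]]] := hG.
have [e e0 Ne] := hfix.
(* A point of the limit set provides the base point. *)
have [_ [_ [_ [[[_ [x0 _]] _ _] _]]]] := not_card_le2 nonel.
have [f [C [fC fL]]] := loxodromic_ex x0 hyp act_isom nonel.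
have [t Et] := outside_commens_ex hyp act_isom nonel fC fL.
apply: infinite_dimensional_QCtilde => n.
have [F [qF H]] := counting_family hyp geo act_isom acyl fC fL n hN Ne Et.
exists F; split=> // c beta kappa bb ck ebk q.
have [u [ps [h [W [W1 Wcl val]]]]] := H q.
(* On the words for [q] the combination reduces to [c q] times the count, so rigidity applies to one
   coefficient at a time. *)
apply: (cocycle_rigidity (h := h) (norm_le_nat hK) hE W1 Wcl bb ck _ e0) => g v Wgv.
have [Fq Fi] := val g v Wgv.
rewrite -ebk (bigD1 q) //= Fq big1 ?addr0// => i iq.
by rewrite Fi ?scaler0.
Qed.
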